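(* The problem $4$-SAT/2-FLIP with lexicographic payoffs and forbidden flips is PLS-complete, and this is witnessed by a tight PLS-reduction from FLIP.
   Context: $4$-SAT/2-FLIP with lexicographic payoffs and forbidden flips: the input is a CNF formula $F=C_1\wedge\dots\wedge C_t$ over variable set $V$, each clause with at most $4$ literals, clause $C_i$ having weight $2^{t-i}$, together with an explicit set $L\subseteq\binom{V}{2}$ of pairs of variables that may not be flipped simultaneously. The payoff of an assignment is the total weight of satisfied clauses. The neighbors of an assignment $\alpha$ are the assignments obtained by changing one variable, or two variables $\{x,y\}\notin L$; one must find an assignment with no neighbor of strictly larger payoff. FLIP: given a Boolean circuit $C$ with $n$ inputs and $m$ outputs, the solutions are inputs $x\in\{0,1\}^n$ with cost $C(x)$ read as a binary number (first output most significant), neighbors of $x$ are the $x\oplus e_i$, and one must find an $x$ whose output is not lexicographically smaller than that of any neighbor (local maximum). A PLS-reduction from $P$ to $Q$ is a pair of polynomial-time functions $(f,g)$, $f$ mapping instances $I$ of $P$ to instances $f(I)$ of $Q$ and $g$ mapping solutions $s$ of $f(I)$ to solutions $g(I,s)$ of $I$ such that local optima map to local optima. The transition graph $TG(I)$ has the feasible solutions of $I$ as vertices and an edge $(u,v)$ whenever $v$ is a neighbor of $u$. The reduction is tight if for every instance $I$ of $P$ there is a set $\mathcal{R}$ of feasible solutions of $f(I)$ such that (1) $\mathcal{R}$ contains all local optima of $f(I)$; (2) for every solution $s$ of $I$ one can construct in polynomial time a solution $t$ of $f(I)$ with $g(I,t)=s$; (3) whenever $TG(f(I))$ has a path from $q$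 to $q'$ whose only vertices in $\mathcal{R}$ are $q$ and $q'$, either $g(I,q)=g(I,q')$ or $TG(I)$ has an edge from $g(I,q)$ to $g(I,q')$. PLS-completeness is with respect to PLS-reductions. *)

(* Defs.v *)
From mathcomp Require Import all_boot.
Set Implicit Arguments.
Unset Strict Implicit.
Unset Printing Implicit Defensive.

Notation bits := (seq bool).

Inductive move := Left | Stay | Right.

(* Tape alphabet: blank is [None], input and output symbols are
   [Some (inl b)], further work symbols are [Some (inr w)]. *)
Definition symbol (W : finType) : finType := option (bool + W)%type.

Record tm := TM {
  tm_work_tapes : nat;
  tm_state : finType;
  tm_work : finType;
  tm_start : tm_state;
  tm_final : pred tm_state;
  tm_delta : tm_state -> {ffun 'I_tm_work_tapes.+1 -> symbol tm_work} ->
             tm_state * {ffun 'I_tm_work_tapes.+1 -> symbol tm_work * move}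
}.

(* [(l, r)]: the head scans the first cell of [r]; [l] lists the cells to its
   left, nearest first; all cells not listed are blank. *)
Definition tape (W : finType) : Type := (seq (symbol W) * seq (symbol W))%type.

Definition tape_read (W : finType) (t : tape W) : symbol W := head None t.2.

Definition tape_write_move (W : finType) (t : tape W)
    (am : symbol W * move) : tape W :=
  let: (l, r) := t in
  let: (a, m) := am in
  match m with
  | Left => (behead l, head None l :: a :: behead r)
  | Stay => (l, a :: behead r)
  | Right => (a :: l, behead r)
  end.

Definition tm_config (M : tm) : Type :=
  (tm_state M * {ffun 'I_(tm_work_tapes M).+1 -> tape (tm_work M)})%type.

Definition tm_init (M : tm) (w : bits) : tm_config M :=
  (tm_start M,
   [ffun i : 'I_(tm_work_tapes M).+1 =>
      if i == ord0 then ([::], [seq Some (inl b) | b <- w]) else ([::], [::])]).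

Definition tm_step (M : tm) (c : tm_config M) : tm_config M :=
  if tm_final c.1 then c else
  let: (q, act) := tm_delta c.1 [ffun i => tape_read (c.2 i)] in
  (q, [ffun i => tape_write_move (c.2 i) (act i)]).

Fixpoint leading_bits (W : finType) (r : seq (symbol W)) : bits :=
  if r is Some (inl b) :: r' then b :: leading_bits r' else [::].

(* The output is the maximal block of bits starting at the head of tape 0. *)
Definition tm_run (M : tm) (w : bits) (T : nat) : option bits :=
  let c := iter T (@tm_step M) (tm_init M w) in
  if tm_final c.1 then Some (leading_bits (c.2 ord0).2) else None.

(* [F] is computed in polynomial time on the inputs [a] satisfying [D], which
   are given to the machine as [e a]; every polynomial in [n] is bounded by
   [n ^ k + k] for some [k]. *)
Definition polytime (A : Type) (D : A -> Prop) (e : A -> bits) (F : A -> bits)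
    : Prop :=
  exists (M : tm) (k : nat), forall a : A, D a ->
    tm_run M (e a) (size (e a) ^ k + k) = Some (F a).

(* Most significant bit first. *)
Definition bin_val (b : bits) : nat := foldl (fun n (d : bool) => n.*2 + d) 0 b.

Definition enc_pair (u v : bits) : bits :=
  flatten [seq [:: true; b] | b <- u] ++ false :: v.

Definition enc_nat (n : nat) : bits := rcons (nseq n true) false.

Definition enc_seq (A : Type) (e : A -> bits) (s : seq A) : bits :=
  rcons (flatten [seq true :: e x | x <- s]) false.

Record ls_problem := LSProblem {
  ls_inst : Type;
  ls_enc : ls_inst -> bits;
  ls_sol : ls_inst -> pred bits;
  ls_max : bool; (* maximization or minimization *)
  ls_payoff : ls_inst -> bits -> nat;
  ls_nbr : ls_inst -> bits -> bits -> Prop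
}.

Definition enc_inst_sol (P : ls_problem) (p : ls_inst P * bits) : bits :=
  enc_pair (ls_enc p.1) p.2.

(* The transition graph: as defined here, its edges lead to all neighbors, not
   only to strictly better ones. *)
Definition TG (P : ls_problem) (I : ls_inst P) (u v : bits) : Prop :=
  [/\ ls_sol I u, ls_sol I v & ls_nbr I u v].

Definition better (P : ls_problem) (I : ls_inst P) (s s' : bits) : bool :=
  if ls_max P then ls_payoff I s < ls_payoff I s'
  else ls_payoff I s' < ls_payoff I s.

Definition local_opt (P : ls_problem) (I : ls_inst P) (s : bits) : Prop :=
  ls_sol I s /\ forall s', TG I s s' -> ~~ better I s s'.

Definition enc_option (o : option bits) : bits :=
  if o is Some s then true :: s else [:: false].

(* As in Johnson, Papadimitriou and Yannakakis: recognizable instances and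
   solutions, short solutions, and the three algorithms (initial solution,
   payoff, better neighbor or certificate of local optimality). *)
Record in_PLS (P : ls_problem) : Prop := InPLS {
  pls_enc_inj : injective (@ls_enc P);
  pls_inst_dec : exists dec : bits -> bool,
    polytime (fun=> True) id (fun w => [:: dec w]) /\
    forall w, dec w <-> exists I : ls_inst P, ls_enc I = w;
  pls_sol_size : exists k : nat, forall (I : ls_inst P) s,
    ls_sol I s -> size s <= size (ls_enc I) ^ k + k;
  pls_sol_dec :
    polytime (fun=> True) (@enc_inst_sol P) (fun p => [:: ls_sol p.1 p.2]);
  pls_start : exists start : ls_inst P -> bits,
    polytime (fun=> True) (@ls_enc P) start /\
    forall I, ls_sol I (start I);
  pls_payoff : exists val : ls_inst P -> bits -> bits,
    polytime (fun p => ls_sol p.1 p.2) (@enc_inst_sol P)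
             (fun p => val p.1 p.2) /\
    forall I s, ls_sol I s -> bin_val (val I s) = ls_payoff I s;
  pls_improve : exists next : ls_inst P -> bits -> option bits,
    polytime (fun p => ls_sol p.1 p.2) (@enc_inst_sol P)
             (fun p => enc_option (next p.1 p.2)) /\
    forall I s, ls_sol I s ->
      if next I s is Some s' then TG I s s' /\ better I s s'
      else local_opt I s
}.

Record pls_reduction (P Q : ls_problem) (f : ls_inst P -> ls_inst Q)
    (g : ls_inst P -> bits -> bits) : Prop := PLSReduction {
  red_f_poly : polytime (fun=> True) (@ls_enc P) (fun I => ls_enc (f I));
  red_g_poly : polytime (fun p => ls_sol (f p.1) p.2)
    (fun p => enc_pair (ls_enc p.1) p.2) (fun p => g p.1 p.2);
  red_g_sol : forall I s, ls_sol (f I) s -> ls_sol I (g I s);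
  red_local_opt : forall I s, local_opt (f I) s -> local_opt I (g I s)
}.

Definition PLS_complete (Q : ls_problem) : Prop :=
  in_PLS Q /\
  forall P : ls_problem, in_PLS P -> exists f g, @pls_reduction P Q f g.

Fixpoint TG_path (P : ls_problem) (I : ls_inst P) (u : bits) (p : seq bits)
    : Prop :=
  if p is v :: p' then TG I u v /\ TG_path I v p' else True.

(* [h] is the polynomial-time construction of a preimage under [g]. *)
Definition tight (P Q : ls_problem) (f : ls_inst P -> ls_inst Q)
    (g : ls_inst P -> bits -> bits) : Prop :=
  exists h : ls_inst P -> bits -> bits,
    polytime (fun p => ls_sol p.1 p.2) (@enc_inst_sol P)
             (fun p => h p.1 p.2) /\
    forall I : ls_inst P, exists R : bits -> Prop,
      [/\ forall q, R q -> ls_sol (f I) q,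
          forall q, local_opt (f I) q -> R q,
          forall s, ls_sol I s -> ls_sol (f I) (h I s) /\ g I (h I s) = s
        & forall q p q', R q -> R q' -> (forall v, v \in p -> ~ R v) ->
            TG_path (f I) q (rcons p q') ->
            g I q = g I q' \/ TG I (g I q) (g I q')].

Definition flip (i : nat) (s : bits) : bits :=
  set_nth false s i (~~ nth false s i).

(* Wires [0 .. n-1] are the inputs of the circuit and wire [n + j] is the
   output of its [j]-th gate. *)
Inductive gate := GNot of nat | GAnd of nat & nat | GOr of nat & nat.

Record circuit := Circuit {
  c_inputs : nat;
  c_gates : seq gate;
  c_outputs : seq nat
}.

Definition gate_reads_below (b : nat) (g : gate) : bool :=
  match g with
  | GNot i => i < b
  | GAnd i j | GOr i j => (i < b) && (j < b)
  end.

Definition circuit_wf (c : circuit) : bool :=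
  all (fun j => gate_reads_below (c_inputs c + j) (nth (GNot 0) (c_gates c) j))
      (iota 0 (size (c_gates c)))
  && all (fun o => o < c_inputs c + size (c_gates c)) (c_outputs c).

Definition gate_eval (v : bits) (g : gate) : bool :=
  match g with
  | GNot i => ~~ nth false v i
  | GAnd i j => nth false v i && nth false v j
  | GOr i j => nth false v i || nth false v j
  end.

Definition circuit_eval (c : circuit) (x : bits) : bits :=
  let wires := foldl (fun v g => rcons v (gate_eval v g)) x (c_gates c) in
  [seq nth false wires o | o <- c_outputs c].

(* Wire and variable numbers are written in unary: they are bounded by the
   number of wires (variables), so this changes sizes only polynomially. *)
Definition enc_gate (g : gate) : bits :=
  match g with
  | GNot i => false :: enc_nat i
  | GAnd i j => [:: true, false & enc_nat i ++ enc_nat j]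
  | GOr i j => [:: true, true & enc_nat i ++ enc_nat j]
  end.

Definition enc_circuit (c : circuit) : bits :=
  enc_nat (c_inputs c) ++ enc_seq enc_gate (c_gates c)
  ++ enc_seq enc_nat (c_outputs c).

Definition FLIP : ls_problem := {|
  ls_inst := {c : circuit | circuit_wf c};
  ls_enc := fun I => enc_circuit (sval I);
  ls_sol := fun I x => size x == c_inputs (sval I);
  ls_max := true;
  ls_payoff := fun I x => bin_val (circuit_eval (sval I) x);
  ls_nbr := fun I x x' =>
    exists2 i, i < c_inputs (sval I) & x' = flip i x
|}.

(* [(x, b)] is the literal satisfied by the assignments with [x = b]. *)
Definition literal : Type := (nat * bool)%type.

Record sat_instance := SatInstance {
  sat_vars : nat;
  sat_clauses : seq (seq literal);
  sat_forbidden : seq (nat * nat) (* {x, y} with x < y is listed as (x, y) *)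
}.

Definition sat_wf (F : sat_instance) : bool :=
  all (fun C : seq literal =>
         (size C <= 4) && all (fun l : literal => l.1 < sat_vars F) C)
      (sat_clauses F)
  && all (fun xy : nat * nat => xy.1 < xy.2 < sat_vars F) (sat_forbidden F).

Definition clause_sat (a : bits) (C : seq literal) : bool :=
  has (fun l : literal => nth false a l.1 == l.2) C.

(* The exponent is [t - i] for clauses numbered from 1. *)
Definition sat_payoff (F : sat_instance) (a : bits) : nat :=
  \sum_(i < size (sat_clauses F) | clause_sat a (nth [::] (sat_clauses F) i))
     2 ^ (size (sat_clauses F) - i.+1).

Definition sat_nbr (F : sat_instance) (a a' : bits) : Prop :=
  (exists2 x, x < sat_vars F & a' = flip x a) \/
  (exists x y, [/\ x < y, y < sat_vars F, (x, y) \notin sat_forbidden F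
                 & a' = flip x (flip y a)]).

Definition enc_literal (l : literal) : bits := l.2 :: enc_nat l.1.

Definition enc_sat (F : sat_instance) : bits :=
  enc_nat (sat_vars F) ++ enc_seq (enc_seq enc_literal) (sat_clauses F)
  ++ enc_seq (fun xy => enc_nat xy.1 ++ enc_nat xy.2) (sat_forbidden F).

Definition SAT4_2FLIP : ls_problem := {|
  ls_inst := {F : sat_instance | sat_wf F};
  ls_enc := fun I => enc_sat (sval I);
  ls_sol := fun I a => size a == sat_vars (sval I);
  ls_max := true;
  ls_payoff := fun I => sat_payoff (sval I);
  ls_nbr := fun I => sat_nbr (sval I)
|}.

(* Main.v *)
Require Import Defs.
From mathcomp Require Import all_boot zify.
Set Implicit Arguments.
Unset Strict Implicit.
Unset Printing Implicit Defensive.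

(** Polynomial time is handled through a class of functions on binary trees,
    closed under composition, case analysis and size-bounded iteration, which
    is shown to coincide with the functions of polynomial-time Turing machines.

    Both reductions are instances of one construction.  Suppose that a
    polynomial-time function maps a string [w] of [n] bits to a value [V w] and
    a string [S w] such that [V w < V (S w)] unless [S w = w].  A tableau turns
    it into a circuit of selection gates.  The formula contains two registers,
    each with its own copy of the circuit, a control variable [u] that selects
    the active register, value bits [v] and a visible copy [x] of the active
    input.  Clauses are ordered so that a local optimum first makes the gates of
    the active register correct, then sets [v] to the value of the active
    input, then loads its successor into the inactive register, then makes the
    gates of the inactive register correct, and finally copies the active input
    to [x]; the control literal is the fourth literal of a gate clause.  If the
    successor differs from the active input, then flipping [u] together with
    the first value bit in which the two values differ is an improvement.  Hence
    [S x = x] at every local optimum.  For FLIP, forbidding the simultaneous flip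
    of two variables of [x] makes the reduction tight, every assignment being
    put in the set of reasonable solutions. *)

(** * Stack machines *)

(** A move changes at most two bits, so it cannot replace the input of a circuit and also recompute
    the gates. This is why there are two registers: the successor and its value are computed in
    advance by lighter clauses, and changing [u] makes the finished computation the active one.
    Changing [u] alone gains no value bit and may violate the clauses of later bits; changing also
    the first differing bit, from 0 to 1, gains a clause heavier than every possible loss.

    Apart from single flips, only the pairs made of [u] and a value bit are needed to leave an
    assignment that is not optimal. So all pairs inside [x] can be forbidden without creating
    unwanted local optima, and then every move changes at most one bit of [x], which is what
    tightness requires.

    Hardness does not pass through FLIP: an arbitrary problem in PLS enters the same construction,
    with solutions padded to a common length, invalid strings read as the initial solution, and
    values complemented for minimization. *)

Notation sym := (bool + unit)%type.
Notation mark := (inr tt : sym).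

Definition stacks : Type := (seq sym * seq sym * seq sym)%type.

Definition i0 : 'I_3 := @Ordinal 3 0 isT.
Definition i1 : 'I_3 := @Ordinal 3 1 isT.
Definition i2 : 'I_3 := @Ordinal 3 2 isT.

Definition get (i : 'I_3) (s : stacks) : seq sym :=
  match val i with 0 => s.1.1 | 1 => s.1.2 | _ => s.2 end.

Definition put (i : 'I_3) (x : seq sym) (s : stacks) : stacks :=
  match val i with
  | 0 => (x, s.1.2, s.2) | 1 => (s.1.1, x, s.2) | _ => (s.1.1, s.1.2, x)
  end.

Lemma get_put i j x s : get j (put i x s) = if j == i then x else get j s.
Proof.
by case: i j s => [[|[|[|i]]] hi] [[|[|[|j]]] hj] [[a b] c].
Qed.

Lemma put_put i x y s : put i x (put i y s) = put i x s.
Proof. by case: i s => [[|[|[|i]]] hi] [[a b] c]. Qed.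

Lemma put_get i s : put i (get i s) s = s.
Proof. by case: i s => [[|[|[|i]]] hi] [[a b] c]. Qed.

Lemma putC i j x y s : i != j -> put i x (put j y s) = put j y (put i x s).
Proof.
by case: i j s => [[|[|[|i]]] hi] [[|[|[|j]]] hj] [[a b] c].
Qed.

Inductive instr (Q : Type) :=
| INop of option Q
| IPush of 'I_3 & sym & option Q
| IPop of 'I_3 & (option sym -> option Q).

Definition imap Q Q' (h : option Q -> option Q') (c : instr Q) : instr Q' :=
  match c with
  | INop k => INop (h k)
  | IPush i a k => IPush i a (h k)
  | IPop i k => IPop i (fun a => h (k a))
  end.

Definition istep Q (c : instr Q) (s : stacks) : option Q * stacks :=
  match c with
  | INop k => (k, s)
  | IPush i a k => (k, put i (a :: get i s) s)
  | IPop i k => (k (ohead (get i s)), put i (behead (get i s)) s)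
  end.

Lemma istep_map Q Q' (h : option Q -> option Q') c s :
  istep (imap h c) s = (h (istep c s).1, (istep c s).2).
Proof. by case: c. Qed.

Record fm := FM { fQ : finType; fstart : fQ; fcode : fQ -> instr fQ }.

(* [exec code o s t s']: from control state [o] ([None] is the exit) the
   exit is reached with stacks [s'] after at most [t] instructions. *)
Inductive exec Q (code : Q -> instr Q) :
    option Q -> stacks -> nat -> stacks -> Prop :=
| ExDone s t : exec code None s t s
| ExStep q s t s' :
    exec code (istep (code q) s).1 (istep (code q) s).2 t s' ->
    exec code (Some q) s t.+1 s'.

Lemma exec_mono Q (code : Q -> instr Q) o s t s' :
  exec code o s t s' -> forall t', t <= t' -> exec code o s t' s'.
Proof.
elim=> {o s t s'} [s t t' _|q s t s' _ IH [//|t'] le]; first exact: ExDone.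
by apply: ExStep; apply: IH.
Qed.

(** The exit of the embedded machine is redirected to the control point [k], where the second run
    takes over. The run lemmas of both combinators follow from it. *)
Lemma exec_embed Q1 Q2 (code1 : Q1 -> instr Q1) (code2 : Q2 -> instr Q2)
    (e : Q1 -> Q2) (k : option Q2) o s t s1 t2 s2 :
  (forall q, code2 (e q) =
     imap (fun o => if o is Some q' then Some (e q') else k) (code1 q)) ->
  exec code1 o s t s1 -> exec code2 k s1 t2 s2 ->
  exec code2 (if o is Some q then Some (e q) else k) s (t + t2) s2.
Proof.
move=> He; elim=> {o s t s1} [s t E|q s t s' _ IH E].
  exact: exec_mono E _ (leq_addl _ _).
by rewrite addSn; apply: ExStep; rewrite He istep_map; apply: IH.
Qed.

Definition runs (M : fm) := exec (@fcode M) (Some (fstart M)).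

Lemma runs_mono M s t s' t' : runs M s t s' -> t <= t' -> runs M s t' s'.
Proof. by move=> H; apply: exec_mono. Qed.

Definition MSkip : fm := @FM unit tt (fun=> INop None).
Definition MPush i a : fm := @FM unit tt (fun=> IPush i a None).

Definition MSeq (M1 M2 : fm) : fm :=
  @FM (fQ M1 + fQ M2)%type (inl (fstart M1))
    (fun q => match q with
       | inl q => imap (fun o => if o is Some q' then Some (inl q')
                                else Some (inr (fstart M2))) (fcode q)
       | inr q => imap (omap inr) (fcode q)
       end).

(** The popped symbol stays in the control state as the tag of the running body, so that it is still
    known when the decision to continue is made. With [cont] constantly false the loop is a case
    analysis. *)
Definition MLoop (i : 'I_3) (M : option sym -> fm) (cont : option sym -> bool)
    : fm :=
  @FM (option {a : option sym & fQ (M a)}) None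
    (fun q => match q with
       | None => IPop i (fun a => Some (Some (Tagged (fun a => fQ (M a))
                                               (fstart (M a)))))
       | Some (existT a q) =>
         imap (fun o => if o is Some q'
                        then Some (Some (Tagged (fun a => fQ (M a)) q'))
                        else if cont a then Some None else None) (fcode q)
       end).

Definition MCase i M := MLoop i M xpred0.

Lemma runs_skip s : runs MSkip s 1 s.
Proof. by apply: ExStep; exact: ExDone. Qed.

Lemma runs_push i a s : runs (MPush i a) s 1 (put i (a :: get i s) s).
Proof. by apply: ExStep; exact: ExDone. Qed.

Lemma runs_seq M1 M2 s t1 s1 t2 s2 :
  runs M1 s t1 s1 -> runs M2 s1 t2 s2 -> runs (MSeq M1 M2) s (t1 + t2) s2.
Proof.
move=> H1 H2.
have H2' : exec (@fcode (MSeq M1 M2)) (Some (inr (fstart M2))) s1 (t2 + 0) s2.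
  apply: (exec_embed (e := inr) (k := None) _ H2 (ExDone _ _ _)).
  by move=> q /=.
rewrite addn0 in H2'.
apply: (exec_embed (e := inl) (k := Some (inr (fstart M2))) _ H1 H2').
by move=> q /=.
Qed.

Section Loop.
Variables (i : 'I_3) (M : option sym -> fm) (cont : option sym -> bool).

Lemma runs_loop_body s t s1 t' s2 (a := ohead (get i s)) :
  runs (M a) (put i (behead (get i s)) s) t s1 ->
  exec (@fcode (MLoop i M cont)) (if cont a then Some None else None) s1 t' s2 ->
  runs (MLoop i M cont) s (t + t').+1 s2.
Proof.
move=> H1 H2; apply: ExStep => /=; rewrite -/a.
apply: (exec_embed (e := fun q => Some (Tagged (fun a => fQ (M a)) q)) _ H1 H2).
by move=> q /=.
Qed.

Lemma runs_loop_exit s t s1 (a := ohead (get i s)) :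
  cont a = false -> runs (M a) (put i (behead (get i s)) s) t s1 ->
  runs (MLoop i M cont) s t.+1 s1.
Proof.
move=> ca H; rewrite -[t]addn0; apply: runs_loop_body H _.
by rewrite ca; exact: ExDone.
Qed.

Lemma runs_loop_cont s t s1 t' s2 (a := ohead (get i s)) :
  cont a -> runs (M a) (put i (behead (get i s)) s) t s1 ->
  runs (MLoop i M cont) s1 t' s2 -> runs (MLoop i M cont) s (t + t').+1 s2.
Proof. by move=> ca H1 H2; apply: runs_loop_body H1 _; rewrite ca. Qed.

End Loop.

Definition stacks_size (s : stacks) := size s.1.1 + size s.1.2 + size s.2.

(** An instruction pushes at most one symbol. This turns time bounds into bounds on the size of
    results. *)
Lemma exec_size Q (code : Q -> instr Q) o s t s' :
  exec code o s t s' -> stacks_size s' <= stacks_size s + t.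
Proof.
elim=> {o s t s'} [s t|q s t s' _ IH]; first by rewrite leq_addr.
apply: leq_trans IH _; rewrite addnS -addSn leq_add2r.
case: (code q) => [k|i a k|i k] //=; rewrite /stacks_size /put /get.
  by case: (val i) => [|[|?]] /=; lia.
by case: (val i) => [|[|?]] /=; rewrite size_behead; lia.
Qed.

(** * Compilation of stack machines to Turing machines *)

Section Compile.
Variable M : fm.

(* A push takes two steps: move left, then write the pending symbol. *)
Definition ctm_state : finType := (option (fQ M) * option ('I_3 * sym))%type.

Definition ctm_delta (st : ctm_state) (rd : {ffun 'I_3 -> symbol unit}) :
    ctm_state * {ffun 'I_3 -> symbol unit * move} :=
  match st.2 with
  | Some ia => ((st.1, None),
      [ffun j => (if j == ia.1 then Some ia.2 else rd j, Stay)])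
  | None =>
    match st.1 with
    | None => (st, [ffun j => (rd j, Stay)])
    | Some q =>
      match fcode q with
      | INop k => ((k, None), [ffun j => (rd j, Stay)])
      | IPush i a k => ((k, Some (i, a)),
          [ffun j => (rd j, if j == i then Left else Stay)])
      | IPop i k => ((k (rd i), None),
          [ffun j => (rd j, if j == i then Right else Stay)])
      end
    end
  end.

Definition ctm : tm :=
  @TM 2 ctm_state unit (Some (fstart M), None) (pred1 (None, None)) ctm_delta.

(** The cells to the left of the head are left free: a pop leaves its symbol there, and a push
    overwrites whatever it finds. Trailing blanks appear when an empty stack is read. *)
Definition tape_rep (t : tape unit) (s : seq sym) : Prop :=
  exists j, t.2 = map Some s ++ nseq j None.

Lemma tape_rep_read t s : tape_rep t s -> tape_read t = ohead s.
Proof. by rewrite /tape_read => -[j ->]; case: s => //=; case: j. Qed.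

Lemma tape_rep_stay t s :
  tape_rep t s -> tape_rep (tape_write_move t (tape_read t, Stay)) s.
Proof.
case: t => l r [j /= ->]; case: s => [|a s] /=; last by exists j.
by case: j => [|j]; [exists 1|exists j.+1].
Qed.

Lemma tape_rep_right t s :
  tape_rep t s -> tape_rep (tape_write_move t (tape_read t, Right)) (behead s).
Proof.
case: t => l r [j /= ->]; case: s => [|a s] /=; last by exists j.
by exists j.-1; case: j.
Qed.

Lemma tape_rep_push t s a : tape_rep t s ->
  tape_rep (tape_write_move (tape_write_move t (tape_read t, Left))
              (Some a, Stay)) (a :: s).
Proof.
case: t => l r [j /= ->]; rewrite /tape_rep /=; case: s => [|b s] /=.
  by case: j => [|j]; [exists 1|exists j.+1].
by exists j.
Qed.

Definition tapes_rep (tp : {ffun 'I_3 -> tape unit}) (s : stacks) : Prop :=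
  forall i, tape_rep (tp i) (get i s).

(** The factor 2 pays for pushes. Any larger [T] will do, since a halted configuration is
    stationary. *)
Lemma ctm_exec o s t s' : exec (@fcode M) o s t s' ->
  forall T tp, 2 * t <= T -> tapes_rep tp s -> exists2 tp',
    iter T (@tm_step ctm) ((o, None), tp) = ((None, None), tp') &
    tapes_rep tp' s'.
Proof.
elim=> {o s t s'} [s t T tp _ rp|q s t s' _ IH [|[|T]] tp le rp].
- exists tp => //; by elim: T => //= T ->.
- by lia.
- by lia.
have leT : 2 * t <= T by lia.
rewrite iterSr.
set c1 := tm_step _.
have Ec1 : c1 = (let: (q', act) := ctm_delta (Some q, None)
                     [ffun i => tape_read (tp i)] in
  (q', [ffun i => tape_write_move (tp i) (act i)])) by [].
rewrite {c1}Ec1 /ctm_delta /=.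
case E: (fcode q) IH => [k|i a k|i k] IH; rewrite ?E /= in IH *.
- apply: (IH T.+1); first by lia.
  by move=> j; rewrite !ffunE; apply: tape_rep_stay.
- rewrite -iterS iterSr {2}/tm_step /= xpair_eqE andbF /=.
  apply: (IH T) => // j; rewrite !ffunE /= get_put.
  case: eqP => [->|ne].
    by apply: tape_rep_push.
  by apply: tape_rep_stay; exact: tape_rep_stay.
- rewrite ffunE (tape_rep_read (rp i)).
  apply: (IH T.+1); first by lia.
  move=> j; rewrite !ffunE /= get_put; case: eqP => [->|ne].
    exact: tape_rep_right.
  exact: tape_rep_stay.
Qed.

Lemma leading_bits_rep (b : bits) j :
  @leading_bits unit (map Some (map inl b) ++ nseq j None) = b.
Proof. by elim: b => [|a b IH] /=; [case: j|rewrite IH]. Qed.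

Lemma ctm_run w t b T : runs M (map inl w, [::], [::]) t (map inl b, [::], [::]) ->
  2 * t <= T -> tm_run ctm w T = Some b.
Proof.
move=> H le; have [|tp' E rp] := ctm_exec H (tp := (tm_init ctm w).2) le.
  move=> i; rewrite /tm_init /= ffunE; exists 0; rewrite cats0.
  by case: i => [[|[|[|i]]] hi] //=; rewrite -map_comp.
rewrite /tm_run; move: E; rewrite /tm_init /= => -> /=.
have [j ->] := rp ord0.
by rewrite leading_bits_rep.
Qed.

End Compile.

(** * Data as binary trees and polynomial-time functions *)

Inductive btree := Lf | Nd of btree & btree.

Fixpoint ser (x : btree) : bits :=
  if x is Nd a b then true :: ser a ++ ser b else [:: false].

Notation SS x := (map (inl : bool -> sym) (ser x)).

Definition vsz x := size (ser x).

Lemma vszN a b : vsz (Nd a b) = (vsz a + vsz b).+1.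
Proof. by rewrite /vsz /= size_cat. Qed.

Lemma vsz_gt0 a : 0 < vsz a.
Proof. by case: a. Qed.

(** * Stack routines on serialized trees *)

Definition MTr i j : fm :=
  MLoop i (fun a => if a is Some (inl b) then MPush j (inl b) else MSkip)
        (fun a => if a is Some (inl _) then true else false).

Lemma runs_tr i j s w r : i != j -> get i s = map inl w ++ mark :: r ->
  runs (MTr i j) s (2 * size w + 2)
    (put i r (put j (rev (map inl w) ++ get j s) s)).
Proof.
move=> ij; elim: w s => [|b w IH] s E.
  have -> : put i r (put j (rev (map inl [::]) ++ get j s) s)
         = put i (behead (get i s)) s by rewrite E put_get.
  by apply: runs_loop_exit; rewrite E //=; exact: runs_skip.
have -> : 2 * size (b :: w) + 2 = (1 + (2 * size w + 2)).+1 by rewrite /=; lia.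
apply: runs_loop_cont; rewrite ?E //=; first exact: runs_push.
set s1 := put j _ _.
have -> : put i r (put j (rev (inl b :: map inl w) ++ get j s) s) =
   put i r (put j (rev (map inl w) ++ get j s1) s1).
  rewrite /s1 !get_put eqxx eq_sym (negbTE ij) put_put rev_cons cat_rcons.
  by rewrite (putC _ _ _ (_ : j != i)) 1?eq_sym // put_put.
by apply: IH; rewrite /s1 !get_put (negbTE ij) eqxx.
Qed.

Definition MDel1 : fm :=
  MLoop i1 (fun=> MSkip)
        (fun a => if a is Some (inl _) then true else false).

Lemma runs_del1 s0 w r1 s2 :
  runs MDel1 (s0, map inl w ++ mark :: r1, s2) (2 * size w + 2) (s0, r1, s2).
Proof.
elim: w => [|b w IH]; first by apply: runs_loop_exit => //; exact: runs_skip.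
have -> : 2 * size (b :: w) + 2 = (1 + (2 * size w + 2)).+1 by rewrite /=; lia.
by apply: runs_loop_cont => //; [exact: runs_skip|exact: IH].
Qed.

(* Stack 2 counts, in unary above a mark, the subtrees still to be read. *)
Definition MMove : fm :=
  MSeq (MPush i1 mark) (MSeq (MPush i2 mark) (MSeq (MPush i2 (inl true))
  (MLoop i2 (fun a => if a is Some (inl true) then
      MCase i0 (fun b => if b is Some (inl true) then
          MSeq (MPush i1 (inl true))
            (MSeq (MPush i2 (inl true)) (MPush i2 (inl true)))
        else MPush i1 (inl false)) else MSkip)
    (fun a => if a is Some (inl true) then true else false)))).

Lemma runs_move x r0 r1 r2 :
  runs MMove (SS x ++ r0, r1, r2) (6 * vsz x + 6)
    (r0, rev (SS x) ++ mark :: r1, r2).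
Proof.
rewrite (_ : _ + 6 = 1 + (1 + (1 + (6 * vsz x + 3)))); last by lia.
apply: runs_seq (runs_push _ _ _) _; apply: runs_seq (runs_push _ _ _) _.
apply: runs_seq (runs_push _ _ _) _; rewrite /get /put /=.
set LL := MLoop _ _ _; move: (mark :: r1) => s1.
(* The claim takes the rest of the run as a premise, so that the induction hypotheses for the two
   subtrees can be chained inside a single run of the loop. *)
have loop y q0 q1 q2 t s' : runs LL (q0, rev (SS y) ++ q1, q2) t s' ->
    runs LL (SS y ++ q0, q1, inl true :: q2) (6 * vsz y + t) s'.
  elim: y q0 q1 q2 t s' => [|y1 IH1 y2 IH2] q0 q1 q2 t s' H.
    rewrite (_ : _ + t = (2 + t).+1 + 3); last by rewrite /vsz /=; lia.
    apply: runs_mono (leq_addr _ _); apply: runs_loop_cont => //=.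
      by apply: runs_loop_exit => //=; exact: runs_push.
    exact: H.
  rewrite vszN (_ : _ + t =
    (4 + (6 * vsz y1 + (6 * vsz y2 + t))).+1 + 1); last by lia.
  apply: runs_mono (leq_addr _ _); apply: runs_loop_cont => //=.
    apply: runs_loop_exit => //=.
    rewrite -[3]/(1 + (1 + 1)).
    by do 2 (apply: runs_seq; first exact: runs_push); exact: runs_push.
  rewrite /get /put /= map_cat -catA; apply: IH1; apply: IH2.
  by move: H; rewrite /= rev_cons map_cat rev_cat cat_rcons -!catA.
apply: loop; apply: (@runs_mono _ _ 2) => //.
by apply: runs_loop_exit => //; exact: runs_skip.
Qed.

Lemma runs_tr10 w s0 r1 s2 :
  runs (MTr i1 i0) (s0, rev (map inl w) ++ mark :: r1, s2) (2 * size w + 2)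
    (map inl w ++ s0, r1, s2).
Proof.
have := @runs_tr i1 i0 (s0, rev (map inl w) ++ mark :: r1, s2) (rev w) r1 isT.
rewrite /get /= -map_rev => /(_ erefl).
by rewrite -map_rev revK size_rev.
Qed.

Definition MDrop : fm := MSeq MMove MDel1.

Lemma runs_drop x r0 r1 r2 :
  runs MDrop (SS x ++ r0, r1, r2) (8 * vsz x + 8) (r0, r1, r2).
Proof.
rewrite (_ : 8 * _ + _ = (6 * vsz x + 6) + (2 * size (rev (ser x)) + 2)).
  apply: runs_seq (runs_move _ _ _ _) _; rewrite -map_rev; exact: runs_del1.
by rewrite size_rev -/(vsz x); lia.
Qed.

Definition MDup : fm :=
  MSeq MMove (MSeq (MPush i2 mark) (MSeq
   (MLoop i1 (fun a => if a is Some (inl b) then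
       MSeq (MPush i0 (inl b)) (MPush i2 (inl b)) else MSkip)
     (fun a => if a is Some (inl _) then true else false))
   (MSeq (MPush i1 mark) (MSeq (MTr i2 i1) (MTr i1 i0))))).

Lemma runs_dup x r0 r1 r2 :
  runs MDup (SS x ++ r0, r1, r2) (20 * vsz x + 20)
    (SS x ++ SS x ++ r0, r1, r2).
Proof.
rewrite (_ : 20 * _ + _ = (6 * vsz x + 6) + (1 + ((3 * vsz x + 2) + (1 +
  ((2 * vsz x + 2) + (2 * vsz x + 2))))) + (7 * vsz x + 6)); last by lia.
apply: runs_mono (leq_addr _ _).
apply: runs_seq (runs_move _ _ _ _) _; apply: runs_seq (runs_push _ _ _) _.
rewrite /get /put /=.
apply: (runs_seq (s1 := (SS x ++ r0, r1, SS x ++ mark :: r2))).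
  set LL := MLoop _ _ _.
  have loop w q0 q2 :
      runs LL (q0, map inl w ++ mark :: r1, q2) (3 * size w + 2)
        (rev (map inl w) ++ q0, r1, rev (map inl w) ++ q2).
    elim: w q0 q2 => [|b w IH] q0 q2.
      by apply: runs_loop_exit => //; exact: runs_skip.
    rewrite (_ : 3 * _ + 2 = (2 + (3 * size w + 2)).+1); last by rewrite /=; lia.
    apply: runs_loop_cont => //=.
      apply: (@runs_seq _ _ _ 1 _ 1); exact: runs_push.
    by rewrite rev_cons !cat_rcons; apply: IH.
  rewrite -map_rev.
  have := loop (rev (ser x)) r0 (mark :: r2).
  by rewrite -!map_rev !revK size_rev.
apply: runs_seq (runs_push _ _ _) _; rewrite /get /put /=.
apply: (runs_seq (s1 := (SS x ++ r0, rev (SS x) ++ mark :: r1, r2))).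
  by have := @runs_tr i2 i1 (SS x ++ r0, mark :: r1, SS x ++ mark :: r2)
    (ser x) r2 isT erefl.
exact: runs_tr10.
Qed.

Definition MSwap : fm :=
  MSeq MMove (MSeq MMove (MSeq (MPush i2 mark) (MSeq (MTr i1 i2)
   (MSeq (MTr i1 i0) (MSeq (MPush i1 mark) (MSeq (MTr i2 i1) (MTr i1 i0))))))).

Lemma runs_swap x y r0 r1 r2 :
  runs MSwap (SS x ++ SS y ++ r0, r1, r2) (12 * (vsz x + vsz y) + 22)
    (SS y ++ SS x ++ r0, r1, r2).
Proof.
rewrite (_ : 12 * _ + _ = (6 * vsz x + 6) + ((6 * vsz y + 6) + (1 +
  ((2 * vsz y + 2) + ((2 * vsz x + 2) + (1 + ((2 * vsz y + 2) +
   (2 * vsz y + 2))))))) + 4 * vsz x); last by lia.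
apply: runs_mono (leq_addr _ _).
apply: runs_seq (runs_move _ _ _ _) _; apply: runs_seq (runs_move _ _ _ _) _.
apply: runs_seq (runs_push _ _ _) _; rewrite /get /put /=.
apply: (runs_seq (s1 := (r0, rev (SS x) ++ mark :: r1, SS y ++ mark :: r2))).
  have := @runs_tr i1 i2 (r0, rev (SS y) ++ mark :: rev (SS x) ++ mark :: r1,
     mark :: r2) (rev (ser y)) _ isT.
  rewrite /get /= -map_rev => /(_ _ erefl).
  by rewrite -!map_rev !revK size_rev.
apply: (runs_seq (s1 := (SS x ++ r0, r1, SS y ++ mark :: r2))).
  exact: runs_tr10.
apply: runs_seq (runs_push _ _ _) _; rewrite /get /put /=.
apply: (runs_seq (s1 := (SS x ++ r0, rev (SS y) ++ mark :: r1, r2))).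
  by have := @runs_tr i2 i1 (SS x ++ r0, mark :: r1, SS y ++ mark :: r2)
    (ser y) r2 isT erefl.
exact: runs_tr10.
Qed.

(** * The class of polynomial-time functions and its closure properties *)

Class emb (A : Type) := embed : A -> btree.

Definition esz A {eA : emb A} (a : A) : nat := vsz (embed a).
Arguments esz {A eA} a.

(* Every polynomial in [n] is bounded by a power of [n + 2]. *)
Definition pb A {eA : emb A} (T : A -> nat) : Prop :=
  exists k, forall a, T a <= (esz a).+2 ^ k.

(** The contents below the argument are arbitrary and must survive. Hence machines compose, and
    other values can be stored on the stacks while one of them runs. *)
Definition poly A B {eA : emb A} {eB : emb B} (f : A -> B) : Prop :=
  exists M (T : A -> nat), pb T /\ forall a r0 r1 r2,
    runs M (SS (embed a) ++ r0, r1, r2) (T a)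
           (SS (embed (f a)) ++ r0, r1, r2).

Section PB.
Context {A : Type} {eA : emb A}.
Implicit Types (T : A -> nat).

Lemma pb_le T1 T2 : pb T2 -> (forall a, T1 a <= T2 a) -> pb T1.
Proof. by move=> [k H] le; exists k => a; apply: leq_trans (le a) (H a). Qed.

Lemma pb_cst c : pb (fun _ : A => c).
Proof.
exists c => a; apply: leq_trans (ltnW (ltn_expl c (isT : 1 < 2))) _.
by case: (c) => // c'; rewrite leq_exp2r.
Qed.

Lemma pb_esz : pb (@esz A eA).
Proof. by exists 1 => a; rewrite expn1; lia. Qed.

Lemma pbM T1 T2 : pb T1 -> pb T2 -> pb (fun a => T1 a * T2 a).
Proof.
by move=> [k1 H1] [k2 H2]; exists (k1 + k2) => a; rewrite expnD leq_mul.
Qed.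

Lemma pbD T1 T2 : pb T1 -> pb T2 -> pb (fun a => T1 a + T2 a).
Proof.
move=> [k1 H1] [k2 H2]; exists (k1 + k2).+1 => a.
have h1 : T1 a <= (esz a).+2 ^ (k1 + k2).
  by apply: leq_trans (H1 a) _; rewrite leq_exp2l // leq_addr.
have h2 : T2 a <= (esz a).+2 ^ (k1 + k2).
  by apply: leq_trans (H2 a) _; rewrite leq_exp2l // leq_addl.
rewrite expnS; move: (_ ^ _) h1 h2 => p h1 h2; nia.
Qed.

Lemma pbS T : pb T -> pb (fun a => (T a).+1).
Proof. by move=> H; apply: (pb_le (pbD (pb_cst 1) H)). Qed.

Lemma pbX T k : pb T -> pb (fun a => T a ^ k).
Proof.
move=> H; elim: k => [|k IH]; first exact: pb_cst.
by apply: (pb_le (pbM H IH)) => a; rewrite expnS.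
Qed.

Lemma pb_comp B {eB : emb B} (f : A -> B) (T : B -> nat) :
  pb (fun a => esz (f a)) -> pb T -> pb (fun a => T (f a)).
Proof.
move=> Hf [k H]; apply: (pb_le (T2 := fun a => (esz (f a)).+2 ^ k)) => //.
by apply: pbX; do 2 apply: pbS.
Qed.

Lemma poly_esz B {eB : emb B} (f : A -> B) : poly f -> pb (fun a => esz (f a)).
Proof.
move=> [M [T [pT H]]]; apply: (pb_le (pbD pb_esz pT)) => a.
have := exec_size (H a [::] [::] [::]).
by rewrite /stacks_size /= !cats0 !size_map !addn0.
Qed.

Lemma pb_poly B {eB : emb B} (f : A -> B) (T : B -> nat) :
  poly f -> pb T -> pb (fun a => T (f a)).
Proof. by move=> /poly_esz; exact: pb_comp. Qed.

End PB.

Ltac pb_tac := repeat match goal with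
  | H : poly ?f |- pb (fun a => esz (?f a)) => exact: (poly_esz H)
  | _ => first [ exact: pb_cst | exact: pb_esz | assumption | apply: pbD
    | apply: pbM | apply: pbS | apply: pbX ]
  end.

Section Basic.
Context {A B C : Type} {eA : emb A} {eB : emb B} {eC : emb C}.

Lemma poly_ext (f g : A -> B) : (forall a, f a = g a) -> poly f -> poly g.
Proof.
by move=> E [M [T [pT H]]]; exists M, T; split=> // a *; rewrite -E.
Qed.

Lemma poly_cast (f : A -> B) (g : A -> C) :
  (forall a, embed (f a) = embed (g a)) -> poly f -> poly g.
Proof.
by move=> E [M [T [pT H]]]; exists M, T; split=> // a *; rewrite -E.
Qed.

Lemma poly_id : poly (fun a : A => a).
Proof.
exists MSkip, (fun=> 1); split; first exact: pb_cst.
by move=> *; exact: runs_skip.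
Qed.

Lemma poly_comp (g : B -> C) (f : A -> B) :
  poly g -> poly f -> poly (fun a => g (f a)).
Proof.
move=> [M2 [T2 [p2 H2]]] pf; have [M1 [T1 [p1 H1]]] := pf.
exists (MSeq M1 M2), (fun a => T1 a + T2 (f a)); split.
  by apply: pbD => //; apply: pb_poly.
by move=> a r0 r1 r2; apply: runs_seq (H1 _ _ _ _) (H2 _ _ _ _).
Qed.

Lemma poly_const (b : B) : poly (fun _ : A => b).
Proof.
have push (w : seq sym) : exists M, forall r0 r1 r2,
    runs M (r0, r1, r2) (size w + 1) (w ++ r0, r1, r2).
  elim: w => [|c w [M HM]]; first by exists MSkip => *; exact: runs_skip.
  exists (MSeq M (MPush i0 c)) => r0 r1 r2 /=.
  rewrite (_ : _.+1 + 1 = (size w + 1) + 1); last by lia.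
  by apply: runs_seq (HM _ _ _) _; exact: runs_push.
have [M HM] := push (SS (embed b)).
exists (MSeq MDrop M), (fun a => (8 * esz a + 8) + (size (SS (embed b)) + 1)).
split; first by pb_tac.
by move=> a r0 r1 r2; apply: runs_seq (HM _ _ _); exact: runs_drop.
Qed.

End Basic.

Instance emb_unit : emb unit := fun=> Lf.
Instance emb_bool : emb bool := fun b => if b then Nd Lf Lf else Lf.
Instance emb_nat : emb nat := fun n => iter n (Nd Lf) Lf.
Instance emb_prod A B {eA : emb A} {eB : emb B} : emb (A * B) :=
  fun p => Nd (embed p.1) (embed p.2).
Instance emb_seq A {eA : emb A} : emb (seq A) :=
  fun s => foldr (fun a v => Nd (embed a) v) Lf s.
Instance emb_option A {eA : emb A} : emb (option A) :=
  fun o => if o is Some a then Nd (embed a) Lf else Lf.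

Lemma esz_pair X Y {eX : emb X} {eY : emb Y} (a : X) (b : Y) :
  esz (a, b) = (esz a + esz b).+1.
Proof. by rewrite /esz {1}/embed /= vszN. Qed.

Section Data.
Context {X A B C D : Type}.
Context {eX : emb X} {eA : emb A} {eB : emb B} {eC : emb C} {eD : emb D}.

Lemma poly_pair (f : X -> A) (g : X -> B) :
  poly f -> poly g -> poly (fun x => (f x, g x)).
Proof.
move=> [M1 [T1 [p1 H1]]] pg; have [M2 [T2 [p2 H2]]] := pg.
exists (MSeq MDup (MSeq M2 (MSeq MSwap (MSeq M1 (MPush i0 (inl true)))))),
  (fun x => (20 * esz x + 20) + (T2 x + ((12 * (esz (g x) + esz x) + 22)
     + (T1 x + 1)))); split; first by pb_tac.
move=> x r0 r1 r2.
apply: runs_seq (runs_dup _ _ _ _) _; apply: runs_seq (H2 _ _ _ _) _.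
apply: runs_seq (runs_swap _ _ _ _ _) _; apply: runs_seq (H1 _ _ _ _) _.
by rewrite /embed /emb_prod /= map_cat -catA; exact: runs_push.
Qed.

Lemma poly_fst (f : X -> A * B) : poly f -> poly (fun x => (f x).1).
Proof.
move=> pf; apply: (poly_comp (g := fst) _ pf).
exists (MCase i0 (fun=> MSeq MSwap MDrop)),
  (fun p => ((12 * (esz p.1 + esz p.2) + 22) + (8 * esz p.2 + 8)).+1).
have le1 (p : A * B) : esz p.1 <= esz p /\ esz p.2 <= esz p.
  by case: p => a b; rewrite esz_pair /=; lia.
split.
  apply: (pb_le (T2 := fun p => 40 * esz p + 40)); first by pb_tac.
  by move=> p; have := le1 p; lia.
move=> p r0 r1 r2; apply: runs_loop_exit => //.
rewrite /get /put /= map_cat -catA.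
by apply: runs_seq (runs_swap _ _ _ _ _) (runs_drop _ _ _ _).
Qed.

Lemma poly_snd (f : X -> A * B) : poly f -> poly (fun x => (f x).2).
Proof.
move=> pf; apply: (poly_comp (g := snd) _ pf).
exists (MCase i0 (fun=> MDrop)), (fun p => (8 * esz p.1 + 8).+1).
split.
  apply: (pb_le (T2 := fun p => 8 * esz p + 9)); first by pb_tac.
  by move=> [a b]; rewrite esz_pair /=; lia.
move=> p r0 r1 r2; apply: runs_loop_exit => //.
by rewrite /get /put /= map_cat -catA; exact: runs_drop.
Qed.

(** Common source of the case analyses on booleans, lists, options and numbers. One popped symbol
    tells a leaf from a node, and a node is already the code of the pair of its subtrees: pushing
    [true] back yields the argument of [g]. *)
Lemma poly_match (c : X -> A) (f : X -> B) (g : X * (C * D) -> B) (h : X -> B) :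
  poly c -> poly f -> poly g ->
  (forall x, (embed (c x) = Lf /\ h x = f x) \/
     exists d e, embed (c x) = Nd (embed d) (embed e) /\ h x = g (x, (d, e))) ->
  poly h.
Proof.
move=> pc [Mf [Tf [pf Hf]]] [Mg [Tg [[kg pg] Hg]]] Hh.
have [Mc [Tc [pc' Hc]]] := pc.
exists (MSeq MDup (MSeq Mc (MCase i0 (fun a => if a is Some (inl true) then
   MSeq (MPush i0 (inl true)) (MSeq MSwap (MSeq (MPush i0 (inl true)) Mg))
   else Mf)))).
exists (fun x => (20 * esz x + 20) + (Tc x + (Tf x + (24 + 12 * (esz (c x) +
   esz x) + (esz x + esz (c x) + 1).+2 ^ kg)).+1)).
split; first by pb_tac.
move=> x r0 r1 r2; apply: runs_seq (runs_dup _ _ _ _) _.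
apply: runs_seq (Hc _ _ _ _) _.
have [[E ->]|[d [e [E ->]]]] := Hh x.
  apply: runs_loop_exit; rewrite ?E //=.
  by apply: runs_mono (Hf _ _ _ _) (leq_addr _ _).
apply: runs_loop_exit; rewrite ?E //=.
rewrite /get /put /=.
have E1 : esz (c x) = (esz d + esz e).+1 by rewrite /esz E vszN.
have E2 : esz (x, (d, e)) = esz x + esz (c x) + 1.
  by rewrite !esz_pair E1; lia.
apply: (runs_mono (t := 1 + ((12 * (esz (d, e) + esz x) + 22) +
   (1 + Tg (x, (d, e)))))); last first.
  have := pg (x, (d, e)); rewrite E2.
  have -> : esz (d, e) = esz (c x) by rewrite /esz E.
  lia.
apply: runs_seq (runs_push _ _ _) _; rewrite /get /put /=.
apply: runs_seq (runs_swap (Nd (embed d) (embed e)) _ _ _ _) _.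
apply: runs_seq (runs_push _ _ _) _; rewrite /get /put /=.
have := Hg (x, (d, e)) r0 r1 r2.
rewrite [in SS _]/embed /= map_cat -catA; exact.
Qed.

End Data.

Section Fold.
Context {X S Y : Type} {eX : emb X} {eS : emb S} {eY : emb Y}.

Lemma esz_cons (y : Y) l : esz (y :: l) = (esz y + esz l).+1.
Proof. by rewrite /esz {1}/embed /= vszN. Qed.

Lemma esz_nil : esz (Nil Y) = 1.
Proof. by []. Qed.

Lemma size_esz (l : seq Y) : size l < esz l.
Proof. by elim: l => //= y l IH; rewrite esz_cons; lia. Qed.

(** During each round the tail of the list is parked on stack 1, above a mark, so that the state and
    the head of the list form the argument pair of [M]. *)
Definition MFold (M : fm) : fm :=
  MLoop i0 (fun a => if a is Some (inl true) then
     MSeq MSwap (MSeq MMove (MSeq MSwap (MSeq (MPush i0 (inl true))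
       (MSeq M (MTr i1 i0))))) else MSkip)
    (fun a => if a is Some (inl true) then true else false).

Lemma runs_fold M (f : S * Y -> S) (T : S * Y -> nat) k b l s r0 r1 r2 :
  (forall p, T p <= (esz p).+2 ^ k) ->
  (forall p r0 r1 r2, runs M (SS (embed p) ++ r0, r1, r2) (T p)
      (SS (embed (f p)) ++ r0, r1, r2)) ->
  esz l <= b ->
  (forall i, esz (foldl (fun s y => f (s, y)) s (take i l)) <= b) ->
  runs (MFold M) (SS (embed l) ++ SS (embed s) ++ r0, r1, r2)
    (size l * (44 * b + 60 + (2 * b).+3 ^ k) + 2)
    (SS (embed (foldl (fun s y => f (s, y)) s l)) ++ r0, r1, r2).
Proof.
move=> leT HM; elim: l s => [|y l IH] s leb bd.
  by apply: runs_loop_exit => //; exact: runs_skip.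
rewrite esz_cons in leb.
have lebs : esz s <= b by have := bd 0; rewrite take0.
set t := _ + (2 * b).+3 ^ k.
rewrite (_ : size (y :: l) * t + 2 = t + (size l * t + 2)); last by rewrite /=; lia.
have e1 : esz (s, y) <= (2 * b).+1 by rewrite esz_pair; lia.
have e2 : T (s, y) <= (2 * b).+3 ^ k.
  apply: leq_trans (leT _) _; case: (k) => // k'; rewrite leq_exp2r //; lia.
apply: (runs_mono (t := ((12 * (esz y + esz l) + 22) + ((6 * esz l + 6) +
  ((12 * (esz y + esz s) + 22) + (1 + (T (s, y) + (2 * esz l + 2)))))
  + (size l * t + 2)).+1)); last first.
  by rewrite {2}/t; lia.
apply: runs_loop_cont => //=; last first.
  apply: IH; first by lia.
  by move=> i; have := bd i.+1.
rewrite /get /put /= map_cat -catA.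
apply: runs_seq (runs_swap _ _ _ _ _) _; apply: runs_seq (runs_move _ _ _ _) _.
apply: runs_seq (runs_swap _ _ _ _ _) _; apply: runs_seq (runs_push _ _ _) _.
rewrite /get /put /=.
apply: runs_seq _ (runs_tr10 _ _ _ _).
have := HM (s, y) r0 (rev (SS (emb_seq l)) ++ mark :: r1) r2.
rewrite [in SS _]/embed /= map_cat -catA; exact.
Qed.

(** Polynomial steps alone do not suffice, because a step that doubles its state has exponential
    iterates; hence the bound on every intermediate state. *)
Lemma poly_fold_bound (f : S * Y -> S) (init : X -> S) (l : X -> seq Y) :
  poly f -> poly init -> poly l ->
  (exists2 b, pb b & forall x i,
     esz (foldl (fun s y => f (s, y)) (init x) (take i (l x))) <= b x) ->
  poly (fun x => foldl (fun s y => f (s, y)) (init x) (l x)).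
Proof.
move=> [M [T [[k leT] HM]]] pin pl [b pb_b bd].
have [Mp [Tp [pTp Hp]]] := poly_pair pl pin.
exists (MSeq Mp (MSeq (MCase i0 (fun=> MSkip)) (MFold M))).
exists (fun x => Tp x + (2 + (esz (l x) * (44 * (b x + esz (l x)) + 60 +
   (2 * (b x + esz (l x))).+3 ^ k) + 2))); split; first by pb_tac.
move=> x r0 r1 r2; apply: runs_seq (Hp _ _ _ _) _.
apply: runs_seq.
  by apply: runs_loop_exit => //; exact: runs_skip.
rewrite /get /put /= map_cat -catA.
apply: runs_mono; first apply: (runs_fold (b := b x + esz (l x)) _ _ _ leT HM).
- by rewrite leq_addl.
- by move=> i; apply: leq_trans (bd x i) (leq_addr _ _).
- by rewrite leq_add2r leq_mul2r; have := size_esz (l x); lia.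
Qed.

End Fold.

(** * Conversion between bit strings and their tree codes *)

Definition MIn : fm :=
  MSeq (MLoop i0 (fun a => if a is Some c then MPush i1 c else MSkip) isSome)
 (MSeq (MPush i0 (inl false))
  (MLoop i1 (fun a => if a is Some c then
     MSeq (MSeq (MPush i0 (inl false)) (if c is inl true then
        MSeq (MPush i0 (inl false)) (MPush i0 (inl true)) else MSkip))
       (MPush i0 (inl true)) else MSkip) isSome)).

Lemma runs_in (w : bits) :
  runs MIn (map inl w, [::], [::]) (7 * size w + 7) (SS (embed w), [::], [::]).
Proof.
rewrite (_ : _ + 7 = (2 * size w + 2) + (1 + (5 * size w + 4))); last by lia.
apply: (runs_seq (s1 := ([::], map inl (rev w) ++ [::], [::]))).
  move: {1 4}[::] => r1.
  elim: w r1 => [|b w IH] r1; first by apply: runs_loop_exit => //; exact: runs_skip.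
  rewrite (_ : 2 * _ + 2 = (1 + (2 * size w + 2)).+1); last by rewrite /=; lia.
  apply: runs_loop_cont => //=; first exact: runs_push.
  by rewrite rev_cons map_rcons cat_rcons; apply: IH.
apply: runs_seq (runs_push _ _ _) _; rewrite cats0 /get /put /=.
apply: (@runs_mono _ _ (5 * size (rev w) + 2)); last by rewrite size_rev; lia.
set LL := MLoop _ _ _.
have loop (v u : bits) : runs LL (SS (embed u), map inl v, [::])
    (5 * size v + 2) (SS (embed (catrev v u)), [::], [::]).
  elim: v u => [|b v IH] u; first by apply: runs_loop_exit => //; exact: runs_skip.
  rewrite (_ : 5 * _ + 2 = (4 + (5 * size v + 2)).+1); last by rewrite /=; lia.
  apply: runs_loop_cont => //=.
  have -> : SS (embed (b :: u)) = inl true :: SS (embed b) ++ SS (embed u).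
    by rewrite [embed (b :: u)]/embed /= map_cat.
  apply: (runs_seq (t1 := 3) (t2 := 1)
    (s1 := (SS (embed b) ++ SS (embed u), map inl v, [::]))).
    case: b => /=; last first.
      apply: (@runs_seq _ _ _ 1 _ 2); first exact: runs_push.
      by apply: runs_mono (runs_skip _) _.
    apply: (@runs_seq _ _ _ 1 _ 2); first exact: runs_push.
    apply: (@runs_seq _ _ _ 1 _ 1); first exact: runs_push.
    exact: runs_push.
  exact: runs_push.
by have := loop (rev w) [::]; rewrite catrevE revK cats0.
Qed.

Definition MOut : fm :=
  MSeq (MLoop i0 (fun a => if a is Some (inl true) then
     MCase i0 (fun b => if b is Some (inl true) then
        MCase i0 (fun=> MCase i0 (fun=> MPush i1 (inl true)))
        else MPush i1 (inl false)) else MSkip)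
     (fun a => if a is Some (inl true) then true else false))
  (MLoop i1 (fun a => if a is Some c then MPush i0 c else MSkip) isSome).

Lemma runs_out (w : bits) :
  runs MOut (SS (embed w), [::], [::]) (7 * size w + 4) (map inl w, [::], [::]).
Proof.
rewrite (_ : _ + 4 = (5 * size w + 2) + (2 * size (rev w) + 2)); last first.
  by rewrite size_rev; lia.
apply: (runs_seq (s1 := ([::], map inl (rev w) ++ [::], [::]))).
  move: {1 4}[::] => r1.
  elim: w r1 => [|b w IH] r1; first by apply: runs_loop_exit => //; exact: runs_skip.
  rewrite (_ : 5 * _ + 2 = (4 + (5 * size w + 2)).+1); last by rewrite /=; lia.
  apply: runs_loop_cont => //=; last first.
    by rewrite rev_cons map_rcons cat_rcons; apply: IH.
  rewrite /get /put /= -/(embed w) map_cat.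
  case: b => /=.
    by do 3 (apply: runs_loop_exit => //); exact: runs_push.
  by apply: (@runs_mono _ _ 2) => //; apply: runs_loop_exit => //; exact: runs_push.
have loop (v : bits) q0 : runs (MLoop i1 (fun a => if a is Some c then
    MPush i0 c else MSkip) isSome) (q0, map inl v, [::]) (2 * size v + 2)
    (map inl (rev v) ++ q0, [::], [::]).
  elim: v q0 => [|b v IH] q0; first by apply: runs_loop_exit => //; exact: runs_skip.
  rewrite (_ : 2 * _ + 2 = (1 + (2 * size v + 2)).+1); last by rewrite /=; lia.
  apply: runs_loop_cont => //=; first exact: runs_push.
  by rewrite rev_cons map_rcons cat_rcons; apply: IH.
by have := loop (rev w) [::]; rewrite revK !cats0.
Qed.

Lemma esz_bits (w : bits) : esz w <= 4 * size w + 1.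
Proof.
elim: w => //= b w IH; rewrite esz_cons.
by have : esz b <= 3; [case: (b)|lia].
Qed.

Lemma polytime_poly A (D : A -> Prop) (e F : A -> bits) (G : bits -> bits) :
  poly G -> (forall a, D a -> G (e a) = F a) -> polytime D e F.
Proof.
move=> pG E; have [M [T [pT H]]] := pG.
have [k Hk] : pb (fun w : bits => 2 * ((7 * size w + 7) + (T w +
    (7 * size (G w) + 4)))).
  apply: (pb_le (T2 := fun w => 2 * ((7 * esz w + 7) + (T w +
    (7 * esz (G w) + 4))))); first by pb_tac.
  move=> w; have h v : size v < esz (v : bits) by apply: size_esz.
  by have := h w; have := h (G w); lia.
(* The time is at most [(4 * n + 3) ^ k] for inputs of size [n]. If [n >= 2], then
   [4 * n + 3 <= n ^ 5], which gives the exponent [5 * k]; if [n < 2], then [4 * n + 3 <= 11], which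
   gives the additive constant. *)
exists (ctm (MSeq MIn (MSeq M MOut))), (5 * k + 11 ^ k) => a Da.
have R : runs (MSeq MIn (MSeq M MOut)) (map inl (e a), [::], [::])
    ((7 * size (e a) + 7) + (T (e a) + (7 * size (G (e a)) + 4)))
    (map inl (F a), [::], [::]).
  apply: runs_seq (runs_in _) _; rewrite -(E _ Da).
  apply: runs_seq (runs_out _).
  by have := H (e a) [::] [::] [::]; rewrite !cats0.
apply: (ctm_run R); apply: leq_trans (Hk (e a)) _.
have le : (esz (e a)).+2 <= 4 * size (e a) + 3 by have := esz_bits (e a); lia.
have le2 : (esz (e a)).+2 ^ k <= (4 * size (e a) + 3) ^ k.
  by case: (k) => // k'; rewrite leq_exp2r.
apply: leq_trans le2 _; move: (size _) => n.
have [n2|n2] := ltnP n 2.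
  have le3 : (4 * n + 3) ^ k <= 11 ^ k.
    by case: (k) => // k'; rewrite leq_exp2r //; lia.
  by apply: leq_trans le3 _; lia.
have le3 : (4 * n + 3) ^ k <= (n ^ 5) ^ k.
  case: (k) => // k'; rewrite leq_exp2r // !expnS expn0 muln1.
  have h : 16 <= n * (n * (n * n)).
    by rewrite mulnA; apply: (@leq_mul 4 4); apply: (@leq_mul 2 2).
  by apply: (@leq_trans (n * 16)); [lia|rewrite leq_mul2l h orbT].
apply: leq_trans le3 _; rewrite -expnM; apply: leq_trans (leq_addr _ _).
by rewrite leq_exp2l // leq_addr.
Qed.

(** * Lists and numbers *)

Lemma poly_ap2 X A B C {eX : emb X} {eA : emb A} {eB : emb B} {eC : emb C}
    (F : A -> B -> C) (a : X -> A) (b : X -> B) :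
  poly (fun p => F p.1 p.2) -> poly a -> poly b ->
  poly (fun x => F (a x) (b x)).
Proof. by move=> pF pa pb'; exact: (poly_comp pF (poly_pair pa pb')). Qed.

Section Cases.
Context {X A B C : Type} {eX : emb X} {eA : emb A} {eB : emb B} {eC : emb C}.

Lemma poly_if (b : X -> bool) (f g : X -> C) :
  poly b -> poly f -> poly g -> poly (fun x => if b x then f x else g x).
Proof.
move=> pb' pf pg.
apply: (poly_match (g := fun p : X * (unit * unit) => f p.1) pb' pg).
  exact: poly_comp pf (poly_fst (poly_id)).
by move=> x; case: (b x); [right; exists tt, tt|left].
Qed.

Lemma poly_caseseq (l : X -> seq A) (f : X -> C) (g : X -> A -> seq A -> C) :
  poly l -> poly f -> poly (fun p : X * (A * seq A) => g p.1 p.2.1 p.2.2) ->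
  poly (fun x => match l x with [::] => f x | a :: s => g x a s end).
Proof.
move=> pl pf pg; apply: (poly_match pl pf pg) => x.
by case: (l x) => [|a s]; [left|right; exists a, s].
Qed.

Lemma poly_caseopt (l : X -> option A) (f : X -> C) (g : X -> A -> C) :
  poly l -> poly f -> poly (fun p : X * A => g p.1 p.2) ->
  poly (fun x => match l x with None => f x | Some a => g x a end).
Proof.
move=> pl pf pg.
apply: (poly_match (g := fun p : X * (A * unit) => g p.1 p.2.1) pl pf).
  apply: (poly_ap2 pg); first exact: poly_fst poly_id.
  exact: poly_fst (poly_snd poly_id).
by move=> x; case: (l x) => [a|]; [right; exists a, tt|left].
Qed.

Lemma poly_casenat (n : X -> nat) (f : X -> C) (g : X -> nat -> C) :
  poly n -> poly f -> poly (fun p : X * nat => g p.1 p.2) ->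
  poly (fun x => match n x with 0 => f x | m.+1 => g x m end).
Proof.
move=> pl pf pg.
apply: (poly_match (g := fun p : X * (unit * nat) => g p.1 p.2.2) pl pf).
  apply: (poly_ap2 pg); first exact: poly_fst poly_id.
  exact: poly_snd (poly_snd poly_id).
by move=> x; case: (n x) => [|m]; [left|right; exists tt, m].
Qed.

Lemma poly_letpair (l : X -> A * B) (g : X -> A -> B -> C) :
  poly l -> poly (fun p : X * (A * B) => g p.1 p.2.1 p.2.2) ->
  poly (fun x => let (a, b) := l x in g x a b).
Proof.
move=> pl pg.
apply: (poly_ext (f := fun x => g x (l x).1 (l x).2)).
  by move=> x; case: (l x).
exact: (poly_comp pg (poly_pair poly_id pl)).
Qed.

Lemma poly_cons (a : X -> A) (s : X -> seq A) :
  poly a -> poly s -> poly (fun x => a x :: s x).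
Proof. by move=> pa ps; apply: poly_cast (poly_pair pa ps). Qed.

Lemma poly_S (n : X -> nat) : poly n -> poly (fun x => (n x).+1).
Proof.
by move=> pn; apply: poly_cast (poly_pair (poly_const tt) pn).
Qed.

Lemma poly_Some (a : X -> A) : poly a -> poly (fun x => Some (a x)).
Proof.
by move=> pn; apply: poly_cast (poly_pair pn (poly_const tt)).
Qed.

End Cases.

Section CaseAliases.
Context {X A : Type} {eX : emb X} {eA : emb A}.

Lemma poly_andb (a b : X -> bool) : poly a -> poly b -> poly (fun x => a x && b x).
Proof. by move=> pa pb'; apply: poly_if pa pb' (poly_const _). Qed.

Lemma poly_orb (a b : X -> bool) : poly a -> poly b -> poly (fun x => a x || b x).
Proof. by move=> pa pb'; apply: poly_if pa (poly_const _) pb'. Qed.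

Lemma poly_negb (a : X -> bool) : poly a -> poly (fun x => ~~ a x).
Proof. by move=> pa; apply: poly_if pa (poly_const _) (poly_const _). Qed.

Lemma poly_head (x0 : X -> A) l :
  poly x0 -> poly l -> poly (fun x => head (x0 x) (l x)).
Proof.
by move=> p0 pl; apply: poly_caseseq pl p0 (poly_fst (poly_snd poly_id)).
Qed.

Lemma poly_behead (l : X -> seq A) : poly l -> poly (fun x => behead (l x)).
Proof.
by move=> pl; apply: poly_caseseq pl (poly_const _) (poly_snd (poly_snd poly_id)).
Qed.

Lemma poly_ohead (l : X -> seq A) : poly l -> poly (fun x => ohead (l x)).
Proof.
move=> pl; apply: poly_caseseq pl (poly_const _) _.
exact: poly_Some (poly_fst (poly_snd poly_id)).
Qed.

Lemma poly_pred (n : X -> nat) : poly n -> poly (fun x => (n x).-1).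
Proof.
by move=> pn; apply: (poly_casenat pn pn (poly_snd poly_id)).
Qed.

End CaseAliases.

Ltac is_match := lazymatch goal with |- @poly ?A _ _ _ ?f =>
  assert_succeeds (let x := fresh "x" in
    assert (forall x : A, f x = f x);
    [ intro x; cbv beta; lazymatch goal with
      | |- (match _ with _ => _ end) = _ => idtac end | ]) end.
Ltac poly_lem := fail.
Ltac poly_eta := lazymatch goal with |- @poly ?A ?B ?eA ?eB ?f =>
  change (@poly A B eA eB (fun x => f x)); cbv beta end.
Ltac poly_step := poly_eta; first
  [ assumption | apply poly_const | apply poly_id
  | lazymatch goal with
    | |- poly (fun x => fst (@?f1 x)) => apply poly_fst
    | |- poly (fun x => snd (@?f1 x)) => apply poly_snd
    | |- poly (fun x => ((@?f1 x), (@?f2 x))) => apply poly_pair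
    | |- poly (fun x => (@?f1 x) :: (@?f2 x)) => apply poly_cons
    | |- poly (fun x => S (@?f1 x)) => apply poly_S
    | |- poly (fun x => Some (@?f1 x)) => apply poly_Some
    | |- poly (fun x => andb (@?f1 x) (@?f2 x)) => apply poly_andb
    | |- poly (fun x => orb (@?f1 x) (@?f2 x)) => apply poly_orb
    | |- poly (fun x => negb (@?f1 x)) => apply poly_negb
    | |- poly (fun x => head (@?f1 x) (@?f2 x)) => apply poly_head
    | |- poly (fun x => behead (@?f1 x)) => apply poly_behead
    | |- poly (fun x => ohead (@?f1 x)) => apply poly_ohead
    | |- poly (fun x => predn (@?f1 x)) => apply poly_pred
    | H : poly ?f |- poly (fun x => ?f (@?g x)) => apply (poly_comp H)
    | _ => first [ poly_lem | is_match; first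
      [ apply poly_if | apply poly_letpair | apply poly_caseseq
      | apply poly_caseopt | apply poly_casenat ] ]
    end ].
Ltac poly_auto := repeat poly_step.

Section Folds.
Context {X S Y C : Type} {eX : emb X} {eS : emb S} {eY : emb Y} {eC : emb C}.

Lemma poly_foldlb (step : X -> S -> Y -> S) (init : X -> S) (l : X -> seq Y) :
  poly (fun p : X * S * Y => step p.1.1 p.1.2 p.2) -> poly init -> poly l ->
  (exists2 b, pb b & forall x i,
     esz (foldl (step x) (init x) (take i (l x))) <= b x) ->
  poly (fun x => foldl (step x) (init x) (l x)).
Proof.
move=> ps pin pl [b pb_b bd].
pose f (p : (X * S) * Y) := (p.1.1, step p.1.1 p.1.2 p.2).
have E x s u : foldl (fun s y => f (s, y)) (x, s) u = (x, foldl (step x) s u).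
  by elim: u s => //= y u IH s; rewrite IH.
apply: (poly_ext (f := fun x =>
    (foldl (fun s y => f (s, y)) (x, init x) (l x)).2)).
  by move=> x; rewrite E.
apply: poly_snd; apply: poly_fold_bound => //.
- by apply: poly_pair => //; poly_auto.
- by poly_auto.
exists (fun x => (esz x + b x).+1); first by pb_tac.
by move=> x i; rewrite E esz_pair ltnS leq_add2l.
Qed.

Lemma poly_foldl (step : X -> S -> Y -> S) (h : X -> Y -> C)
    (init : X -> S) (l : X -> seq Y) :
  poly (fun p : X * S * Y => step p.1.1 p.1.2 p.2) ->
  poly (fun p : X * Y => h p.1 p.2) ->
  (forall x s y, esz (step x s y) <= esz s + esz (h x y)) ->
  poly init -> poly l ->
  poly (fun x => foldl (step x) (init x) (l x)).
Proof.
move=> ps ph le pin pl; apply: poly_foldlb => //.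
have [k Hk] := poly_esz ph.
exists (fun x => esz (init x) + esz (l x) * (esz x + esz (l x) + 1).+2 ^ k).
  by pb_tac.
move=> x i; set B := _ ^ k.
have mem u s : esz u <= esz (l x) ->
    esz (foldl (step x) s u) <= esz s + size u * B.
  elim: u s => [|y u IH] s leu /=; first by lia.
  rewrite esz_cons in leu.
  apply: leq_trans (IH _ _) _; first by lia.
  have h1 : esz (h x y) <= B.
    apply: leq_trans (Hk (x, y)) _; rewrite /B esz_pair.
    by case: (k) => // k'; rewrite leq_exp2r //; lia.
  by have := le x s y; lia.
have let' u : esz (take i u) <= esz (u : seq Y).
  elim: u (i) => [|y u IH] [|j] //=; rewrite ?esz_cons ?esz_nil //.
  by have := IH j; lia.
apply: leq_trans (mem _ _ (let' _)) _; rewrite leq_add2l leq_mul2r.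
have h2 u : size u < esz (u : seq Y) by apply: size_esz.
by have := h2 (take i (l x)); have := let' (l x); lia.
Qed.

End Folds.

Lemma poly_rev X Y {eX : emb X} {eY : emb Y} (l : X -> seq Y) :
  poly l -> poly (fun x => rev (l x)).
Proof.
move=> pl; apply: (poly_ext (f := fun x => foldl (fun s y => y :: s) [::] (l x))).
  move=> x; rewrite -[rev _]cats0 -catrevE; move: [::].
  by elim: (l x) => //= y u IH s; rewrite IH.
apply: (poly_foldl (h := fun _ y => (y, tt))) => //; poly_auto.
by move=> x s y; rewrite esz_cons esz_pair; lia.
Qed.

Section Folds2.
Context {X S Y C : Type} {eX : emb X} {eS : emb S} {eY : emb Y} {eC : emb C}.

Lemma poly_foldr (step : X -> Y -> S -> S) (h : X -> Y -> C)
    (init : X -> S) (l : X -> seq Y) :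
  poly (fun p : X * S * Y => step p.1.1 p.2 p.1.2) ->
  poly (fun p : X * Y => h p.1 p.2) ->
  (forall x s y, esz (step x y s) <= esz s + esz (h x y)) ->
  poly init -> poly l ->
  poly (fun x => foldr (step x) (init x) (l x)).
Proof.
move=> ps ph le pin pl.
apply: (poly_ext (f := fun x =>
    foldl (fun s y => step x y s) (init x) (rev (l x)))).
  by move=> x; rewrite foldl_rev.
by apply: (poly_foldl (h := h)) => //; exact: poly_rev.
Qed.

Lemma poly_iter (step : X -> S -> S) (h : X -> C) (init : X -> S) (n : X -> nat) :
  poly (fun p : X * S => step p.1 p.2) -> poly h ->
  (forall x s, esz (step x s) <= esz s + esz (h x)) ->
  poly init -> poly n ->
  poly (fun x => iter (n x) (step x) (init x)).
Proof.
move=> ps ph le pin pn.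
apply: (poly_ext (f := fun x =>
    foldl (fun s _ => step x s) (init x) (nseq (n x) tt))).
  move=> x; elim: (n x) (init x) => //= m IH s.
  by rewrite IH -iterS iterSr.
apply: (poly_foldl (h := fun x _ => h x)) => //.
- exact: poly_comp ps (poly_fst poly_id).
- exact: poly_comp ph (poly_fst poly_id).
by apply: poly_cast pn => x; elim: (n x) => //= m; rewrite /embed /= => ->.
Qed.

End Folds2.

Lemma esz_nat (k : nat) : esz k = k.*2.+1.
Proof.
elim: k => // k; rewrite doubleS /esz {2}/embed /= vszN => <-.
by rewrite /embed /vsz /=; lia.
Qed.

Section Lists.
Context {X Y Z : Type} {eX : emb X} {eY : emb Y} {eZ : emb Z}.
Implicit Types (l : X -> seq Y) (n m : X -> nat).

Lemma poly_cat l l' : poly l -> poly l' -> poly (fun x => l x ++ l' x).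
Proof.
move=> pl pl'; apply: (poly_ext (f := fun x => foldr (fun y s => y :: s) (l' x) (l x))).
  by move=> x; elim: (l x) => //= y s ->.
apply: (poly_foldr (h := fun _ y => (y, tt))) => //; poly_auto.
by move=> x s y; rewrite esz_cons esz_pair; lia.
Qed.

Lemma poly_map l (f : X -> Y -> Z) :
  poly (fun p : X * Y => f p.1 p.2) -> poly l ->
  poly (fun x => map (f x) (l x)).
Proof.
move=> pf pl.
apply: (poly_ext (f := fun x => foldr (fun y s => f x y :: s) [::] (l x))).
  by move=> x; elim: (l x) => //= y s ->.
apply: (poly_foldr (h := fun x y => (f x y, tt))) => //; poly_auto.
- apply: (poly_comp pf (f := fun p : X * seq Z * Y => (p.1.1, p.2))).
  by poly_auto.
by move=> x s y; rewrite esz_cons esz_pair; lia.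
Qed.

Lemma poly_filter l (f : X -> Y -> bool) :
  poly (fun p : X * Y => f p.1 p.2) -> poly l ->
  poly (fun x => filter (f x) (l x)).
Proof.
move=> pf pl.
apply: (poly_ext (f := fun x =>
    foldr (fun y s => if f x y then y :: s else s) [::] (l x))).
  by move=> x; elim: (l x) => //= y s ->.
apply: (poly_foldr (h := fun x y => (y, tt))) => //; poly_auto.
- apply: (poly_comp pf (f := fun p : X * seq Y * Y => (p.1.1, p.2))).
  by poly_auto.
by move=> x s y; case: (f x y); rewrite ?esz_cons esz_pair; lia.
Qed.

Lemma poly_all l (f : X -> Y -> bool) :
  poly (fun p : X * Y => f p.1 p.2) -> poly l ->
  poly (fun x => all (f x) (l x)).
Proof.
move=> pf pl.
apply: (poly_ext (f := fun x => foldr (fun y s => f x y && s) true (l x))).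
  by move=> x; elim: (l x) => //= y s ->.
apply: (poly_foldr (h := fun x y => true)) => //; poly_auto.
- apply: (poly_comp pf (f := fun p : X * bool * Y => (p.1.1, p.2))).
  by poly_auto.
by move=> x [] y; case: (f x y).
Qed.

Lemma poly_has l (f : X -> Y -> bool) :
  poly (fun p : X * Y => f p.1 p.2) -> poly l ->
  poly (fun x => has (f x) (l x)).
Proof.
move=> pf pl.
apply: (poly_ext (f := fun x => foldr (fun y s => f x y || s) false (l x))).
  by move=> x; elim: (l x) => //= y s ->.
apply: (poly_foldr (h := fun x y => true)) => //; poly_auto.
- apply: (poly_comp pf (f := fun p : X * bool * Y => (p.1.1, p.2))).
  by poly_auto.
by move=> x [] y; case: (f x y).
Qed.

Lemma poly_size l : poly l -> poly (fun x => size (l x)).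
Proof.
move=> pl; apply: (poly_ext (f := fun x => foldr (fun _ s => s.+1) 0 (l x))).
  by move=> x; elim: (l x) => //= y s ->.
apply: (poly_foldr (h := fun x y => true)) => //; poly_auto.
by move=> x s y; rewrite !esz_nat (_ : esz true = 3) //; lia.
Qed.

Lemma poly_drop l n : poly l -> poly n -> poly (fun x => drop (n x) (l x)).
Proof.
move=> pl pn; apply: (poly_ext (f := fun x => iter (n x) behead (l x))).
  move=> x; elim: (n x) (l x) => [|m IH] s; first by rewrite drop0.
  by rewrite iterSr IH; case: s.
apply: (poly_iter (h := fun=> tt)) => //; poly_auto.
by move=> x [|y s] //=; rewrite esz_cons; lia.
Qed.

Lemma poly_nth (y0 : X -> Y) l n :
  poly y0 -> poly l -> poly n -> poly (fun x => nth (y0 x) (l x) (n x)).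
Proof.
move=> py pl pn.
apply: (poly_ext (f := fun x => head (y0 x) (drop (n x) (l x)))).
  by move=> x; rewrite -nth0 nth_drop addn0.
have := poly_drop pl pn => pd; rewrite /head; poly_auto.
Qed.

Lemma poly_take l n : poly l -> poly n -> poly (fun x => take (n x) (l x)).
Proof.
move=> pl pn; pose st (p : seq Y * seq Y) :=
  if p.2 is y :: s then (y :: p.1, s) else p.
apply: (poly_ext (f := fun x => rev (iter (n x) st ([::], l x)).1)).
  move=> x; have E (m : nat) u s : (iter m st (u, s)).1 = catrev (take m s) u.
    elim: m u s => [|m IH] u s; first by rewrite take0.
    by rewrite iterSr; case: s => [|y s] /=; [rewrite IH; case: (m)|exact: IH].
  by rewrite E catrevE cats0 revK.
apply: poly_rev; apply: poly_fst.
apply: (poly_iter (h := fun=> tt)) => //; rewrite /st; poly_auto.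
move=> x [u [|y s]]; rewrite /= !esz_pair ?esz_cons; lia.
Qed.

Lemma poly_add n m : poly n -> poly m -> poly (fun x => n x + m x).
Proof.
move=> pl pn; apply: (poly_ext (f := fun x => iter (n x) S (m x))).
  by move=> x; rewrite iter_succn addnC.
apply: (poly_iter (h := fun=> true)) => //; poly_auto.
by move=> x s; rewrite !esz_nat (_ : esz true = 3) //; lia.
Qed.

Lemma esz_bool (b : bool) : 1 <= esz b <= 3.
Proof. by case: b. Qed.

End Lists.

Section Arith.
Context {X : Type} {eX : emb X}.
Implicit Types (n m : X -> nat).

Lemma poly_sub n m : poly n -> poly m -> poly (fun x => n x - m x).
Proof.
move=> pl pn; apply: (poly_ext (f := fun x => iter (m x) predn (n x))).
  by move=> x; rewrite iter_predn.
apply: (poly_iter (h := fun=> tt)) => //; first exact: poly_pred (poly_snd poly_id).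
  by apply: poly_const.
by move=> x s; rewrite !esz_nat; lia.
Qed.

Lemma poly_mul n m : poly n -> poly m -> poly (fun x => n x * m x).
Proof.
move=> pl pn; apply: (poly_ext (f := fun x => iter (n x) (addn (m x)) 0)).
  by move=> x; rewrite iter_addn_0 mulnC.
apply: (poly_iter (h := m)) => //; last by apply: poly_const.
  apply: poly_add; last exact: poly_snd poly_id.
  exact: poly_comp pn (poly_fst poly_id).
by move=> x s; rewrite !esz_nat; lia.
Qed.

Lemma poly_exp n k : poly n -> poly (fun x => n x ^ k).
Proof.
move=> pn; elim: k => [|k IH]; first exact: poly_const.
by apply: (poly_ext _ (poly_mul pn IH)) => x; rewrite expnS.
Qed.

Lemma poly_leq n m : poly n -> poly m -> poly (fun x => n x <= m x).
Proof.
move=> pn pm; apply: (poly_ext (f := fun x =>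
   if n x - m x is 0 then true else false)).
  by move=> x; rewrite -subn_eq0; case: (_ - _).
by have ps := poly_sub pn pm; poly_auto.
Qed.

Lemma poly_eqn n m : poly n -> poly m -> poly (fun x => n x == m x).
Proof.
move=> pn pm; apply: (poly_ext (f := fun x => (n x <= m x) && (m x <= n x))).
  by move=> x; rewrite eqn_leq.
by have p1 := poly_leq pn pm; have p2 := poly_leq pm pn; poly_auto.
Qed.

Lemma poly_eqb (a b : X -> bool) : poly a -> poly b -> poly (fun x => a x == b x).
Proof.
move=> pa pb'; apply: (poly_ext (f := fun x => if a x then b x else
   if b x then false else true)); last by poly_auto.
by move=> x; case: (a x); case: (b x).
Qed.

Lemma poly_nseq Y {eY : emb Y} n (y : X -> Y) :
  poly n -> poly y -> poly (fun x => nseq (n x) (y x)).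
Proof.
move=> pn py; apply: (poly_ext (f := fun x => iter (n x) (cons (y x)) [::])).
  by move=> x; elim: (n x) => //= k ->.
apply: (poly_iter (h := fun x => (y x, tt))) => //; last by poly_auto.
- apply: poly_cons; last exact: poly_snd poly_id.
  exact: poly_comp py (poly_fst poly_id).
- by poly_auto.
by move=> x s; rewrite esz_cons esz_pair; lia.
Qed.

Lemma poly_iota n : poly n -> poly (fun x => iota 0 (n x)).
Proof.
move=> pn; pose st (p : nat * seq nat) (_ : unit) := (p.1.+1, p.1 :: p.2).
have E k : foldl st (0, [::]) (nseq k tt) = (k, rev (iota 0 k)).
  elim: k => // k IH; rewrite -[k.+1]addn1 nseqD foldl_cat IH /=.
  by rewrite /st /= iotaD rev_cat /= addn1.
apply: (poly_ext (f := fun x => rev (foldl st (0, [::]) (nseq (n x) tt)).2)).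
  by move=> x; rewrite E revK.
apply: poly_rev; apply: poly_snd; apply: poly_foldlb.
- by rewrite /st; poly_auto.
- by poly_auto.
- by apply: poly_nseq => //; apply: poly_const.
exists (fun x => 10 * (esz (n x) * esz (n x)) + 10); first by pb_tac.
move=> x i; have -> : take i (nseq (n x) tt) = nseq (minn i (n x)) tt.
  by elim: (n x) (i) => [|a IH] [|j] //=; rewrite ?minn0 // minnSS IH.
rewrite E esz_pair !esz_nat; set k := minn _ _.
have le : k <= n x by rewrite geq_minr.
have h : esz (rev (iota 0 k)) <= 4 * (k * k) + 1.
  elim: (k) => // j IH; rewrite -addn1 iotaD rev_cat /= esz_cons esz_nat.
  by lia.
by nia.
Qed.

Lemma poly_flatten Y {eY : emb Y} (l : X -> seq (seq Y)) :
  poly l -> poly (fun x => flatten (l x)).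
Proof.
move=> pl; apply: (poly_foldr (h := fun _ y => y)) => //.
- by apply: poly_cat; poly_auto.
- exact: poly_snd poly_id.
- move=> x s; elim=> [|a y IH] /=; rewrite ?esz_cons; lia.
by apply: poly_const.
Qed.

Lemma poly_rcons Y {eY : emb Y} (l : X -> seq Y) y :
  poly l -> poly y -> poly (fun x => rcons (l x) (y x)).
Proof.
move=> pl py; apply: (poly_ext (f := fun x => l x ++ [:: y x])).
  by move=> x; rewrite cats1.
by apply: poly_cat => //; poly_auto.
Qed.

End Arith.

Section Arith2.
Context {X : Type} {eX : emb X}.
Implicit Types (n m : X -> nat).

Lemma poly_eqbits (u v : X -> bits) :
  poly u -> poly v -> poly (fun x => u x == v x).
Proof.
move=> pu pv; apply: (poly_ext (f := fun x => (size (u x) == size (v x)) &&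
  all (fun i => nth false (u x) i == nth false (v x) i) (iota 0 (size (u x))))).
  move=> x; apply/andP/eqP => [[/eqP es /allP E]|->]; last first.
    by split=> //; apply/allP => i _.
  apply: (eq_from_nth (x0 := false)) => // i lt.
  by apply/eqP/E; rewrite mem_iota.
apply: poly_andb; first by apply: poly_eqn; apply: poly_size.
apply: poly_all; last by apply: poly_iota; apply: poly_size.
apply: poly_eqb.
  by apply: poly_nth; poly_auto.
by apply: poly_nth; poly_auto.
Qed.

(** Counts up to [n x], carrying quotient and remainder. For divisor 0 the carry never occurs, in
    agreement with the conventions that the quotient is 0 and the remainder is the dividend. *)
Lemma poly_divmod n m :
  poly n -> poly m -> poly (fun x => (n x %/ m x, n x %% m x)).
Proof.
move=> pn pm; pose st d (p : nat * nat) :=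
  if p.2.+1 == d then (p.1.+1, 0) else (p.1, p.2.+1).
apply: (poly_ext (f := fun x => iter (n x) (st (m x)) (0, 0))).
  move=> x; case: (posnP (m x)) => [->|d0].
    rewrite divn0 modn0; elim: (n x) => // k IH.
    by rewrite iterS IH /st.
  elim: (n x) => [|k IH]; first by rewrite div0n mod0n.
  rewrite iterS IH /st /=; have := ltn_pmod k d0; have := divn_eq k (m x).
  move: (k %/ _) (k %% _) => q r E lt; case: eqP => Er.
    have -> : k.+1 = q.+1 * m x by rewrite E mulSn; lia.
    by rewrite mulnK // modnMl.
  have -> : k.+1 = q * m x + r.+1 by rewrite E; lia.
  by rewrite divnMDl // modnMDl divn_small ?modn_small ?addn0 //; lia.
apply: (poly_iter (h := fun=> (1, 1))) => //; rewrite /st.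
- apply: poly_if; [apply: poly_eqn|poly_auto|poly_auto].
    by poly_auto.
  exact: poly_comp pm (poly_fst poly_id).
- exact: poly_const.
- by move=> x [a b]; case: ifP => _ /=; rewrite !esz_pair !esz_nat; lia.
exact: poly_const.
Qed.

Lemma poly_div n m : poly n -> poly m -> poly (fun x => n x %/ m x).
Proof. by move=> pn pm; exact: poly_fst (poly_divmod pn pm). Qed.

Lemma poly_mod n m : poly n -> poly m -> poly (fun x => n x %% m x).
Proof. by move=> pn pm; exact: poly_snd (poly_divmod pn pm). Qed.

End Arith2.

Ltac poly_lem ::= lazymatch goal with
    | |- poly (fun x => eq_op (@?f1 x) (@?f2 x)) =>
      first [ apply poly_eqn | apply poly_eqb | apply poly_eqbits ]
    | |- poly (fun x => leq (@?f1 x) (@?f2 x)) => apply poly_leq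
    | |- poly (fun x => addn (@?f1 x) (@?f2 x)) => apply poly_add
    | |- poly (fun x => subn (@?f1 x) (@?f2 x)) => apply poly_sub
    | |- poly (fun x => muln (@?f1 x) (@?f2 x)) => apply poly_mul
    | |- poly (fun x => expn (@?f1 x) (@?f2 x)) => apply poly_exp
    | |- poly (fun x => divn (@?f1 x) (@?f2 x)) => apply poly_div
    | |- poly (fun x => modn (@?f1 x) (@?f2 x)) => apply poly_mod
    | |- poly (fun x => cat (@?f1 x) (@?f2 x)) => apply poly_cat
    | |- poly (fun x => map (@?f1 x) (@?f2 x)) => apply poly_map
    | |- poly (fun x => filter (@?f1 x) (@?f2 x)) => apply poly_filter
    | |- poly (fun x => all (@?f1 x) (@?f2 x)) => apply poly_all
    | |- poly (fun x => has (@?f1 x) (@?f2 x)) => apply poly_has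
    | |- poly (fun x => size (@?f1 x)) => apply poly_size
    | |- poly (fun x => drop (@?f1 x) (@?f2 x)) => apply poly_drop
    | |- poly (fun x => take (@?f1 x) (@?f2 x)) => apply poly_take
    | |- poly (fun x => nth (@?f1 x) (@?f2 x) (@?f3 x)) => apply poly_nth
    | |- poly (fun x => iota (@?f1 x) (@?f2 x)) => apply poly_iota
    | |- poly (fun x => nseq (@?f1 x) (@?f2 x)) => apply poly_nseq
    | |- poly (fun x => flatten (@?f1 x)) => apply poly_flatten
    | |- poly (fun x => rcons (@?f1 x) (@?f2 x)) => apply poly_rcons
    | |- poly (fun x => rev (@?f1 x)) => apply poly_rev
    end.

(** * Turing machines are simulated by polynomial-time functions *)

(* An alias, so that the representation by rank is not confused with the
   structural representations of [bool], [option] and products. *)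
Definition fin (T : finType) : Type := T.
Typeclasses Opaque fin.
Instance emb_fin T : emb (fin T) | 100 := fun a => embed (enum_rank (a : T) : nat).

Lemma esz_fin (T : finType) (a : fin T) : esz a <= #|T|.*2.+1.
Proof.
rewrite -[esz a]/(esz (enum_rank (a : T) : nat)) esz_nat ltnS leq_double.
exact: ltnW (ltn_ord _).
Qed.

Section Finite.
Context {T : finType}.

(** A finite table: the argument is compared with each element in turn. No uniformity of [F] in its
    first argument is required. *)
Lemma poly_fin_family X B {eX : emb X} {eB : emb B} (F : T -> X -> B) :
  (forall a, poly (F a)) -> poly (fun p : fin T * X => F p.1 p.2).
Proof.
move=> pF; case: (pickP (fun _ : T => true)) => [a0 _|T0]; last first.
  exists MSkip, (fun=> 1); split; first exact: pb_cst.
  by move=> [a x]; have := T0 a.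
apply: (poly_ext (f := fun p : fin T * X => foldr (fun e r =>
   if (enum_rank (p.1 : T) : nat) == enum_rank e then F e p.2 else r)
   (F a0 p.2) (enum T))).
  move=> [a x] /=; have: a \in enum T by rewrite mem_enum.
  elim: (enum T) => //= e es IH; rewrite in_cons.
  case: (a =P e) => [->|ne] /=; first by rewrite eqxx.
  move=> /IH ->; case: eqP => // /val_inj /enum_rank_inj E.
  by case: ne.
have pX : poly (fun p : fin T * X => p.2) by poly_auto.
elim: (enum T) => /= [|e es IH]; first exact: poly_comp (pF _) pX.
apply: poly_if => //; last exact: poly_comp (pF _) pX.
apply: poly_eqn; last exact: poly_const.
by apply: (poly_cast _ (poly_fst poly_id)).
Qed.

Lemma poly_fin B {eB : emb B} (F : T -> B) : poly (fun a : fin T => F a).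
Proof.
apply: (poly_comp (poly_fin_family (F := fun a (_ : unit) => F a) _)
  (f := fun a : fin T => (a, tt))); last by poly_auto.
by move=> a; apply: poly_const.
Qed.

(** The length [n] is fixed, so an arbitrary function of [n] symbols is again a finite table, built
    by branching on one head at a time. *)
Lemma poly_finseq B {eB : emb B} n (x0 : T) (h : seq T -> B) :
  poly (fun s : seq (fin T) => h (mkseq (nth x0 s) n)).
Proof.
elim: n h => [|n IH] h; first exact: (poly_const (h [::])).
apply: (poly_ext (f := fun s : seq (fin T) =>
    h (head x0 s :: mkseq (nth x0 (behead s)) n))).
  move=> s; rewrite /mkseq /= -[1]/(1 + 0) iotaDl -map_comp nth0.
  by congr (h (_ :: _)); apply: eq_map => i /=; rewrite nth_behead.
apply: (poly_ap2 (poly_fin_family (F := fun a s => h (a :: mkseq (nth x0 s) n)) _)).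
- by move=> a; exact: (IH (fun s => h (a :: s))).
- by apply: poly_head; poly_auto; apply: (poly_const (x0 : fin T)).
by apply: poly_behead; poly_auto.
Qed.

End Finite.

Definition move_code (m : move) : option bool :=
  match m with Left => None | Stay => Some false | Right => Some true end.

Instance emb_move : emb move := fun m => embed (move_code m).

Section Simulation.
Variable M : tm.
Let n := (tm_work_tapes M).+1.
Let Q := tm_state M.
Let Sg := symbol (tm_work M).
Let blank : Sg := None.
Notation stape := (seq (fin Sg) * seq (fin Sg))%type.

Definition sim_act (q : Q) (rs : seq Sg) : fin Q * seq (fin Sg * move) :=
  let r := tm_delta q [ffun i : 'I_n => nth blank rs i] in
  (r.1, [seq r.2 i | i <- enum 'I_n]).

Definition sim_write (t : stape) (am : fin Sg * move) : stape :=
  @tape_write_move (tm_work M) t am.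

Definition sim_step (c : fin Q * seq stape) : fin Q * seq stape :=
  if tm_final (c.1 : Q) then c else
  let r := sim_act c.1 (map (fun t : stape => head (blank : fin Sg) t.2) c.2) in
  (r.1, [seq sim_write (nth ([::], [::]) c.2 i) (nth (blank : fin Sg, Stay) r.2 i)
        | i <- iota 0 n]).

Lemma poly_sim_write X {eX : emb X} (t : X -> stape) am :
  poly t -> poly am -> poly (fun x => sim_write (t x) (am x)).
Proof.
move=> pt pa; pose mc x := move_code (am x).2.
have pm : poly mc by apply: (poly_cast _ (poly_snd pa)).
pose b : fin Sg := blank.
apply: (poly_ext (f := fun x =>
  match mc x with
  | None => (behead (t x).1, head b (t x).1 :: (am x).1 :: behead (t x).2)
  | Some m => if m then ((am x).1 :: (t x).1, behead (t x).2)
              else ((t x).1, (am x).1 :: behead (t x).2)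
  end)).
  by move=> x; rewrite /mc /sim_write; case: (t x) => l r; case: (am x) => a [].
by poly_auto.
Qed.

Lemma poly_sim_act X {eX : emb X} (q : X -> fin Q) (rs : X -> seq (fin Sg)) :
  poly q -> poly rs -> poly (fun x => sim_act (q x) (rs x)).
Proof.
apply: poly_ap2; apply: (poly_fin_family (F := fun q rs => sim_act q rs)) => q'.
apply: (poly_ext _ (poly_finseq n blank (sim_act q'))) => s.
rewrite /sim_act; set f := finfun _; set g := finfun _.
suff -> : f = g by [].
by apply/ffunP => i; rewrite !ffunE nth_mkseq.
Qed.

Lemma poly_sim_step : poly sim_step.
Proof.
rewrite /sim_step.
apply: poly_if; [|exact: poly_id|].
  by apply: (poly_comp (poly_fin (fun q : Q => tm_final q)) (poly_fst poly_id)).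
pose r (c : fin Q * seq stape) := sim_act c.1
   (map (fun t : stape => head (blank : fin Sg) t.2) c.2).
have pr : poly r by apply: poly_sim_act; poly_auto.
apply: (poly_ext (f := fun c => ((r c).1,
  [seq sim_write (nth ([::], [::]) c.2 i) (nth (blank : fin Sg, Stay) (r c).2 i)
  | i <- iota 0 n]))) => //.
apply: poly_pair; first by poly_auto.
by apply: poly_map; [apply: poly_sim_write|]; poly_auto.
Qed.

Lemma esz_sim_write (t : stape) am :
  esz (sim_write t am) <= esz t + (8 * #|Sg| + 8).
Proof.
case: t am => l r [a m].
have hl (u : seq (fin Sg)) : esz (head (blank : fin Sg) u) + esz (behead u)
    <= esz u + #|Sg|.*2.+1.
  have := esz_fin (head (blank : fin Sg) u).
  by case: u => [|b u] /=; rewrite ?esz_cons; lia.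
have := esz_fin a; have := hl l; have := hl r.
have gt (u : fin Sg) : 0 < esz u by exact: vsz_gt0.
have := gt (head (blank : fin Sg) r); have := gt (head (blank : fin Sg) l).
case: m.
- rewrite (_ : sim_write _ _ = (behead l,
    head (blank : fin Sg) l :: a :: behead r)) // !esz_pair !esz_cons; lia.
- rewrite (_ : sim_write _ _ = (l, a :: behead r)) // !esz_pair !esz_cons; lia.
rewrite (_ : sim_write _ _ = (a :: l, behead r)) // !esz_pair !esz_cons; lia.
Qed.

(** The growth per step is a constant of the machine, as bounded iteration requires. *)
Lemma esz_sim_step c : esz (sim_step c) <=
  esz c + (#|Q|.*2.+1 + n * (8 * #|Sg| + 12)).
Proof.
have [K HK] : exists K, K = 8 * #|Sg| + 12 by eexists.
have hw t am : esz (sim_write t am) + 4 <= esz t + K.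
  by have := esz_sim_write t am; rewrite HK; lia.
rewrite -HK {HK}.
have -> : esz c = (esz c.1 + esz c.2).+1 by case: c => q ts; rewrite esz_pair.
rewrite /sim_step; case: ifP => _; first by case: c => q ts; rewrite esz_pair /=; lia.
set r := sim_act _ _; rewrite esz_pair.
have := esz_fin r.1; have gt : 0 < esz c.1 by exact: vsz_gt0.
move: (c.2) => ts.
have : esz [seq sim_write (nth ([::], [::]) ts i) (nth (blank : fin Sg, Stay) r.2 i)
          | i <- iota 0 n] <= esz ts + n * K.
  move: (r.2); elim: (n) ts => [|k IH] ts am.
    by have gs : 0 < esz ts; [exact: vsz_gt0|exact: leq_trans gs (leq_addr _ _)].
  (* The default tape has size 3, so the estimate [h1] below also covers lists with fewer than [n]
     tapes; arbitrary states have to be considered, not only those that represent configurations. *)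
  rewrite [iota _ _]/= map_cons esz_cons -[1]/(1 + 0) iotaDl -map_comp.
  have := IH (behead ts) (behead am).
  under eq_map => i do rewrite !nth_behead.
  have h1 : esz (nth ([::], [::]) ts 0) + esz (behead ts) <= esz ts + 3.
    by case: ts => [|t ts] //=; rewrite esz_cons; lia.
  have := hw (nth ([::], [::]) ts 0) (nth (blank : fin Sg, Stay) am 0).
  move=> h2 h3.
  rewrite (eq_map (g := fun i => sim_write (nth ([::], [::]) ts i.+1)
     (nth (blank : fin Sg, Stay) am i.+1))) //; lia.
by lia.
Qed.

Definition sim_rep (c : tm_config M) : fin Q * seq stape :=
  (c.1, [seq (c.2 i : stape) | i <- enum 'I_n]).

Lemma nth_sim_rep d (c : tm_config M) (i : 'I_n) : nth d (sim_rep c).2 i = c.2 i.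
Proof. by rewrite (nth_map i) ?size_enum_ord // nth_ord_enum. Qed.

Lemma sim_stepP c : sim_step (sim_rep c) = sim_rep (tm_step c).
Proof.
rewrite /sim_step /tm_step [(sim_rep c).1]/=; case: ifP => // _.
set rs := [seq _ | t <- _].
have -> : sim_act c.1 rs = (let r := tm_delta c.1 [ffun i => tape_read (c.2 i)] in
    (r.1, [seq r.2 i | i <- enum 'I_n])).
  rewrite /sim_act; set f := finfun _; set g := finfun _.
  suff -> : f = g by [].
  apply/ffunP => i; rewrite !ffunE /rs (nth_map ([::], [::])).
    by rewrite -/(sim_rep c).2 nth_sim_rep.
  by rewrite size_map size_enum_ord.
case: (tm_delta _ _) => q act; rewrite [RHS]/sim_rep; congr pair.
rewrite -[iota 0 n]val_enum_ord -map_comp; apply: eq_map => i.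
rewrite [RHS]ffunE [LHS]/= -/(sim_rep c).2 nth_sim_rep.
by rewrite (nth_map i) ?size_enum_ord // nth_ord_enum.
Qed.

Lemma sim_init w : sim_rep (tm_init M w) = (tm_start M,
  ([::], [seq Some (inl b) | b <- w]) :: nseq n.-1 ([::], [::])).
Proof.
rewrite /sim_rep enum_ordSl map_cons ffunE -map_comp; congr (_, _ :: _).
apply: (eq_from_nth (x0 := ([::], [::]))) => [|i].
  by rewrite size_map size_enum_ord size_nseq.
rewrite size_map size_enum_ord => lt.
by rewrite nth_nseq lt (nth_map (Ordinal lt)) ?size_enum_ord //= ffunE.
Qed.

Definition sim_out (c : fin Q * seq stape) : bits :=
  @leading_bits (tm_work M) (head ([::], [::]) c.2).2.

Lemma poly_sim_out : poly sim_out.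
Proof.
pose bit (a : Sg) : option bool := if a is Some (inl b) then Some b else None.
apply: (poly_ext (f := fun c : fin Q * seq stape =>
  foldr (fun (a : fin Sg) s => if bit a is Some b then b :: s else [::]) [::]
    (head ([::], [::]) c.2).2)).
  move=> c; rewrite /sim_out; elim: (_.2) => //= a s ->.
  by case: a => [[]|].
have pbit : poly (fun a : fin Sg => bit a) by apply: poly_fin.
apply: (poly_foldr (Y := fin Sg) (h := fun _ _ => (true, true))) => //; poly_auto.
move=> x s a; case: (bit a) => [b|]; rewrite ?esz_cons ?esz_nil esz_pair.
  by have := esz_bool b; rewrite (_ : esz true = 3) //; lia.
by lia.
Qed.

Lemma poly_tm_run k : exists2 G : bits -> bits, poly G &
  forall w b, tm_run M w (size w ^ k + k) = Some b -> G w = b.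
Proof.
exists (fun w => sim_out (iter (size w ^ k + k) sim_step (sim_rep (tm_init M w)))).
  apply: (poly_comp poly_sim_out).
  apply: (poly_iter (h := fun=> #|Q|.*2.+1 + n * (8 * #|Sg| + 12))).
  - exact: poly_comp poly_sim_step (poly_snd poly_id).
  - exact: poly_const.
  - move=> _ s; apply: leq_trans (esz_sim_step s) _.
    by rewrite leq_add2l [leqRHS]esz_nat; lia.
  - apply: (poly_ext (f := fun w : bits => (tm_start M : fin Q,
      ([::], [seq (Some (inl b) : fin Sg) | b <- w]) :: nseq n.-1 ([::], [::])))).
      by move=> w; rewrite sim_init.
    apply: poly_pair; first exact: poly_const.
    apply: poly_cons; last exact: poly_const.
    apply: poly_pair; first exact: poly_const.
    apply: poly_map; last exact: poly_id.
    apply: (poly_ext (f := fun p : bits * bool => if p.2 then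
      (Some (inl true) : fin Sg) else (Some (inl false) : fin Sg))).
      by move=> [w []].
    by poly_auto.
  by poly_auto.
move=> w b; rewrite /tm_run; case: ifP => // _ [<-].
have -> T c : iter T sim_step (sim_rep c) = sim_rep (iter T (@tm_step M) c).
  by elim: T => //= T ->; rewrite sim_stepP.
by rewrite /sim_out -nth0 -[0]/(val (ord0 : 'I_n)) nth_sim_rep.
Qed.

End Simulation.

Lemma poly_polytime A (D : A -> Prop) (e F : A -> bits) : polytime D e F ->
  exists2 G : bits -> bits, poly G & forall a, D a -> G (e a) = F a.
Proof.
move=> [M [k H]]; have [G pG HG] := poly_tm_run M k.
by exists G => // a /H /HG.
Qed.

(** * Circuits of Turing machine computations *)

(* The defining clauses of the selection gate [GM c a b] have three literals,
   which leaves room for a control literal. *)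
Inductive sgate := GC of bool | GM of nat & nat & nat.

Definition geval (v : nat -> bool) (g : sgate) : bool :=
  match g with GC b => b | GM c a b => if v c then v a else v b end.

Definition greads (b : nat) (g : sgate) : bool :=
  match g with GC _ => true | GM c a d => [&& c < b, a < b & d < b] end.

(** Circuits are not evaluated: a computation is any assignment of the wires that is consistent with
    every gate, because this is what clauses can express. *)
Definition gsat (v : nat -> bool) (base : nat) (gs : seq sgate) : Prop :=
  forall j, j < size gs -> v (base + j) = geval v (nth (GC false) gs j).

Definition gwf (base : nat) (gs : seq sgate) : Prop :=
  forall j, j < size gs -> greads (base + j) (nth (GC false) gs j).

Lemma gsat_cat v base g1 g2 : gsat v base (g1 ++ g2) ->
  gsat v base g1 /\ gsat v (base + size g1) g2.
Proof.
move=> H; split=> j lt.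
  have := H j; rewrite size_cat nth_cat lt; apply.
  by rewrite ltn_addr.
have := H (size g1 + j); rewrite size_cat ltn_add2l lt nth_cat.
by rewrite ltnNge leq_addr /= addKn addnA; apply.
Qed.

Lemma gwf_cat base g1 g2 :
  gwf base g1 -> gwf (base + size g1) g2 -> gwf base (g1 ++ g2).
Proof.
move=> H1 H2 j; rewrite size_cat nth_cat => lt; case: ltnP => [/H1 //|le].
have := H2 (j - size g1).
by rewrite -addnA subnKC //; apply; lia.
Qed.

(** * Concatenation of gate blocks of equal size *)

Section Blocks.
Variables (blk : nat -> seq sgate) (sg : nat).
Hypothesis size_blk : forall q, size (blk q) = sg.

Lemma size_blocks B : size (flatten [seq blk q | q <- iota 0 B]) = sg * B.
Proof.
elim: B => [|B IH]; first by rewrite muln0.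
by rewrite -addn1 iotaD map_cat flatten_cat size_cat IH /= cats0 size_blk; lia.
Qed.

Lemma gsat_blocks v base B q :
  gsat v base (flatten [seq blk q | q <- iota 0 B]) -> q < B ->
  gsat v (base + sg * q) (blk q).
Proof.
elim: B => // B IH; rewrite -addn1 iotaD map_cat flatten_cat addn1 /= cats0.
move=> /gsat_cat [H1 H2]; rewrite ltnS leq_eqVlt => /orP[/eqP ->|]; last exact: IH.
by move: H2; rewrite size_blocks.
Qed.

Lemma gwf_blocks base B : (forall q, q < B -> gwf (base + sg * q) (blk q)) ->
  gwf base (flatten [seq blk q | q <- iota 0 B]).
Proof.
elim: B => [_ //|B IH] H; rewrite -addn1 iotaD map_cat flatten_cat /= cats0.
apply: gwf_cat; first by apply: IH => q lt; apply: H; lia.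
by rewrite size_blocks; apply: H.
Qed.

End Blocks.

(** * Decision trees of selection gates *)

Fixpoint tsz d := if d is d'.+1 then (tsz d' + tsz d').+1 else 1.

Lemma tsz_gt0 d : 0 < tsz d.
Proof. by case: d. Qed.

(** A full decision tree for an arbitrary boolean function, with its root at the last wire. Its
    exponential size is harmless, since the number of wires read will depend on the Turing machine
    only. *)
Fixpoint tree (ws : seq nat) (phi : bits -> bool) (base : nat) : seq sgate :=
  if ws is w :: ws' then
    let ts := tsz (size ws') in
    tree ws' (fun b => phi (true :: b)) base ++
    tree ws' (fun b => phi (false :: b)) (base + ts) ++
    [:: GM w (base + ts).-1 (base + ts + ts).-1]
  else [:: GC (phi [::])].

Lemma size_tree ws phi base : size (tree ws phi base) = tsz (size ws).
Proof.
by elim: ws phi base => //= w ws IH phi base; rewrite !size_cat !IH /=; lia.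
Qed.

Lemma tree_sat v ws phi base : gsat v base (tree ws phi base) ->
  v (base + tsz (size ws)).-1 = phi (map v ws).
Proof.
elim: ws phi base => [|w ws IH] phi base /=.
  by move=> /(_ 0 isT); rewrite addn0 addn1.
move=> /gsat_cat [H1 /gsat_cat [H2 /(_ 0 isT)]].
rewrite !size_tree addn0 /= (IH _ _ H1) => E.
rewrite size_tree in H2; move: E; rewrite (IH _ _ H2).
by rewrite addnS /= addnA => ->; case: (v w).
Qed.

Lemma tree_wf ws phi base : all (fun w => w < base) ws ->
  gwf base (tree ws phi base).
Proof.
elim: ws phi base => [|w ws IH] phi base /=; first by move=> _ [].
move=> /andP[lw lws]; apply: gwf_cat; first exact: IH.
rewrite size_tree; have gt := tsz_gt0 (size ws); apply: gwf_cat.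
  apply: IH; apply: sub_all lws => x; lia.
by rewrite size_tree => -[|//] _ /=; lia.
Qed.

Definition sg_view (g : sgate) : (bool * bool) * (nat * (nat * nat)) :=
  match g with
  | GC b => ((false, b), (0, (0, 0)))
  | GM c a d => ((true, false), (c, (a, d)))
  end.

Instance emb_sgate : emb sgate := fun g => embed (sg_view g).

Section PolyTree.
Context {X : Type} {eX : emb X}.

Lemma poly_GM (c a d : X -> nat) :
  poly c -> poly a -> poly d -> poly (fun x => GM (c x) (a x) (d x)).
Proof.
move=> pc pa pd.
apply: (poly_cast (f := fun x => ((true, false), (c x, (a x, d x))))) => //.
by poly_auto.
Qed.

Lemma poly_tree d phi (ws : X -> seq nat) (b : X -> nat) :
  (forall x, size (ws x) = d) -> poly ws -> poly b ->
  poly (fun x => tree (ws x) phi (b x)).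
Proof.
elim: d phi ws b => [|d IH] phi ws b sz pw pb'.
  apply: (poly_ext (f := fun=> [:: GC (phi [::])])); last exact: poly_const.
  by move=> x; rewrite (size0nil (sz x)).
apply: (poly_ext (f := fun x =>
   tree (behead (ws x)) (fun b => phi (true :: b)) (b x) ++
   tree (behead (ws x)) (fun b => phi (false :: b)) (b x + tsz d) ++
   [:: GM (head 0 (ws x)) (b x + tsz d).-1 (b x + tsz d + tsz d).-1])).
  by move=> x; case: (ws x) (sz x) => //= w s [->].
have szb x : size (behead (ws x)) = d by rewrite size_behead sz.
apply: poly_cat; first by apply: IH => //; poly_auto.
apply: poly_cat; first by apply: IH => //; poly_auto.
apply: poly_cons; last exact: poly_const.
by apply: poly_GM; poly_auto.
Qed.

Lemma poly_flatten_fixed I (F : I -> X -> seq sgate) (es : seq I) :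
  (forall e, poly (F e)) -> poly (fun x => flatten [seq F e x | e <- es]).
Proof.
move=> pF; elim: es => [|e es IH] /=; first exact: poly_const.
by apply: poly_cat.
Qed.

End PolyTree.

(** * The tableau of a Turing machine computation *)

Section Tableau.
Variable M : tm.
Let K := (tm_work_tapes M).+1.
Let Q := tm_state M.
Let Sy := symbol (tm_work M).

(* Cell 0 holds the state and the scanned symbols; cell [p > 0] holds, for
   each tape, the symbols at distance [p] to the left and to the right of the
   head.  Recentring at the head makes the step a local rule. *)
Definition cell : finType :=
  ((Q * {ffun 'I_K -> Sy}) + {ffun 'I_K -> Sy * Sy})%type.

Definition cell_of (c : tm_config M) (p : nat) : cell :=
  if p is p'.+1
  then inr [ffun i => (nth None (c.2 i).1 p', nth None (c.2 i).2 p)]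
  else inl (c.1, [ffun i => tape_read (c.2 i)]).

Definition lpart (c : cell) i : Sy := if c is inr f then (f i).1 else None.
Definition rpart (c : cell) i : Sy := if c is inr f then (f i).2 else None.

(** The arguments are the head cell and the cells at distance [p - 1], [p] and [p + 1]. When [a] is
    the head cell itself, the symbol entering from it is the one just written. *)
Definition cell_step (c0 a b c : cell) : cell :=
  if c0 is inl qh then
    if tm_final qh.1 then b else
    let: (q', act) := tm_delta qh.1 qh.2 in
    if b is inr f then
      inr [ffun i => match (act i).2 with
        | Left => (lpart c i, if a is inr _ then rpart a i else (act i).1)
        | Stay => f i
        | Right => (if a is inr _ then lpart a i else (act i).1, rpart c i)
        end]
    else
      inl (q', [ffun i => match (act i).2 with
        | Left => lpart c i | Stay => (act i).1 | Right => rpart c i end])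
  else b.

Lemma cell_stepP c p :
  cell_of (tm_step c) p =
  cell_step (cell_of c 0) (cell_of c p.-1) (cell_of c p) (cell_of c p.+1).
Proof.
rewrite /cell_step {2}/cell_of /tm_step /=; case: ifP => // _.
case: (tm_delta _ _) => q act; case: p => [|[|p]] /=.
- congr (inl (_, _)); apply/ffunP => i; rewrite !ffunE /= /tape_read.
  case: (c.2 i) (act i) => l r [a []] /=; rewrite ?nth0 //.
  by case: r => //= _ [].
- congr inr; apply/ffunP => i; rewrite !ffunE /=.
  by case: (c.2 i) (act i) => l r [a []] //=; rewrite ?nth_behead.
congr inr; apply/ffunP => i; rewrite !ffunE /=.
by case: (c.2 i) (act i) => l r [a []] //=; rewrite ?nth_behead.
Qed.

Definition init_cell (first : bool) (o : option bool) : cell :=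
  if first then
    inl (tm_start M, [ffun i => if i == ord0 then omap inl o else None])
  else inr [ffun i => (None, if i == ord0 then omap inl o else None)].

Lemma init_cellP (w : bits) p : cell_of (tm_init M w) p =
  init_cell (p == 0) (if p < size w then Some (nth false w p) else None).
Proof.
have E : nth None [seq Some (inl b) | b <- w] p =
    omap inl (if p < size w then Some (nth false w p) else None) :> Sy.
  case: ltnP => lt; first by rewrite (nth_map false).
  by rewrite nth_default // size_map.
case: p E => [|p] E /=; rewrite /init_cell /=.
  congr (inl (_, _)); apply/ffunP => i; rewrite !ffunE.
  by case: ifP => //= _; rewrite -E /tape_read /= nth0.
congr inr; apply/ffunP => i; rewrite !ffunE; case: ifP => _ /=; last by rewrite nth_nil.
by rewrite nth_nil -E.
Qed.

Definition cell0 : cell := init_cell true None.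
Definition csz := #|cell|.
Definition onehot (x : cell) : bits := [seq x == y | y <- enum cell].
Definition unhot (b : bits) : cell := nth cell0 (enum cell) (find id b).

Lemma size_onehot x : size (onehot x) = csz.
Proof. by rewrite size_map -cardE. Qed.

Lemma onehotK x : unhot (onehot x) = x.
Proof.
rewrite /unhot /onehot find_map -[find _ _]/(find (fun y => x == y) (enum cell)).
have h : has (fun y => x == y) (enum cell).
  by apply/hasP; exists x; rewrite ?mem_enum.
by apply/esym/eqP; have := nth_find cell0 h.
Qed.

Definition step_bits (b : bits) : cell :=
  cell_step (unhot (take csz b)) (unhot (take csz (drop csz b)))
    (unhot (take csz (drop (csz + csz) b)))
    (unhot (take csz (drop (csz + csz + csz) b))).

(* Rule of a block: [None] for a step, [Some (f, o)] for an initial cell, read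
   from a variable wire if [o = None]. *)
Definition mode : finType := option (bool * option (option bool)).

Definition mode_cell (m : mode) (b : bits) : cell :=
  match m with
  | None => step_bits b
  | Some (f, None) => init_cell f (Some (head false b))
  | Some (f, Some o) => init_cell f o
  end.

Definition dim := csz + csz + csz + csz.
Definition tau := tsz dim.
Definition sigma := tau * csz.
(** Fixes the depth of the trees for every list of wires, so that their construction is polynomial
    for arbitrary arguments. *)
Definition norm (ws : seq nat) := mkseq (nth 0 ws) dim.

Definition block (m : mode) (ws : seq nat) (base : nat) : seq sgate :=
  flatten [seq tree (norm ws) (fun b => nth false (onehot (mode_cell m b)) e)
             (base + tau * e) | e <- iota 0 csz].

Lemma size_block m ws base : size (block m ws base) = sigma.
Proof.
by rewrite (size_blocks (sg := tau)) // => q; rewrite size_tree size_mkseq.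
Qed.

Lemma block_sat v m ws base : gsat v base (block m ws base) ->
  size ws = dim ->
  mkseq (fun e => v (base + tau * e + tau).-1) csz =
  onehot (mode_cell m (map v ws)).
Proof.
move=> H sz; apply: (eq_from_nth (x0 := false)).
  by rewrite size_mkseq size_onehot.
move=> e; rewrite size_mkseq => lt; rewrite nth_mkseq //.
have nE : norm ws = ws by rewrite /norm -sz mkseq_nth.
have szt q : size (tree (norm ws) (fun b => nth false (onehot (mode_cell m b)) q)
    (base + tau * q)) = tau by rewrite size_tree size_mkseq.
have := tree_sat (gsat_blocks szt H lt).
by rewrite nE sz.
Qed.

Lemma take_norm ws : size ws <= dim -> take (size ws) (norm ws) = ws.
Proof.
move=> le; have sz : size (take (size ws) (norm ws)) = size ws.
  by rewrite size_takel // size_mkseq.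
apply: (eq_from_nth (x0 := 0)) => // i; rewrite sz => lt.
by rewrite nth_take // nth_mkseq // (leq_trans lt).
Qed.

Lemma all_norm base ws : 0 < base -> all (fun w => w < base) ws ->
  all (fun w => w < base) (norm ws).
Proof.
move=> b0 /allP H; apply/allP => w /mapP[i _ ->].
have [lt|ge] := ltnP i (size ws); last by rewrite nth_default.
by apply: H; rewrite mem_nth.
Qed.

Lemma block_wf m ws base : 0 < base -> all (fun w => w < base) ws ->
  gwf base (block m ws base).
Proof.
move=> b0 H; apply: (gwf_blocks (sg := tau)).
  by move=> q; rewrite size_tree size_mkseq.
move=> q _; apply: tree_wf; apply: all_norm; first by lia.
by apply: sub_all H => w; lia.
Qed.

Section Gates.
Variables (pre : bits) (n T outl : nat).
Let c := size pre.
(** One column is lost at the right border in each step; [T] extra columns keep the output cells of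
    the last row correct. *)
Definition width := T + outl + 2.
Let N := width.

Definition base0 := n.+1.
Definition wire q e := (base0 + sigma * q + tau * e + tau).-1.
Definition cwires q := [seq wire q e | e <- iota 0 csz].

Definition block_mode (q : nat) : mode :=
  if q < N then
    if q < c then Some (q == 0, Some (Some (nth false pre q)))
    else if q < c + n then Some (q == 0, None) else Some (q == 0, Some None)
  else None.

(** Blocks are numbered row by row. In the first row the only wire of interest is repeated. Later
    blocks read the head cell and three neighbours in the previous row; in the last column the
    missing right neighbour is replaced by the cell itself, which may give wrong contents. *)
Definition block_wires (q : nat) : seq nat :=
  if q < N then
    nseq dim (if q < c then n else if q < c + n then q - c else n)
  else
    let r := (q %/ N).-1 * N in let p := q %% N in
    cwires r ++ cwires (r + p.-1) ++ cwires (r + p) ++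
    cwires (r + (if p.+1 < N then p.+1 else p)).

Definition cblock q := block (block_mode q) (block_wires q) (base0 + sigma * q).

Definition bit_bits (b : bits) : bool :=
  match unhot (take csz b) with
  | inl qh => qh.2 ord0 == Some (inl true)
  | inr f => (f ord0).2 == Some (inl true)
  end.

Definition base1 := base0 + sigma * (T.+1 * N).

Definition oblock j :=
  tree (norm (cwires (T * N + j))) bit_bits (base1 + tau * j).

(** The constant gate occupies wire [n], which is read by blocks of the first row that need no
    variable. It also ensures that wire 0, the default in [norm], exists when [n = 0]. *)
Definition tgates : seq sgate :=
  GC false :: flatten [seq cblock q | q <- iota 0 (T.+1 * N)] ++
  flatten [seq oblock j | j <- iota 0 outl].

Definition touts : seq nat :=
  [seq (base1 + tau * j + tau).-1 | j <- iota 0 outl].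

Lemma size_cwires q : size (cwires q) = csz.
Proof. by rewrite size_map size_iota. Qed.

Lemma size_block_wires q : size (block_wires q) = dim.
Proof.
rewrite /block_wires; case: ifP => _; first by rewrite size_nseq.
by rewrite !size_cat !size_cwires /dim; lia.
Qed.

Lemma size_oblock j : size (oblock j) = tau.
Proof. by rewrite size_tree size_mkseq. Qed.

Lemma size_tgates : size tgates = (sigma * (T.+1 * N) + tau * outl).+1.
Proof.
rewrite /= size_cat (size_blocks (sg := sigma)); last by move=> q; exact: size_block.
by rewrite (size_blocks (sg := tau)) //; exact: size_oblock.
Qed.

Lemma wire_lt q q' e : q' < q -> e < csz -> wire q' e < base0 + sigma * q.
Proof.
move=> lq le; rewrite /wire /sigma.
have h1 : tau * e.+1 <= tau * csz by rewrite leq_mul2l le orbT.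
have h2 : tau * csz * q'.+1 <= tau * csz * q by rewrite leq_mul2l lq orbT.
rewrite mulnS in h1; rewrite mulnS in h2; have := tsz_gt0 dim; rewrite -/tau.
by lia.
Qed.

Lemma cwires_lt q q' : q' < q ->
  all (fun w => w < base0 + sigma * q) (cwires q').
Proof.
move=> lq; apply/allP => w /mapP[e]; rewrite mem_iota => /andP[_ le] ->.
exact: wire_lt.
Qed.

Lemma N_gt0 : 0 < N. Proof. by rewrite /N /width addn2. Qed.

Lemma block_wires_lt q : all (fun w => w < base0 + sigma * q) (block_wires q).
Proof.
rewrite /block_wires; case: ltnP => lq.
  apply/allP => w; rewrite mem_nseq => /andP[_ /eqP ->].
  by rewrite /base0; case: ifP => ?; [|case: ifP => ?]; lia.
have h1 : (q %/ N).-1 * N + N <= (q %/ N) * N.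
  by have := divn_gt0 q N_gt0; rewrite lq; case: (q %/ N) => // k _; rewrite mulSn addnC.
have h2 := divn_eq q N; have h3 := ltn_pmod q N_gt0.
by rewrite !all_cat !cwires_lt //; first [lia | case: ifP => ?; lia].
Qed.

Lemma tgates_wf : gwf n tgates.
Proof.
rewrite /tgates -cat1s; apply: gwf_cat; first by case.
rewrite addn1 -/base0; apply: gwf_cat.
  apply: (gwf_blocks (sg := sigma)); first by move=> q; exact: size_block.
  by move=> q _; apply: block_wf; [|exact: block_wires_lt].
rewrite (size_blocks (sg := sigma)); last by move=> q; exact: size_block.
rewrite -/base1; apply: (gwf_blocks (sg := tau)); first exact: size_oblock.
move=> j lt; apply: tree_wf; apply: all_norm; first by rewrite /base1 /base0; lia.
have : T * N + j < T.+1 * N by rewrite mulSn /N /width; lia.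
by move=> /cwires_lt; apply: sub_all => w; rewrite /base1; lia.
Qed.

Lemma touts_lt : all (fun o => o < n + size tgates) touts.
Proof.
apply/allP => o /mapP[j]; rewrite mem_iota => /andP[_ lt] ->.
rewrite size_tgates /base1 /base0.
have h1 : tau * j.+1 <= tau * outl by rewrite leq_mul2l lt orbT.
by rewrite mulnS in h1; have := tsz_gt0 dim; rewrite -/tau; lia.
Qed.

Section Sound.
Variable v : nat -> bool.
Hypothesis vsat : gsat v n tgates.
Let w := mkseq v n.

Lemma cblock_sat q : q < T.+1 * N ->
  [seq v x | x <- cwires q] =
  onehot (mode_cell (block_mode q) (map v (block_wires q))).
Proof.
move: vsat; rewrite /tgates -cat1s => /gsat_cat[_]; rewrite addn1.
move=> /gsat_cat[H _] lq.
have Hq := gsat_blocks (fun q => size_block _ _ _) H lq.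
rewrite -(block_sat Hq (size_block_wires q)) /cwires -map_comp.
by apply: eq_map => e.
Qed.

(** A cell depends on neighbours at distance at most one, so the errors created at the right border
    have moved at most [t] columns after [t] steps. This also covers inputs longer than the table is
    wide. *)
Lemma row_sat t p : t <= T -> p + t < N ->
  [seq v x | x <- cwires (t * N + p)] =
  onehot (cell_of (iter t (@tm_step M) (tm_init M (pre ++ w))) p).
Proof.
have sw : size (pre ++ w) = c + n by rewrite size_cat size_mkseq.
elim: t p => [|t IH] p leT ltN.
  rewrite addn0 in ltN; rewrite mul0n add0n cblock_sat; last by rewrite mulSn; lia.
  congr onehot; rewrite /block_mode /block_wires ltN /= init_cellP sw nth_cat.
  rewrite -/c; case: ltnP => pc /=; first by rewrite ltn_addr.
  case: ltnP => pn //=.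
  rewrite nth_mkseq; last by lia.
  have : 0 < dim.
    rewrite /dim; have : 0 < csz by apply/card_gt0P; exists cell0.
    by lia.
  by case: dim.
have E : t.+1 * N + p < T.+1 * N.
  apply: (@leq_trans (t.+1 * N + N)); first by rewrite ltn_add2l; lia.
  by rewrite addnC -mulSn leq_mul.
rewrite cblock_sat // iterS cell_stepP; congr onehot.
rewrite /block_mode /block_wires.
have -> : t.+1 * N + p < N = false by rewrite mulSn; lia.
have lp : p < N by lia.
rewrite divnMDl ?N_gt0 // divn_small // addn0 modnMDl modn_small // succnK.
have -> : p.+1 < N by lia.
rewrite !map_cat -{1}[t * N]addn0 !IH; try by lia.
rewrite [LHS]/= /step_bits.
set u0 := onehot _; set u1 := onehot _; set u2 := onehot _; set u3 := onehot _.
have [s0 s1 s2 s3] : [/\ size u0 = csz, size u1 = csz, size u2 = csz & size u3 = csz].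
  by rewrite !size_onehot.
have d1 : drop csz (u0 ++ u1 ++ u2 ++ u3) = u1 ++ u2 ++ u3.
  by rewrite drop_size_cat.
have d2 : drop (csz + csz) (u0 ++ u1 ++ u2 ++ u3) = u2 ++ u3.
  by rewrite catA drop_size_cat ?size_cat ?s0 ?s1.
have d3 : drop (csz + csz + csz) (u0 ++ u1 ++ u2 ++ u3) = u3.
  by rewrite !catA drop_size_cat ?size_cat ?s0 ?s1 ?s2 ?size_cat ?s0 ?s1.
by rewrite d1 d2 d3 !take_size_cat // take_oversize ?s3 // !onehotK.
Qed.

Lemma tgates_sound b : tm_run M (pre ++ w) T = Some b -> size b = outl ->
  [seq v o | o <- touts] = b.
Proof.
rewrite /tm_run; set cf := iter _ _ _; case: ifP => // _ [Eb] sb.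
apply: (eq_from_nth (x0 := false)); first by rewrite !size_map size_iota sb.
move=> j; rewrite !size_map size_iota => lt.
rewrite -map_comp (nth_map 0) ?size_iota // nth_iota // add0n /comp.
move: vsat; rewrite /tgates -cat1s => /gsat_cat[_]; rewrite addn1.
move=> /gsat_cat[_]; rewrite (size_blocks (sg := sigma)); last first.
  by move=> q; exact: size_block.
move=> H; have := tree_sat (gsat_blocks size_oblock H lt).
rewrite size_mkseq -/tau -/base0 -/base1 => ->.
have rs := @row_sat T j (leqnn _); rewrite -/cf in rs.
rewrite /bit_bits -map_take -{1}(size_cwires (T * N + j)) take_norm; last first.
  by rewrite size_cwires /dim; lia.
rewrite rs; last by rewrite /N /width; lia.
rewrite onehotK.
have Er : nth None (cf.2 ord0).2 j = Some (inl (nth false b j)).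
  rewrite -sb in lt; rewrite -Eb in lt *.
  elim: (cf.2 ord0).2 j lt {rs} => [|[[a|a]|] r IH] [|j] //= lt; exact: IH.
case: j Er {lt rs} => [|j] Er /=; rewrite ffunE; last by rewrite Er; case: (nth _ _ _).
by rewrite /tape_read -nth0 Er; case: (nth _ _ _).
Qed.

End Sound.
End Gates.
End Tableau.

Section PolyGates.
Variable M : tm.
Context {X : Type} {eX : emb X}.

Lemma poly_norm (ws : X -> seq nat) : poly ws -> poly (fun x => norm M (ws x)).
Proof. by move=> pw; rewrite /norm /mkseq; poly_auto. Qed.

Lemma poly_cwires (n q : X -> nat) :
  poly n -> poly q -> poly (fun x => cwires M (n x) (q x)).
Proof. by move=> pn pq; rewrite /cwires /wire /base0; poly_auto. Qed.

End PolyGates.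

Section PolyGates2.
Variable M : tm.
Context {X : Type} {eX : emb X}.

Lemma poly_block (m : X -> fin mode) (ws : X -> seq nat) (b : X -> nat) :
  poly m -> poly ws -> poly b -> poly (fun x => block M (m x) (ws x) (b x)).
Proof.
move=> pm pw pb'.
apply: (poly_comp (g := fun p : fin mode * (seq nat * nat) =>
  block M p.1 p.2.1 p.2.2) _ (poly_pair pm (poly_pair pw pb'))).
apply: (poly_fin_family (F := fun m p => block M m p.1 p.2)) => m'.
apply: poly_flatten_fixed => e; apply: (poly_tree (d := dim M)).
- by move=> x; rewrite size_mkseq.
- by apply: poly_norm; poly_auto.
by poly_auto.
Qed.

End PolyGates2.

Section PolyGates3.
Variable M : tm.
Context {X : Type} {eX : emb X}.
Variables (pre : X -> bits) (n T outl : X -> nat).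
Hypotheses (ppre : poly pre) (pn : poly n) (pT : poly T) (po : poly outl).

Lemma poly_block_mode (q : X -> nat) : poly q ->
  poly (fun x => block_mode (pre x) (n x) (T x) (outl x) (q x) : fin mode).
Proof.
move=> pq.
have fm f : poly f -> poly (fun x : X => Some (f x, None) : fin mode).
  move=> pf; apply: (poly_ext (f := fun x => if f x then
    (Some (true, None) : fin mode) else (Some (false, None) : fin mode))).
    by move=> x; case: (f x).
  by poly_auto.
have fc o f : poly f -> poly (fun x : X => Some (f x, Some o) : fin mode).
  move=> pf; apply: (poly_ext (f := fun x => if f x then
    (Some (true, Some o) : fin mode) else (Some (false, Some o) : fin mode))).
    by move=> x; case: (f x).
  by poly_auto.
have pb0 : poly (fun x => nth false (pre x) (q x)) by poly_auto.
have p0 : poly (fun x => q x == 0) by poly_auto.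
rewrite /block_mode /width.
apply: poly_if; [by poly_auto| |exact: (poly_const (None : fin mode))].
apply: poly_if; [by poly_auto| |].
  apply: (poly_ext (f := fun x => if nth false (pre x) (q x) then
    (Some (q x == 0, Some (Some true)) : fin mode)
    else (Some (q x == 0, Some (Some false)) : fin mode))).
    by move=> x; case: (nth _ _ _).
  by apply: poly_if => //; apply: fc.
apply: poly_if; [by poly_auto|exact: fm|exact: fc].
Qed.

Lemma poly_block_wires (q : X -> nat) : poly q ->
  poly (fun x => block_wires M (pre x) (n x) (T x) (outl x) (q x)).
Proof.
move=> pq; rewrite /block_wires /width.
apply: poly_if; [by poly_auto|by poly_auto|].
by repeat apply: poly_cat; apply: poly_cwires; poly_auto.
Qed.

Lemma poly_touts : poly (fun x => touts M (n x) (T x) (outl x)).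
Proof. by rewrite /touts /base1 /base0 /width; poly_auto. Qed.

End PolyGates3.

Lemma poly_tgates M X {eX : emb X} (pre : X -> bits) (n T outl : X -> nat) :
  poly pre -> poly n -> poly T -> poly outl ->
  poly (fun x => tgates M (pre x) (n x) (T x) (outl x)).
Proof.
move=> ppre pn pT po; rewrite /tgates; apply: poly_cons; first exact: poly_const.
apply: poly_cat; apply: poly_flatten; apply: poly_map.
- rewrite /cblock; apply: poly_block.
  + by apply: poly_block_mode; poly_auto.
  + by apply: poly_block_wires; poly_auto.
  by rewrite /base0; poly_auto.
- by rewrite /width; poly_auto.
- rewrite /oblock; apply: (poly_tree (d := dim M)).
  + by move=> x; rewrite size_mkseq.
  + by apply: poly_norm; apply: poly_cwires; rewrite /width; poly_auto.
  by rewrite /base1 /base0 /width; poly_auto.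
by poly_auto.
Qed.

(** * Local search by lexicographic satisfiability *)

Lemma foldl_bin b m :
  foldl (fun n (d : bool) => n.*2 + d) m b = m * 2 ^ size b + bin_val b.
Proof.
rewrite /bin_val; elim: b m => [|d b IH] m /=; first by rewrite muln1 addn0.
rewrite IH [in RHS]IH mulnDl -muln2 -mulnA expnS double0 add0n; lia.
Qed.

Lemma bin_val_cons d b : bin_val (d :: b) = d * 2 ^ size b + bin_val b.
Proof. by rewrite /bin_val /= double0 add0n foldl_bin. Qed.

Lemma bin_val_lt b : bin_val b < 2 ^ size b.
Proof.
elim: b => [|d b IH] //; rewrite bin_val_cons /= expnS.
by case: d; rewrite ?mul1n ?mul0n; lia.
Qed.

Lemma bin_val_first s t : size s = size t -> bin_val s < bin_val t ->
  exists k, [/\ k < size s, forall i, i < k -> nth false s i = nth false t i,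
    nth false s k = false & nth false t k = true].
Proof.
elim: s t => [|a s IH] [|b t] //= [sz]; rewrite !bin_val_cons sz.
have := bin_val_lt s; have := bin_val_lt t; rewrite sz.
case: (a =P b) => [->|ne] l1 l2.
  rewrite ltn_add2l => /(IH _ sz)[k [lt E e1 e2]].
  exists k.+1; split=> //; first by rewrite ltnS -sz.
  by case=> [|i] //=; exact: E.
case: a b ne => [] [] // _; first by rewrite mul1n mul0n; lia.
by exists 0; split.
Qed.

(** Before position [k] it is enough that no bit is lost. Hence it need not be known whether a flip
    also happens to satisfy heavier clauses. *)
Lemma bin_val_ltP s t k : size s = size t -> k < size s ->
  (forall i, i < k -> nth false s i -> nth false t i) ->
  nth false s k = false -> nth false t k = true -> bin_val s < bin_val t.
Proof.
elim: s t k => [|a s IH] [|b t] [|k] //= [sz] lt E; rewrite !bin_val_cons sz.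
  by move=> -> ->; have := bin_val_lt s; rewrite sz mul1n mul0n; lia.
move=> e1 e2; have := IH _ k sz lt (fun i li => E i.+1 li) e1 e2.
by have := E 0 isT => /= {E}; case: a; case: b => //= E0; try (by have := E0 isT); lia.
Qed.

Lemma sat_payoffE F a :
  sat_payoff F a = bin_val [seq clause_sat a C | C <- sat_clauses F].
Proof.
rewrite /sat_payoff; elim: (sat_clauses F) => [|C s IH]; first by rewrite big_ord0.
rewrite bin_val_cons size_map -IH big_mkcond big_ord_recl /= -big_mkcond /= subn1.
by congr (_ + _); case: (clause_sat a C); rewrite ?mul1n ?mul0n.
Qed.

Lemma payoff_improve F a a' pre C post :
  sat_clauses F = pre ++ C :: post ->
  (forall D, D \in pre -> clause_sat a D -> clause_sat a' D) ->
  ~~ clause_sat a C -> clause_sat a' C -> sat_payoff F a < sat_payoff F a'.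
Proof.
move=> E keep nC sC; rewrite !sat_payoffE E !map_cat /=.
apply: (@bin_val_ltP _ _ (size pre)).
- by rewrite !size_cat /= !size_map.
- by rewrite size_cat /= size_map; lia.
- move=> i lt; rewrite !nth_cat !size_map lt !(nth_map [::]) //.
  by apply: keep; rewrite mem_nth.
- by rewrite nth_cat size_map ltnn subnn; exact: negbTE.
by rewrite nth_cat size_map ltnn subnn.
Qed.

Lemma nth_flip z a y : z < size a ->
  nth false (flip z a) y = if y == z then ~~ nth false a z else nth false a y.
Proof. by move=> lt; rewrite nth_set_nth /=. Qed.

Lemma size_flip z a : z < size a -> size (flip z a) = size a.
Proof. by move=> lt; rewrite size_set_nth; apply/maxn_idPr. Qed.

Lemma flatten_split A (F : nat -> seq A) k B : k < B ->
  flatten [seq F j | j <- iota 0 B] = flatten [seq F j | j <- iota 0 k] ++ F k ++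
    flatten [seq F j | j <- iota k.+1 (B - k.+1)].
Proof.
move=> lt; have -> : iota 0 B = iota 0 k ++ k :: iota k.+1 (B - k.+1).
  by have -> : B = k + (B - k.+1).+1; [lia|rewrite iotaD add0n /=; do 3 f_equal; lia].
by rewrite map_cat flatten_cat.
Qed.

(** * The formula *)

Section Core.
Variables (n m : nat) (gs : seq sgate) (outs : seq nat).

(** Order of the variables: the visible copy [x], the control variable, the value bits, the wires of
    register [false], the wires of register [true]. *)
Definition nwires := n + size gs.
Definition uvar := n.
Definition vvar k := n.+1 + k.
Definition off (r : bool) := n.+1 + m + (if r then nwires else 0).
Definition core_vars := n.+1 + m + nwires + nwires.
Definition ulit (b : bool) : literal := (uvar, b).
Definition out k := nth 0 outs k.

Definition gate_clauses (ctl : literal) (o y : nat) (g : sgate)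
    : seq (seq literal) :=
  match g with
  | GC b => [:: [:: ctl; (y, b)]]
  | GM c a d =>
    [:: [:: ctl; (o + c, false); (o + a, false); (y, true)];
        [:: ctl; (o + c, false); (o + a, true); (y, false)];
        [:: ctl; (o + c, true); (o + d, false); (y, true)];
        [:: ctl; (o + c, true); (o + d, true); (y, false)]]
  end.

Definition gate_block (r c : bool) (j : nat) : seq (seq literal) :=
  gate_clauses (ulit c) (off r) (off r + (n + j)) (nth (GC false) gs j).

Definition gates_clauses (r c : bool) : seq (seq literal) :=
  flatten [seq gate_block r c j | j <- iota 0 (size gs)].

Definition eq_clauses (c : bool) (x y : nat) : seq (seq literal) :=
  [:: [:: ulit c; (x, false); (y, true)]; [:: ulit c; (x, true); (y, false)]].

(** Only the implication from the value bit to the active output is imposed; the lighter unit clause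
    then rewards setting the bit. Since the unit clauses are ordered by significance, they make the
    payoff increase with the value. *)
Definition value_block (k : nat) : seq (seq literal) :=
  [:: [:: (vvar k, false); (off false + out k, true); ulit true];
      [:: (vvar k, false); (off true + out k, true); ulit false];
      [:: (vvar k, true)]].

Definition next_block (i : nat) : seq (seq literal) :=
  eq_clauses true (off true + i) (off false + out (m + i)) ++
  eq_clauses false (off false + i) (off true + out (m + i)).

Definition copy_block (i : nat) : seq (seq literal) :=
  eq_clauses true i (off false + i) ++ eq_clauses false i (off true + i).

(* Register [r] is active when the control variable equals [r]. *)
Definition core_clauses : seq (seq literal) :=
  (gates_clauses false true ++ gates_clauses true false) ++
  flatten [seq value_block k | k <- iota 0 m] ++
  flatten [seq next_block i | i <- iota 0 n] ++
  (gates_clauses false false ++ gates_clauses true true) ++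
  flatten [seq copy_block i | i <- iota 0 n].

Definition core_forbidden : seq (nat * nat) :=
  flatten [seq [seq (x, y) | x <- iota 0 y] | y <- iota 0 n].

Definition core_sat : sat_instance :=
  SatInstance core_vars core_clauses core_forbidden.

Lemma core_forbiddenP x y : ((x, y) \in core_forbidden) = (x < y < n).
Proof.
apply/flatten_mapP/andP => [[z] | [lxy lyn]].
  rewrite mem_iota => /andP[_ lz] /mapP[w]; rewrite mem_iota => /andP[_ lw] [-> ->].
  by rewrite add0n in lw lz.
by exists y; rewrite ?mem_iota //; apply/mapP; exists x; rewrite ?mem_iota.
Qed.

Hypothesis gs_wf : gwf n gs.
Hypothesis outs_lt : all (fun o => o < nwires) outs.

Lemma out_lt k : k < size outs -> out k < nwires.
Proof. by move=> lt; apply: (allP outs_lt); rewrite mem_nth. Qed.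

Lemma gate_clauses_all (P : pred (seq literal)) ctl o y g b :
  greads b g ->
  (forall D : seq literal, size D <= 4 -> ctl \in D -> all (fun l : literal =>
     [|| l == ctl, l.1 == y | (o <= l.1) && (l.1 < o + b)]) D -> P D) ->
  all P (gate_clauses ctl o y g).
Proof.
case: g => [c|c a d] /= lt H.
  by rewrite H //= ?in_cons ?eqxx ?orbT.
move: lt => /and3P[l1 l2 l3].
by rewrite !H //= ?in_cons ?eqxx ?orbT //= !leq_addr !ltn_add2l ?l1 ?l2 ?l3 ?orbT.
Qed.

Lemma core_wf : m + n <= size outs -> sat_wf core_sat.
Proof.
move=> szo; apply/andP; split; last first.
  by apply/allP => -[x y]; rewrite core_forbiddenP /= /core_vars => /andP[-> /=]; lia.
have gw r c : all (fun C : seq literal => (size C <= 4) &&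
    all (fun l : literal => l.1 < core_vars) C) (gates_clauses r c).
  apply/allP => C /flatten_mapP[j]; rewrite mem_iota => /andP[_ lj].
  have lo : off r + nwires <= core_vars by rewrite /off /core_vars; case: (r); lia.
  apply/allP: C; apply: (gate_clauses_all (gs_wf lj)) => D -> _ /=.
  apply: sub_all => l /or3P[/eqP -> | /eqP -> | ] /=.
  - by rewrite /core_vars /uvar; lia.
  - by apply: leq_trans lo; rewrite ltn_add2l /nwires; lia.
  move=> /andP[_ lt]; apply: leq_trans lo; apply: leq_trans lt _.
  by rewrite leq_add2l /nwires; lia.
have ol r k : k < m + n -> off r + out k < core_vars.
  move=> lt; have := out_lt (leq_trans lt szo); rewrite /off /core_vars.
  by case: (r); lia.
rewrite !all_cat !gw /=; apply/and3P; split.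
- apply/allP => C /flatten_mapP[k]; rewrite mem_iota => /andP[_ lk].
  rewrite !inE => /or3P[] /eqP -> /=; rewrite ?ol //; rewrite /core_vars /uvar /vvar; lia.
- apply/allP => C /flatten_mapP[k]; rewrite mem_iota => /andP[_ lk].
  have h r : off r + k < core_vars.
    by rewrite /off /core_vars /nwires; case: (r); lia.
  rewrite mem_cat !inE -!orbA => /or4P[] /eqP -> /=; rewrite ?ol ?h //;
    rewrite /core_vars /uvar /vvar; lia.
apply/allP => C /flatten_mapP[k]; rewrite mem_iota => /andP[_ lk].
have h r : off r + k < core_vars.
  by rewrite /off /core_vars /nwires; case: (r); lia.
rewrite mem_cat !inE -!orbA => /or4P[] /eqP -> /=; rewrite ?ol ?h //;
  rewrite /core_vars /uvar /vvar; lia.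
Qed.


Lemma gate_clauses_sat a ctl o y g : nth false a ctl.1 == ctl.2 = false ->
  all (clause_sat a) (gate_clauses ctl o y g) =
  (nth false a y == geval (fun w => nth false a (o + w)) g).
Proof.
move=> nc; case: g => [b|c x d] /=; rewrite /clause_sat /= nc /=.
  by rewrite orbF andbT.
by case: (nth _ a (o + c)); case: (nth _ a (o + x)); case: (nth _ a (o + d));
  case: (nth _ a y).
Qed.

Hypothesis szo : m + n <= size outs.

(** * Local optima of the formula *)

Section Opt.
Variable a : bits.
Hypothesis sza : size a = core_vars.
Hypothesis opt : forall a', sat_nbr core_sat a a' ->
  ~~ (sat_payoff core_sat a < sat_payoff core_sat a').
Let A z := nth false a z.
Let r := A uvar.

(** A syntactic condition under which flipping a variable [z] other than the control variable cannot
    falsify [D]: either [D] is satisfied by the control variable, or [z] does not occur in it. *)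
Definition keeps z (D : seq literal) := (ulit r \in D) || (z \notin map fst D).

Lemma keepsP z D : z < core_vars -> z != uvar -> keeps z D ->
  clause_sat a D -> clause_sat (flip z a) D.
Proof.
move=> lz nu /orP[uD _|zD /hasP[l lD sl]]; apply/hasP.
  exists (ulit r) => //; rewrite /= nth_flip ?sza // [uvar == z]eq_sym (negbTE nu).
  by rewrite /r /A eqxx.
exists l => //; rewrite nth_flip ?sza //; case: (l.1 =P z) => // E.
by move: zD; rewrite -E map_f.
Qed.

(** An unsatisfied clause of [blk] would be gained by flipping [z], while no heavier clause is lost;
    clauses of [post] may be lost, but they are lighter. The steps below apply this with suitable
    [z] and [blk]. *)
Lemma opt_block z pre blk post : core_clauses = pre ++ blk ++ post ->
  z < core_vars -> z != uvar -> all (keeps z) pre ->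
  all (clause_sat (flip z a)) blk -> all (clause_sat a) blk.
Proof.
move=> E lz nu kp sb; apply/allP => C Cb; apply/negPn/negP => nC.
have [b1 [b2 Eb]] : exists b1 b2, blk = b1 ++ C :: b2.
  by case/splitPr: Cb => b1 b2; exists b1, b2.
have := opt (a' := flip z a) (or_introl (ex_intro2 _ _ z lz erefl)).
apply/negP/negPn; apply: (@payoff_improve _ _ _ (pre ++ b1) C (b2 ++ post)) => //.
- by rewrite /= E Eb -!catA.
- move=> D; rewrite mem_cat => /orP[Dp|Db].
    by apply: keepsP => //; exact: (allP kp).
  by move=> _; apply: (allP sb); rewrite Eb mem_cat Db.
exact: (allP sb).
Qed.

Lemma off_range r0 w : w < nwires ->
  [/\ off r0 + w < core_vars, off r0 + w != uvar,
      (forall k, k < m -> off r0 + w != vvar k),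
      (forall i, i < n -> off r0 + w != i) &
      (forall w', w' < nwires -> off r0 + w != off (~~ r0) + w')].
Proof.
move=> lw; rewrite /off /core_vars /uvar /vvar.
by case: r0 => /=; split=> *; try apply/eqP; lia.
Qed.

Lemma keeps_relaxed z D : ulit r \in D -> keeps z D.
Proof. by rewrite /keeps => ->. Qed.

(** A gate reads earlier wires only, so its clauses mention no wire after its own. *)
Lemma keeps_gate z r0 c j : j < size gs -> z != uvar ->
  (c == r) || ~~ (off r0 <= z <= off r0 + (n + j)) ->
  all (keeps z) (gate_block r0 c j).
Proof.
move=> lj nu cond; apply: (gate_clauses_all (gs_wf lj)) => D _ uD allD.
case/orP: cond => [/eqP Ec|out_z]; first by apply: keeps_relaxed; rewrite -Ec.
rewrite /keeps; apply/orP; right; apply/mapP => -[l lD Ez].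
have := allP allD _ lD; case/or3P => [/eqP El|/eqP El|/andP[l1 l2]].
- by move: nu; rewrite Ez El eqxx.
- by move: out_z; rewrite Ez El; lia.
by move: out_z; rewrite Ez; lia.
Qed.

Lemma keeps_gates z r0 c : z != uvar ->
  (c == r) || ~~ (off r0 <= z < off r0 + nwires) ->
  all (keeps z) (gates_clauses r0 c).
Proof.
move=> nu cond; apply/allP => D /flatten_mapP[j]; rewrite mem_iota => /andP[_ lj].
apply/allP: D; apply: keeps_gate => //.
by case/orP: cond => [->//|h]; rewrite orbC; apply/orP; left; rewrite /nwires in h; lia.
Qed.

Lemma keeps_value z k : z != uvar -> z != vvar k -> z != off r + out k ->
  all (keeps z) (value_block k).
Proof.
move=> nu nv no; rewrite /= /keeps /= !inE !negb_or nu nv /= !andbT.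
by case: r no => no /=; rewrite ?no ?eqxx ?orbT.
Qed.

Lemma keeps_eq z c x y : z != uvar ->
  (c == r) || (z != x) && (z != y) -> all (keeps z) (eq_clauses c x y).
Proof.
move=> nu /orP[/eqP ->|/andP[nx ny]]; rewrite /= /keeps !inE ?eqxx //=.
by rewrite !negb_or nu nx ny !orbT.
Qed.

Lemma keeps_next z i : z != uvar -> z != off (~~ r) + i ->
  z != off r + out (m + i) -> all (keeps z) (next_block i).
Proof.
move=> nu n1 n2.
by rewrite all_cat !keeps_eq //; case: r n1 n2 => /= n1 n2; rewrite ?n1 ?n2 ?orbT.
Qed.

Lemma keeps_flatten z F B :
  (forall j, j < B -> all (keeps z) (F j)) ->
  all (keeps z) (flatten [seq F j | j <- iota 0 B]).
Proof.
move=> H; apply/allP => D /flatten_mapP[j]; rewrite mem_iota => /andP[_ lj].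
exact/allP/H.
Qed.

Lemma ulitN_unsat z : z != uvar -> z < core_vars ->
  nth false (flip z a) (ulit (~~ r)).1 == (ulit (~~ r)).2 = false.
Proof.
move=> nu lz; rewrite /= nth_flip ?sza // [uvar == z]eq_sym (negbTE nu) -/(A _) -/r.
by case: r.
Qed.

(** Correcting a gate can damage only later gates of the same register, and their clauses are
    lighter. The control literal [~~ r] is false, so the clauses of this group are in force. *)
Lemma opt_gates r0 P R : core_clauses = P ++ gates_clauses r0 (~~ r) ++ R ->
  (forall j, j < size gs -> all (keeps (off r0 + (n + j))) P) ->
  gsat (fun w => A (off r0 + w)) n gs.
Proof.
move=> E kP j lj; set y := off r0 + (n + j).
have lw : n + j < nwires by rewrite ltn_add2l.
have [ly nu _ _ _] := off_range r0 lw; rewrite -/y in ly nu.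
have un : nth false a (ulit (~~ r)).1 == (ulit (~~ r)).2 = false.
  by rewrite /= -/(A _) -/r; case: r.
apply/eqP/negPn/negP => ne; move/negP: (ne); apply.
rewrite -(gate_clauses_sat (off r0) y _ un).
have := E; rewrite /gates_clauses (flatten_split _ lj) -!catA catA => E'.
apply: (opt_block E' ly nu).
  rewrite all_cat kP //=; apply: keeps_flatten => j' lj'.
  by apply: keeps_gate => //; [lia|rewrite /y; lia].
have un' := ulitN_unsat nu ly.
rewrite (gate_clauses_sat _ _ _ un') nth_flip ?sza // eqxx -/(A _).
have -> : geval (fun w => nth false (flip y a) (off r0 + w)) (nth (GC false) gs j)
    = geval (fun w => A (off r0 + w)) (nth (GC false) gs j).
  have := gs_wf lj; case: (nth _ _ _) => //= c x d /and3P[l1 l2 l3].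
  have same w : w < n + j -> nth false (flip y a) (off r0 + w) = A (off r0 + w).
    move=> lt; rewrite nth_flip ?sza //.
    by have -> : off r0 + w == y = false by rewrite /y; lia.
  by rewrite !same.
by move: ne; rewrite -/(A y); case: (A y); case: (geval _ _).
Qed.

Lemma opt_active_gates : gsat (fun w => A (off r + w)) n gs.
Proof.
case Er: r; last first.
  apply: (@opt_gates _ [::]) => //.
  by rewrite Er /core_clauses /= -catA.
apply: (@opt_gates _ (gates_clauses false true)).
  by rewrite Er /core_clauses -!catA.
by move=> j lj; apply: keeps_gates; rewrite ?Er //;
  case: (@off_range true (n + j)); rewrite ?ltn_add2l.
Qed.

Lemma keeps_active_gates z : z != uvar -> ~~ (off r <= z < off r + nwires) ->
  all (keeps z) (gates_clauses false true ++ gates_clauses true false).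
Proof.
move=> nu nz; rewrite all_cat !keeps_gates //; case: r nz => nz /=; rewrite ?nz //.
Qed.

(** If the bit is wrongly set, clearing it repairs an implication and loses only the lighter unit
    clause; if it is wrongly clear, setting it gains the unit clause and respects both
    implications. *)
Lemma opt_value k : k < m -> A (vvar k) = A (off r + out k).
Proof.
move=> lk; have lv : vvar k < core_vars by rewrite /vvar /core_vars; lia.
have nu : vvar k != uvar by rewrite /vvar /uvar; lia.
have kp : all (keeps (vvar k)) ((gates_clauses false true ++
    gates_clauses true false) ++ flatten [seq value_block k | k <- iota 0 k]).
  rewrite all_cat keeps_active_gates //; last first.
    by rewrite /off /vvar; case: (r); lia.
  apply: keeps_flatten => j lj; apply: keeps_value => //.
    by rewrite /vvar; lia.
  by rewrite eq_sym; case: (@off_range r (out j)) => [|_ _ -> //]; apply: out_lt; lia.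
have no r0 : off r0 + out k == vvar k = false.
  by apply/negbTE; case: (@off_range r0 (out k)) => [|_ _ -> //]; apply: out_lt; lia.
have := erefl core_clauses; rewrite {2}/core_clauses (flatten_split _ lk) -!catA.
rewrite !(catA (gates_clauses false true)) catA => E.
have fv y : nth false (flip (vvar k) a) y = if y == vvar k then ~~ A (vvar k) else A y.
  by rewrite nth_flip ?sza.
case Ev: (A (vvar k)).
  have := @opt_block (vvar k) _ [:: nth [::] (value_block k) 0;
    nth [::] (value_block k) 1] ([:: (vvar k, true)] :: _) E lv nu kp.
  rewrite /clause_sat /= !fv !eqxx Ev /= => /(_ isT).
  rewrite -/(A (vvar k)) Ev /= -!/(A _) -/r.
  by case: (r) => /=; case: (A (off _ + _)) => //=; case: (A (off _ + _)).
case Eo: (A (off r + out k)) => //.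
have := opt_block E lv nu kp.
rewrite /clause_sat /= !fv !eqxx Ev !no /= -!/(A _) Ev /=.
have nu' : uvar == vvar k = false by rewrite eq_sym; exact: negbTE.
rewrite nu' -/r; move: Eo; case: (r) => -> /=; rewrite ?orbT /= ?andbF;
  by move=> /(_ isT).
Qed.

Lemma keeps_levels z : z != uvar -> (forall k, k < m -> z != vvar k) ->
  ~~ (off r <= z < off r + nwires) ->
  all (keeps z) ((gates_clauses false true ++ gates_clauses true false) ++
    flatten [seq value_block k | k <- iota 0 m]).
Proof.
move=> nu nv nz; rewrite all_cat keeps_active_gates //.
apply: keeps_flatten => j lj; apply: keeps_value => //; first exact: nv.
by apply/eqP => Ez; move: nz; rewrite Ez; have := out_lt (leq_trans lj (leq_trans (leq_addr n m) szo)); lia.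
Qed.

Lemma not_active w : w < nwires -> ~~ (off r <= off (~~ r) + w < off r + nwires).
Proof. by rewrite /off; case: (r) => /=; lia. Qed.

Lemma eq_clauses_sat b c x y : nth false b uvar = ~~ c ->
  all (clause_sat b) (eq_clauses c x y) = (nth false b x == nth false b y).
Proof.
move=> Eu; rewrite /clause_sat /= Eu.
by case: c {Eu}; case: (nth _ b x); case: (nth _ b y).
Qed.

Lemma eq_clauses_relaxed b c x y : nth false b uvar = c ->
  all (clause_sat b) (eq_clauses c x y).
Proof. by move=> Eu; rewrite /clause_sat /= Eu eqxx. Qed.

Lemma eq_block_sat b x0 y0 x1 y1 :
  all (clause_sat b) (eq_clauses true x0 y0 ++ eq_clauses false x1 y1) =
  if nth false b uvar then nth false b x1 == nth false b y1
  else nth false b x0 == nth false b y0.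
Proof.
rewrite all_cat; case Eu: (nth false b uvar).
  by rewrite eq_clauses_relaxed // eq_clauses_sat.
by rewrite eq_clauses_sat // eq_clauses_relaxed // andbT.
Qed.

(** Every heavier clause that mentions a wire of the inactive register contains the satisfied
    control literal, so its inputs can be changed freely. *)
Lemma opt_next i : i < n -> A (off (~~ r) + i) = A (off r + out (m + i)).
Proof.
move=> li; set z := off (~~ r) + i.
have lw : i < nwires by rewrite /nwires; lia.
have lo : out (m + i) < nwires by apply: out_lt; lia.
have [lz nu nv _ nd] := off_range (~~ r) lw; rewrite -/z negbK in lz nu nv nd.
have [R E] : exists R, core_clauses = (((gates_clauses false true ++
    gates_clauses true false) ++ flatten [seq value_block k | k <- iota 0 m]) ++
    flatten [seq next_block i | i <- iota 0 i]) ++ next_block i ++ R.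
  by eexists; rewrite /core_clauses (flatten_split next_block li) -!catA; reflexivity.
apply/eqP/negPn/negP => ne; move/negP: (ne); apply.
have := opt_block E lz nu; rewrite [next_block i]/next_block !eq_block_sat !nth_flip ?sza //.
rewrite [uvar == z]eq_sym (negbTE nu) -!/(A _) -/r.
have nz : off r + out (m + i) == z = false by rewrite eq_sym; apply/negbTE/nd.
have kp : all (keeps z) (((gates_clauses false true ++ gates_clauses true false) ++
    flatten [seq value_block k | k <- iota 0 m]) ++
    flatten [seq next_block i | i <- iota 0 i]).
  rewrite all_cat keeps_levels ?not_active //=; apply: keeps_flatten => j lj.
  apply: keeps_next => //; first by rewrite /z; lia.
  by apply: nd; apply: out_lt; lia.
move=> /(_ kp); move: ne nz; rewrite /z; case: (r) => /= ne nz; rewrite eqxx nz;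
  by apply; move: ne; case: (A _); case: (A _).
Qed.

(** Gate wires are not input wires, so recomputing the inactive gates does not disturb the inputs
    that were loaded by heavier clauses. *)
Lemma opt_inactive_gates : gsat (fun w => A (off (~~ r) + w)) n gs.
Proof.
have kp j : j < size gs -> all (keeps (off (~~ r) + (n + j)))
    (((gates_clauses false true ++ gates_clauses true false) ++
    flatten [seq value_block k | k <- iota 0 m]) ++
    flatten [seq next_block i | i <- iota 0 n]).
  move=> lj; have lw : n + j < nwires by rewrite ltn_add2l.
  have [lz nu nv _ nd] := off_range (~~ r) lw; rewrite negbK in nd.
  rewrite all_cat keeps_levels ?not_active //=; apply: keeps_flatten => i li.
  apply: keeps_next => //; first by lia.
  by apply: nd; apply: out_lt; lia.
have [R E] : exists R, core_clauses = (((gates_clauses false true ++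
    gates_clauses true false) ++ flatten [seq value_block k | k <- iota 0 m]) ++
    flatten [seq next_block i | i <- iota 0 n]) ++
    gates_clauses false false ++ gates_clauses true true ++ R.
  by eexists; rewrite /core_clauses -!catA; reflexivity.
case Er: (r) => /=; rewrite Er /= in kp.
  by apply: (opt_gates _ kp); rewrite Er; exact: E.
rewrite catA in E; apply: (opt_gates (R := R) (P := _ ++ gates_clauses false false)).
  by rewrite Er; exact: E.
move=> j lj; rewrite all_cat kp //= keeps_gates ?Er //.
by case: (@off_range true (n + j)); rewrite ?ltn_add2l.
Qed.

Lemma opt_copy i : i < n -> A i = A (off r + i).
Proof.
move=> li.
have li' : i < core_vars by rewrite /core_vars; lia.
have nu : i != uvar by rewrite /uvar; lia.
have no r0 w : i < off r0 + w by rewrite /off; lia.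
have [R E] : exists R, core_clauses = (((((gates_clauses false true ++
    gates_clauses true false) ++ flatten [seq value_block k | k <- iota 0 m]) ++
    flatten [seq next_block i | i <- iota 0 n]) ++
    (gates_clauses false false ++ gates_clauses true true)) ++
    flatten [seq copy_block i | i <- iota 0 i]) ++ copy_block i ++ R.
  by eexists; rewrite /core_clauses (flatten_split copy_block li) -!catA; reflexivity.
apply/eqP/negPn/negP => ne; move/negP: (ne); apply.
have := opt_block E li' nu; rewrite [copy_block i]/copy_block !eq_block_sat !nth_flip ?sza //.
rewrite [uvar == i]eq_sym (negbTE nu) -!/(A _) -/r !(gtn_eqF (no _ _)) eqxx.
have kg r0 c : all (keeps i) (gates_clauses r0 c).
  by apply: keeps_gates => //; apply/orP; right; have := no r0 0; lia.
have kp : all (keeps i) ((((((gates_clauses false true ++ gates_clauses true false) ++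
    flatten [seq value_block k | k <- iota 0 m]) ++
    flatten [seq next_block i | i <- iota 0 n]) ++
    (gates_clauses false false ++ gates_clauses true true)) ++
    flatten [seq copy_block i | i <- iota 0 i])).
  rewrite all_cat all_cat all_cat keeps_levels //.
  - rewrite all_cat !kg /= andbT; apply/andP; split.
      apply: keeps_flatten => j lj; apply: keeps_next => //.
        by have := no (~~ r) j; lia.
      by have := no r (out (m + j)); lia.
    apply: keeps_flatten => j lj; rewrite all_cat !keeps_eq //;
      by apply/orP; right; have := no false j; have := no true j; lia.
  - by move=> k lk; rewrite /vvar; lia.
  by have := no r 0; lia.
move=> /(_ kp); move: ne; case: (r) => ne; apply; move: ne;
  by case: (A _); case: (A _).
Qed.

(** Flipping the control variable together with value bit [k] is an improvement. Of the two heaviest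
    groups of gate clauses, one is released by the new control value, and the other holds because
    the inactive gates were already correct. The implications for earlier bits hold because both
    registers agree there, and those for bit [k] because the new active output is 1. So no clause
    before the unit clause of bit [k] is lost, and that one is gained. *)
Lemma opt_value_max k : k < m ->
  (forall i, i < k -> A (off r + out i) = A (off (~~ r) + out i)) ->
  A (off r + out k) = false -> A (off (~~ r) + out k) = true -> False.
Proof.
move=> lk eqv e0 e1; pose a' := flip uvar (flip (vvar k) a).
have lv : vvar k < core_vars by rewrite /vvar /core_vars; lia.
have lu : uvar < core_vars by rewrite /uvar /core_vars; lia.
have nvu : vvar k == uvar = false by rewrite /vvar /uvar; lia.
have fa y : nth false a' y = if y == uvar then ~~ r else
    if y == vvar k then true else A y.
  rewrite /a' nth_flip ?size_flip ?sza // !nth_flip ?sza //.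
  by rewrite [uvar == _]eq_sym nvu -/(A (vvar k)) (opt_value lk) e0.
have same r0 w : w < nwires -> nth false a' (off r0 + w) = A (off r0 + w).
  by case/(off_range r0) => _ nu nv _ _; rewrite fa (negbTE nu) (negbTE (nv _ lk)).
have au : nth false a' uvar = ~~ r by rewrite fa eqxx.
have nb : sat_nbr core_sat a a'.
  right; exists uvar, (vvar k); split=> //; first by rewrite /uvar /vvar; lia.
  by rewrite core_forbiddenP /vvar; lia.
have := opt nb; apply/negP/negPn.
have [R E] : exists R, core_clauses = ((gates_clauses false true ++
    gates_clauses true false) ++ flatten [seq value_block k | k <- iota 0 k] ++
    [:: nth [::] (value_block k) 0; nth [::] (value_block k) 1]) ++
    [:: (vvar k, true)] :: R.
  by eexists; rewrite /core_clauses (flatten_split value_block lk) -!catA; reflexivity.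
apply: (payoff_improve (F := core_sat) E); last first.
- by rewrite /clause_sat /= fa nvu eqxx.
- by rewrite /clause_sat /= -/(A _) opt_value // e0.
have gsatP r0 c D : D \in gates_clauses r0 c ->
    (c == ~~ r) || (r0 == ~~ r) -> clause_sat a' D.
  move=> /flatten_mapP[j]; rewrite mem_iota => /andP[_ lj] Dj cond.
  move: D Dj; apply/allP.
  case: (boolP (c == ~~ r)) cond => [/eqP -> _|nc /= /eqP Er0].
    apply: (gate_clauses_all (gs_wf lj)) => D _ uD _; apply/hasP.
    by exists (ulit (~~ r)) => //; rewrite /= au.
  rewrite gate_clauses_sat; last by rewrite /= au eq_sym; exact: negbTE.
  rewrite same ?ltn_add2l //.
  have := opt_inactive_gates lj; rewrite Er0 => ->.
  have := gs_wf lj; case: (nth _ _ _) => //= cc x d /and3P[l1 l2 l3].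
  have lw w : w < n + j -> w < nwires by rewrite /nwires; lia.
  by rewrite !same ?lw.
move=> D DD sD; move: DD.
rewrite !mem_cat -!orbA => /or4P[Dg|Dg|/flatten_mapP[j]|].
- by apply: gsatP Dg _; case: (r).
- by apply: gsatP Dg _; case: (r).
- rewrite mem_iota => /andP[_ lj]; rewrite add0n in lj.
  have ljm : j < m by lia.
  have lo : out j < nwires by apply: out_lt; lia.
  have vj : nth false a' (vvar j) = A (vvar j).
    by rewrite fa /vvar /uvar; do 2 (case: eqP => [?|_]; first by lia).
  have := opt_value ljm; have := eqv j lj.
  rewrite !inE => e2 e3 /or3P[] /eqP ED; move: sD; rewrite ED /clause_sat /=;
    rewrite ?same ?au ?vj // -!/(A _);
    move: e2 e3; case: (r) => /= e2 e3; rewrite ?e3 ?e2 ?orbT //;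
    by case: (A _).
rewrite !inE => /orP[] /eqP ->; rewrite /clause_sat /= ?same ?au; try by apply: out_lt; lia.
  by move: e1; case: (r) => /= e1; rewrite ?e1 ?orbT.
by move: e1; case: (r) => /= e1; rewrite ?e1 ?orbT.
Qed.

(** At an optimum the inactive register holds the successor and its value. If the successor differed
    from the active input, the first bit where the values differ would be 0 in the active register
    and 1 in the inactive one, against [opt_value_max]. *)
Lemma core_opt (Kf : bits -> bits) :
  size outs = m + n ->
  (forall v, gsat v n gs -> [seq v o | o <- outs] = Kf (mkseq v n)) ->
  (forall w, size w = n -> drop m (Kf w) != w ->
     bin_val (take m (Kf w)) < bin_val (take m (Kf (drop m (Kf w))))) ->
  drop m (Kf (take n a)) = take n a.
Proof.
move=> so sound incr; pose w r0 := mkseq (fun i => A (off r0 + i)) n.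
have Ew : take n a = w r.
  have st : size (take n a) = n.
    by rewrite size_takel // sza /core_vars; lia.
  apply: (eq_from_nth (x0 := false)); rewrite st ?size_mkseq // => i li.
  by rewrite nth_take // nth_mkseq // -/(A i) opt_copy.
have K r0 : gsat (fun w => A (off r0 + w)) n gs ->
    (forall k, k < m + n -> nth false (Kf (w r0)) k = A (off r0 + out k)) /\
    size (Kf (w r0)) = m + n.
  move=> /sound <-; split=> [k lk|]; last by rewrite size_map.
  by rewrite (nth_map 0) ?so.
have [K0 s0] := K _ opt_active_gates; have [K1 s1] := K _ opt_inactive_gates.
have En : drop m (Kf (w r)) = w (~~ r).
  apply: (eq_from_nth (x0 := false)); rewrite size_drop s0 addKn ?size_mkseq // => i li.
  by rewrite nth_drop K0 ?ltn_add2l // nth_mkseq // opt_next.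
rewrite Ew; apply/eqP/negPn/negP => ne.
have := incr _ _ ne; rewrite En size_mkseq => /(_ erefl) lt.
have [|k [lk eqv e0 e1]] := bin_val_first _ lt; first by rewrite !size_take s0 s1.
rewrite size_takel ?s0 ?leq_addr // in lk.
rewrite !nth_take // K0 in e0; last by lia.
rewrite !nth_take // K1 in e1; last by lia.
apply: (opt_value_max lk _ e0 e1) => i li.
have := eqv i li; rewrite !nth_take ?K0 ?K1 //; lia.
Qed.

End Opt.
End Core.

(** * Polynomial-time construction of the formula *)

Definition sat_view (F : sat_instance) :=
  (sat_vars F, (sat_clauses F, sat_forbidden F)).
Instance emb_literal : emb literal := (_ : emb (nat * bool)).
Instance emb_sat : emb sat_instance := fun F => embed (sat_view F).

Lemma poly_gate_clauses X {eX : emb X} (ctl : X -> literal) (o y : X -> nat)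
    (g : X -> sgate) : poly ctl -> poly o -> poly y -> poly g ->
  poly (fun x => gate_clauses (ctl x) (o x) (y x) (g x)).
Proof.
move=> pc po py pg; pose v x := sg_view (g x).
have pv : poly v by apply: poly_cast pg.
apply: (poly_ext (f := fun x => if (v x).1.1 then
    [:: [:: ctl x; (o x + (v x).2.1, false); (o x + (v x).2.2.1, false); (y x, true)];
        [:: ctl x; (o x + (v x).2.1, false); (o x + (v x).2.2.1, true); (y x, false)];
        [:: ctl x; (o x + (v x).2.1, true); (o x + (v x).2.2.2, false); (y x, true)];
        [:: ctl x; (o x + (v x).2.1, true); (o x + (v x).2.2.2, true); (y x, false)]]
    else [:: [:: ctl x; (y x, (v x).1.2)]])).
  by move=> x; rewrite /v; case: (g x).
by poly_auto.
Qed.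

Section PolyCore.
Context {X : Type} {eX : emb X}.
Variables (n m : X -> nat) (gs : X -> seq sgate) (outs : X -> seq nat).
Hypotheses (pn : poly n) (pm : poly m) (pg : poly gs) (po : poly outs).

Lemma poly_off r : poly (fun x => off (n x) (m x) (gs x) r).
Proof. by case: r; rewrite /off /nwires; poly_auto. Qed.

Lemma poly_gates_clauses r c :
  poly (fun x => gates_clauses (n x) (m x) (gs x) r c).
Proof.
have pof := poly_off r; pose f x := off (n x) (m x) (gs x) r.
have pf : poly f by [].
rewrite /gates_clauses; apply: poly_flatten; apply: poly_map; last by poly_auto.
rewrite /gate_block /ulit /uvar.
apply: (poly_ext (f := fun p : X * nat => gate_clauses (n p.1, c) (f p.1)
   (f p.1 + (n p.1 + p.2)) (nth (GC false) (gs p.1) p.2))) => //.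
by apply: poly_gate_clauses; poly_auto.
Qed.

Lemma poly_core_sat : poly (fun x => core_sat (n x) (m x) (gs x) (outs x)).
Proof.
have pf0 := poly_off false; have pf1 := poly_off true.
have pg1 := poly_gates_clauses.
apply: (poly_cast (f := fun x => (core_vars (n x) (m x) (gs x),
  (core_clauses (n x) (m x) (gs x) (outs x), core_forbidden (n x))))) => //.
apply: poly_pair; first by rewrite /core_vars /nwires; poly_auto.
apply: poly_pair; last by rewrite /core_forbidden; poly_auto.
pose f0 x := off (n x) (m x) (gs x) false; pose f1 x := off (n x) (m x) (gs x) true.
have p0 : poly f0 by []. have p1 : poly f1 by [].
apply: (poly_ext (f := fun x =>
  (gates_clauses (n x) (m x) (gs x) false true ++
   gates_clauses (n x) (m x) (gs x) true false) ++
  flatten [seq [:: [:: ((n x).+1 + k, false); (f0 x + nth 0 (outs x) k, true); (n x, true)];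
      [:: ((n x).+1 + k, false); (f1 x + nth 0 (outs x) k, true); (n x, false)];
      [:: ((n x).+1 + k, true)]] | k <- iota 0 (m x)] ++
  flatten [seq [::
     [:: (n x, true); (f1 x + i, false); (f0 x + nth 0 (outs x) (m x + i), true)];
     [:: (n x, true); (f1 x + i, true); (f0 x + nth 0 (outs x) (m x + i), false)];
     [:: (n x, false); (f0 x + i, false); (f1 x + nth 0 (outs x) (m x + i), true)];
     [:: (n x, false); (f0 x + i, true); (f1 x + nth 0 (outs x) (m x + i), false)]]
     | i <- iota 0 (n x)] ++
  (gates_clauses (n x) (m x) (gs x) false false ++
   gates_clauses (n x) (m x) (gs x) true true) ++
  flatten [seq [::
     [:: (n x, true); (i, false); (f0 x + i, true)];
     [:: (n x, true); (i, true); (f0 x + i, false)];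
     [:: (n x, false); (i, false); (f1 x + i, true)];
     [:: (n x, false); (i, true); (f1 x + i, false)]] | i <- iota 0 (n x)])) => //.
by repeat apply: poly_cat; try exact: pg1; poly_auto.
Qed.

End PolyCore.

(** The second component is a suffix of the code, so the first one can be wired into the tableau as
    a constant prefix. *)
Lemma enc_pair_cat u v : enc_pair u v = enc_pair u [::] ++ v.
Proof. by rewrite /enc_pair -catA. Qed.

Lemma poly_enc_pair X {eX : emb X} (u v : X -> bits) :
  poly u -> poly v -> poly (fun x => enc_pair (u x) (v x)).
Proof. by move=> pu pv; rewrite /enc_pair; poly_auto. Qed.

(* [Kf] maps the code of [(e, w)] to the value of [w], on [mW e] bits, followed
   by a better string or [w] itself. *)
Theorem local_search_sat (nW mW : bits -> nat) (Kf : bits -> bits) :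
  poly nW -> poly mW -> poly Kf ->
  exists F : bits -> sat_instance, [/\ poly F, forall e, sat_wf (F e),
    forall e, nW e <= sat_vars (F e),
    forall e x y, x < y < nW e -> (x, y) \in sat_forbidden (F e) &
    forall e a,
      (forall w, size w = nW e -> let k := Kf (enc_pair e w) in
         size k = mW e + nW e /\ (drop (mW e) k != w -> bin_val (take (mW e) k)
           < bin_val (take (mW e) (Kf (enc_pair e (drop (mW e) k)))))) ->
      size a = sat_vars (F e) ->
      (forall a', sat_nbr (F e) a a' -> ~~ (sat_payoff (F e) a < sat_payoff (F e) a')) ->
      drop (mW e) (Kf (enc_pair e (take (nW e) a))) = take (nW e) a].
Proof.
move=> pn pm pK.
have [M [k HM]] := polytime_poly (D := fun=> True) (e := id) pK (fun _ _ => erefl).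
pose pre e := enc_pair e [::].
(* The input of the machine is [pre e] followed by [nW e] variable bits, so this is exactly its time
   bound. *)
pose T e := (size (pre e) + nW e) ^ k + k.
pose gs e := tgates M (pre e) (nW e) (T e) (mW e + nW e).
pose outs e := touts M (nW e) (T e) (mW e + nW e).
have ppre : poly pre by apply: poly_enc_pair; poly_auto.
have pT : poly T by rewrite /T; poly_auto.
have pgs : poly gs by apply: poly_tgates; poly_auto.
have pouts : poly outs by apply: poly_touts; poly_auto.
have gsw e : gwf (nW e) (gs e) by apply: tgates_wf.
have outl e : all (fun o => o < nwires (nW e) (gs e)) (outs e) by apply: touts_lt.
have so e : size (outs e) = mW e + nW e by rewrite size_map size_iota.
exists (fun e => core_sat (nW e) (mW e) (gs e) (outs e)); split.
- exact: poly_core_sat.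
- by move=> e; apply: core_wf; rewrite ?so.
- by move=> e; rewrite /= /core_vars; lia.
- by move=> e x y lt; rewrite core_forbiddenP.
move=> e a HK sza opt; pose Kw w := if size w == nW e then Kf (enc_pair e w) else [::].
have szt : size (take (nW e) a) = nW e.
  by rewrite size_takel // sza /= /core_vars; lia.
have KwE w : size w = nW e -> Kw w = Kf (enc_pair e w).
  by rewrite /Kw => ->; rewrite eqxx.
have so' : mW e + nW e <= size (outs e) by rewrite so.
rewrite -(KwE _ szt).
apply: (@core_opt (nW e) (mW e) (gs e) (outs e) (gsw e) (outl e) so' a sza opt) => //.
  move=> v sv; rewrite KwE ?size_mkseq //.
  have [sK _] := HK (mkseq v (nW e)) (size_mkseq _ _).
  have := HM (enc_pair e (mkseq v (nW e))) I.
  rewrite enc_pair_cat size_cat size_mkseq => run.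
  by apply: (tgates_sound sv run); rewrite -enc_pair_cat.
move=> w sw; have [sK lt] := HK w sw.
by rewrite (KwE _ sw) (KwE (drop _ _)) // size_drop sK addKn.
Qed.

(** * Decoding *)

(* Parsers are total: on words that are not codes the result is arbitrary but
   of linear size. *)
Definition plaw A {eA : emb A} (c : nat) (p : bits -> A * bits) : Prop :=
  forall bs, size (p bs).2 <= size bs /\
    esz (p bs).1 <= c * (size bs - size (p bs).2) + c.

Definition parses A {eA : emb A} (e : A -> bits) (p : bits -> A * bits) : Prop :=
  [/\ poly p, exists c, plaw c p & forall x r, p (e x ++ r) = (x, r)].

Definition parse_nat (bs : bits) : nat * bits :=
  let k := foldr (fun (b : bool) r => if b then r.+1 else 0) 0 bs in
  (k, drop k.+1 bs).

Lemma parses_nat : parses enc_nat parse_nat.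
Proof.
split.
- have pk : poly (fun bs : bits =>
     foldr (fun (b : bool) r => if b then r.+1 else 0) 0 bs).
    apply: (poly_foldr (h := fun _ _ => true)); poly_auto.
    by move=> _ s [] /=; rewrite !esz_nat (_ : esz true = 3) //; lia.
  by rewrite /parse_nat; apply: poly_pair => //; apply: poly_drop; poly_auto.
- exists 2 => bs; rewrite /parse_nat; set k := foldr _ _ _.
  have le : k <= size bs by rewrite {}/k; elim: bs => //= -[] s /=; lia.
  by rewrite /= size_drop esz_nat; lia.
move=> n r; rewrite /parse_nat /enc_nat cat_rcons.
have -> : foldr (fun (b : bool) r => if b then r.+1 else 0) 0
   (nseq n true ++ false :: r) = n by elim: n => //= n ->.
by rewrite drop_cat size_nseq ltnNge leqnSn /= subSnn /= drop0.
Qed.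

Definition parse_pair A B (p : bits -> A * bits) (q : bits -> B * bits) bs :=
  (((p bs).1, (q (p bs).2).1), (q (p bs).2).2).

Section ParsePair.
Context {A B : Type} {eA : emb A} {eB : emb B}.

Lemma parses_pair e1 e2 (p : bits -> A * bits) (q : bits -> B * bits) :
  parses e1 p -> parses e2 q ->
  parses (fun xy => e1 xy.1 ++ e2 xy.2) (parse_pair p q).
Proof.
move=> [pp [c1 l1] cp] [pq [c2 l2] cq]; split.
- by rewrite /parse_pair; poly_auto.
- exists (c1 + c2 + 1) => bs; rewrite /parse_pair /= esz_pair.
  have [h1 h2] := l1 bs; have [h3 h4] := l2 (p bs).2; split; first by lia.
  by nia.
by move=> [x y] r; rewrite /parse_pair -catA cp /= cq.
Qed.

Lemma parses_iso (e : A -> bits) (e' : B -> bits) (p : bits -> A * bits)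
    (f : A -> B) (g : B -> A) :
  parses e p -> (forall x, embed (f x) = embed x) -> cancel g f ->
  (forall y, e' y = e (g y)) -> parses e' (fun bs => (f (p bs).1, (p bs).2)).
Proof.
move=> [pp [c l] cp] Ef gK Ee; split.
- apply: poly_cast pp => bs; case: (p bs) => x r.
  by rewrite -[RHS]/(Nd (embed (f x)) (embed r)) Ef.
- by exists c => bs; have := l bs; rewrite /esz Ef.
by move=> y r; rewrite Ee cp gK.
Qed.

End ParsePair.

Section ParseSeq.
Context {A : Type} {eA : emb A}.
Variables (e : A -> bits) (p : bits -> A * bits).

Definition parse_step (st : seq A * bits) : seq A * bits :=
  if head false st.2 then
    ((p (behead st.2)).1 :: st.1, (p (behead st.2)).2) else st.

(** The input itself serves as the iteration counter: every item takes at least one bit, and further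
    rounds leave the state unchanged once the terminating [false] is in front. *)
Definition parse_seq (bs : bits) : seq A * bits :=
  let st := foldl (fun st _ => parse_step st) ([::], bs) bs in
  (rev st.1, behead st.2).

Lemma esz_rev (s : seq A) : esz (rev s) = esz s.
Proof.
have h (s1 s2 : seq A) : esz (catrev s1 s2) + 1 = esz s1 + esz s2.
  elim: s1 s2 => [|x s1 IH] s2 /=; first by rewrite esz_nil; lia.
  by rewrite IH !esz_cons; lia.
by have := h s [::]; rewrite catrevE cats0 esz_nil; lia.
Qed.

Lemma parses_seq : parses e p -> parses (enc_seq e) parse_seq.
Proof.
move=> [pp [c l] cp].
have inv (bs u : bits) : let st := foldl (fun st _ => parse_step st) ([::], bs) u in
    size st.2 <= size bs /\ esz st.1 <= c.+1 * (size bs - size st.2) + 1.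
  elim/last_ind: u => [|u b [IH1 IH2]]; first by rewrite /= esz_nil; lia.
  rewrite foldl_rcons /=; set st := foldl _ _ u in IH1 IH2 *.
  rewrite /parse_step; case: st IH1 IH2 => acc [|[] r] //= h1 h2.
  have [h3 h4] := l r; rewrite esz_cons; split; first by lia.
  (* The [true] in front of the item accounts for the constant [c] of its parser and for the list
     cell. *)
  have -> : size bs - size (p r).2 = (size bs - (size r).+1) +
     (size r - size (p r).2).+1 by lia.
  by nia.
split.
- have ps : poly (fun bs : bits => foldl (fun st (_ : bool) => parse_step st) ([::], bs) bs).
    apply: poly_foldlb; poly_auto.
    + by rewrite /parse_step; poly_auto.
    exists (fun bs : bits => c.+1 * esz bs + 4 * esz bs + 3); first by pb_tac.
    move=> bs i; set st := foldl _ _ _.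
    have [h1 h2] := inv bs (take i bs); rewrite -/st in h1 h2.
    have hs : size bs < esz bs by apply: size_esz.
    have := esz_bits st.2.
    have -> : esz st = (esz st.1 + esz st.2).+1 by case: (st) => u v; rewrite esz_pair.
    by nia.
  by rewrite /parse_seq; apply: poly_pair; poly_auto.
- exists c.+1 => bs; rewrite /parse_seq; set st := foldl _ _ _.
  have [h1 h2] := inv bs bs; rewrite -/st in h1 h2.
  by rewrite /= esz_rev size_behead; split; [lia|nia].
move=> s r; rewrite /parse_seq /enc_seq cat_rcons.
set bs := flatten _ ++ _.
have loop u acc s' : size s' <= size u ->
    foldl (fun st (_ : bool) => parse_step st)
      (acc, flatten [seq true :: e x | x <- s'] ++ false :: r) u =
    (catrev s' acc, false :: r).
  elim: u acc s' => [|b u IH] acc [|x s'] //= le.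
    by rewrite /parse_step /=; exact: (IH acc [::]).
  by rewrite /parse_step /= -catA cp; exact: IH.
rewrite loop /=; first by rewrite catrevE cats0 revK.
rewrite /bs size_cat /=; apply: leq_trans (leq_addr _ _).
by elim: (s) => //= x s' IH; rewrite size_cat; lia.
Qed.

End ParseSeq.

Definition parse_bit (bs : bits) : bool * bits := (head false bs, behead bs).

Lemma parses_bit : parses (fun b => [:: b]) parse_bit.
Proof.
split; [by rewrite /parse_bit; poly_auto| |by []].
exists 3 => bs; have := esz_bool (head false bs).
by rewrite /= size_behead; lia.
Qed.

Definition parse_literal (bs : bits) : literal * bits :=
  let r := parse_pair parse_bit parse_nat bs in ((r.1.2, r.1.1), r.2).

Lemma parses_literal : parses enc_literal parse_literal.
Proof.
have [pp [c l] cp] := parses_pair parses_bit parses_nat; split.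
- by rewrite /parse_literal; apply: poly_pair; poly_auto.
- exists c => bs; have [h1 h2] := l bs; split=> //.
  apply: leq_trans h2; rewrite /parse_literal /parse_pair /=.
  by rewrite esz_pair [leqLHS]esz_pair addnC.
by move=> [n b] r; rewrite /parse_literal (cp (b, n)).
Qed.

Definition sat_of (v : nat * (seq (seq literal) * seq (nat * nat))) :=
  SatInstance v.1 v.2.1 v.2.2.

Lemma sat_parser : exists p, parses enc_sat p.
Proof.
have pf := parses_seq (parses_pair parses_nat parses_nat).
have pc := parses_seq (parses_seq parses_literal).
have := parses_pair parses_nat (parses_pair pc pf).
move=> /(parses_iso (f := sat_of) (g := sat_view) (e' := enc_sat)) H.
by eexists; apply: H => // -[].
Qed.

Definition gate_view (g : gate) : (bool * bool) * (nat * nat) :=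
  match g with
  | GNot i => ((false, false), (i, 0))
  | GAnd i j => ((true, false), (i, j))
  | GOr i j => ((true, true), (i, j))
  end.

Instance emb_gate : emb gate := fun g => embed (gate_view g).

Definition gate_of (b : bool * bool) (i j : nat) : gate :=
  if b.1 then if b.2 then GOr i j else GAnd i j else GNot i.

Lemma poly_gate_of X {eX : emb X} (b : X -> bool * bool) (i j : X -> nat) :
  poly b -> poly i -> poly j -> poly (fun x => gate_of (b x) (i x) (j x)).
Proof.
move=> pb' pi pj; apply: (poly_cast (f := fun x => if (b x).1 then
    ((true, (b x).2), (i x, j x)) else ((false, false), (i x, 0)))).
  by move=> x; case: (b x) => [[] []].
by poly_auto.
Qed.

Definition parse_gate (bs : bits) : gate * bits :=
  if head false bs then
    let r := parse_pair parse_nat parse_nat (behead (behead bs)) in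
    (gate_of (true, head false (behead bs)) r.1.1 r.1.2, r.2)
  else let r := parse_nat (behead bs) in (gate_of (false, false) r.1 0, r.2).

Lemma parses_gate : parses enc_gate parse_gate.
Proof.
have [p1 [c1 l1] e1] := parses_nat.
have [p2 [c2 l2] e2] := parses_pair parses_nat parses_nat.
split.
- rewrite /parse_gate; apply: poly_if; first by poly_auto.
    by apply: poly_pair; [apply: poly_gate_of|]; poly_auto.
  by apply: poly_pair; [apply: poly_gate_of|]; poly_auto.
- exists (c1 + c2 + 9) => bs; rewrite /parse_gate.
  case: bs => [|[] bs].
  + split=> //; rewrite (_ : esz _ = 7) //.
    by apply: leq_trans (leq_addl _ _); lia.
  + have [h1 h2] := l2 (behead bs); rewrite size_behead in h1 h2; move: h1 h2.
    rewrite [head false (true :: bs)]/= [behead (true :: bs)]/=.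
    case: (parse_pair parse_nat parse_nat (behead bs)) => -[i j] r.
    rewrite ![(_, r).2]/= ![(_, r).1]/= esz_pair => h1 h2; split; first by rewrite /=; lia.
    have -> : esz (gate_of (true, head false bs) i j) =
        esz ((true, head false bs), (i, j)) by case: bs {h1 h2} => [|[] ?].
    rewrite !esz_pair; have := esz_bool true; have := esz_bool (head false bs).
    have -> : size (true :: bs) - size r = ((size bs).-1 - size r) +
       (size (true :: bs) - size r - ((size bs).-1 - size r)) by rewrite /=; lia.
    by nia.
  have [h1 h2] := l1 bs; move: h1 h2.
  rewrite [head false (false :: bs)]/= [behead (false :: bs)]/=.
  case: (parse_nat bs) => i r; rewrite ![(_, r).2]/= ![(_, r).1]/= => h1 h2.
  split; first by rewrite /=; lia.
  rewrite -[esz (gate_of _ _ _)]/(esz ((false, false), (i, 0))).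
  rewrite !esz_pair (_ : esz false = 1) // (_ : esz 0 = 1) //.
  have -> : size (false :: bs) - size r = (size bs - size r).+1 by rewrite /=; lia.
  by nia.
move=> [i|i j|i j] r; rewrite /parse_gate [head false (_ ++ r)]/=.
- by rewrite [behead _]/= e1.
- by rewrite [behead (behead _)]/= (e2 (i, j)).
by rewrite [behead (behead _)]/= (e2 (i, j)).
Qed.

Definition circuit_view (c : circuit) := (c_inputs c, (c_gates c, c_outputs c)).
Definition circuit_of (v : nat * (seq gate * seq nat)) := Circuit v.1 v.2.1 v.2.2.
Instance emb_circuit : emb circuit := fun c => embed (circuit_view c).

Lemma circuit_parser : exists p, parses enc_circuit p.
Proof.
have := parses_pair parses_nat (parses_pair (parses_seq parses_gate)
  (parses_seq parses_nat)).
move=> /(parses_iso (f := circuit_of) (g := circuit_view) (e' := enc_circuit)) H.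
by eexists; apply: H => // -[].
Qed.

Lemma poly_decoder A {eA : emb A} (e : A -> bits) p : parses e p ->
  exists2 d : bits -> A, poly d & cancel e d.
Proof.
move=> [pp _ cp]; exists (fun bs => (p bs).1); first by poly_auto.
by move=> x; rewrite -[e x]cats0 cp.
Qed.

(** [enc_pair u v] is the sequence code of [u], with single bits as items, followed by [v]. *)
Definition unpair := parse_seq parse_bit.

Lemma unpairK u v : unpair (enc_pair u v) = (u, v).
Proof.
have [_ _ cp] := parses_seq parses_bit.
by rewrite -[RHS]cp /enc_seq cat_rcons.
Qed.

Lemma poly_unpair X {eX : emb X} (z : X -> bits) :
  poly z -> poly (fun x => unpair (z x)).
Proof. by have [pp _ _] := parses_seq parses_bit => pz; apply: poly_comp pp pz. Qed.

(** * Membership in PLS *)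

Definition lt_bits (u v : bits) : bool :=
  foldr (fun i r => if nth false u i == nth false v i then r else nth false v i)
    false (iota 0 (size u)).

Lemma lt_bitsE u v : size u = size v -> lt_bits u v = (bin_val u < bin_val v).
Proof.
rewrite /lt_bits; elim: u v => [|a u IH] [|b v] //= [sz].
rewrite -[1]/(1 + 0) iotaDl foldr_map /= (IH _ sz) !bin_val_cons sz.
have := bin_val_lt u; have := bin_val_lt v; rewrite sz.
case: a b => [] [] /=; rewrite ?mul1n ?mul0n => l1 l2; first by rewrite ltn_add2l.
- by apply/esym/negbTE; lia.
- by apply/esym; lia.
by [].
Qed.

Section PolyProblems.
Context {X : Type} {eX : emb X}.

Lemma poly_lt_bits (u v : X -> bits) :
  poly u -> poly v -> poly (fun x => lt_bits (u x) (v x)).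
Proof.
move=> pu pv; rewrite /lt_bits.
apply: (poly_foldr (h := fun _ _ => true)); try by poly_auto.
move=> x s i; have := esz_bool s; rewrite (_ : esz true = 3) //.
case: ifP => _; first by lia.
by have := esz_bool (nth false (v x) i); lia.
Qed.

Lemma poly_flip (i : X -> nat) (s : X -> bits) :
  poly i -> poly s -> poly (fun x => flip (i x) (s x)).
Proof.
move=> pi ps; apply: (poly_ext (f := fun x => if i x < size (s x)
  then take (i x) (s x) ++ ~~ nth false (s x) (i x) :: drop (i x).+1 (s x)
  else s x ++ nseq (i x - size (s x)) false ++ [:: ~~ nth false (s x) (i x)])).
  by move=> x; rewrite /flip set_nthE -cat_nseq.
by poly_auto.
Qed.

Lemma poly_enc_nat (n : X -> nat) : poly n -> poly (fun x => enc_nat (n x)).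
Proof. by move=> pn; rewrite /enc_nat; poly_auto. Qed.

Lemma poly_enc_seq A {eA : emb A} (e : A -> bits) (s : X -> seq A) :
  poly e -> poly s -> poly (fun x => enc_seq e (s x)).
Proof. by move=> pe ps; rewrite /enc_seq; poly_auto. Qed.

Lemma poly_enc_option (o : X -> option bits) :
  poly o -> poly (fun x => enc_option (o x)).
Proof. by move=> po; rewrite /enc_option; poly_auto. Qed.

Lemma poly_sat_view (F : X -> sat_instance) :
  poly F -> poly (fun x => sat_view (F x)).
Proof. exact: poly_cast. Qed.

Lemma poly_sat_vars (F : X -> sat_instance) :
  poly F -> poly (fun x => sat_vars (F x)).
Proof. by move=> /poly_sat_view; exact: poly_fst. Qed.

Lemma poly_sat_clauses (F : X -> sat_instance) :
  poly F -> poly (fun x => sat_clauses (F x)).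
Proof. by move=> /poly_sat_view p; exact: poly_fst (poly_snd p). Qed.

Lemma poly_sat_forbidden (F : X -> sat_instance) :
  poly F -> poly (fun x => sat_forbidden (F x)).
Proof. by move=> /poly_sat_view p; exact: poly_snd (poly_snd p). Qed.

Lemma poly_clause_sat (a : X -> bits) (C : X -> seq literal) :
  poly a -> poly C -> poly (fun x => clause_sat (a x) (C x)).
Proof. by move=> pa pC; rewrite /clause_sat; poly_auto. Qed.

Lemma poly_circuit_view (c : X -> circuit) :
  poly c -> poly (fun x => circuit_view (c x)).
Proof. exact: poly_cast. Qed.

Lemma poly_c_inputs (c : X -> circuit) : poly c -> poly (fun x => c_inputs (c x)).
Proof. by move=> /poly_circuit_view; exact: poly_fst. Qed.

Lemma poly_c_gates (c : X -> circuit) : poly c -> poly (fun x => c_gates (c x)).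
Proof. by move=> /poly_circuit_view p; exact: poly_fst (poly_snd p). Qed.

Lemma poly_c_outputs (c : X -> circuit) : poly c -> poly (fun x => c_outputs (c x)).
Proof. by move=> /poly_circuit_view p; exact: poly_snd (poly_snd p). Qed.

Lemma poly_gate_eval (v : X -> bits) (g : X -> gate) :
  poly v -> poly g -> poly (fun x => gate_eval (v x) (g x)).
Proof.
move=> pv pg; pose w x := gate_view (g x).
have pw : poly w by apply: poly_cast pg.
apply: (poly_ext (f := fun x => if (w x).1.1 then
    if (w x).1.2 then nth false (v x) (w x).2.1 || nth false (v x) (w x).2.2
    else nth false (v x) (w x).2.1 && nth false (v x) (w x).2.2
    else ~~ nth false (v x) (w x).2.1)).
  by move=> x; rewrite /w; case: (g x).
by poly_auto.
Qed.

End PolyProblems.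

Definition sat_value (F : sat_instance) (a : bits) : bits :=
  [seq clause_sat a C | C <- sat_clauses F].

Definition is_forbidden (F : sat_instance) (x y : nat) : bool :=
  has (fun p : nat * nat => (p.1 == x) && (p.2 == y)) (sat_forbidden F).

Definition sat_candidates (F : sat_instance) (a : bits) : seq bits :=
  [seq flip x a | x <- iota 0 (sat_vars F)] ++
  flatten [seq [seq flip x (flip y a) | x <- [seq x <- iota 0 y | ~~ is_forbidden F x y]]
          | y <- iota 0 (sat_vars F)].

Definition sat_next (F : sat_instance) (a : bits) : option bits :=
  ohead [seq b <- sat_candidates F a | lt_bits (sat_value F a) (sat_value F b)].

Lemma is_forbiddenE F x y : is_forbidden F x y = ((x, y) \in sat_forbidden F).
Proof.
apply/hasP/idP => [[[u v] uF /andP[/= /eqP <- /eqP <-]] //|xyF].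
by exists (x, y) => //=; rewrite !eqxx.
Qed.

Lemma sat_candidatesP F a b : b \in sat_candidates F a <-> sat_nbr F a b.
Proof.
rewrite mem_cat; split.
  case/orP => [/mapP[x]|/flatten_mapP[y]].
    by rewrite mem_iota => /andP[_ lx] ->; left; exists x.
  rewrite mem_iota => /andP[_ ly] /mapP[x]; rewrite mem_filter mem_iota.
  by rewrite is_forbiddenE => /and3P[nf _ lx] ->; right; exists x, y.
case=> [[x lx ->]|[x [y [lxy ly nf ->]]]]; apply/orP; [left|right].
  by apply/mapP; exists x; rewrite ?mem_iota.
apply/flatten_mapP; exists y; rewrite ?mem_iota //.
by apply/mapP; exists x; rewrite // mem_filter is_forbiddenE nf mem_iota.
Qed.

Lemma sat_nbr_size F a b : sat_nbr F a b -> size a = sat_vars F ->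
  size b = sat_vars F.
Proof.
case=> [[x lx ->]|[x [y [lxy ly nf ->]]]] sa; first by rewrite size_flip ?sa.
by rewrite !size_flip ?sa // (ltn_trans lxy).
Qed.

Lemma lt_sat_value F a b :
  lt_bits (sat_value F a) (sat_value F b) = (sat_payoff F a < sat_payoff F b).
Proof. by rewrite lt_bitsE ?size_map // !sat_payoffE. Qed.

Lemma ohead_filterP (A : eqType) (P : pred A) (s : seq A) :
  if ohead (filter P s) is Some x then x \in s /\ P x
  else forall x, x \in s -> ~~ P x.
Proof.
elim: s => [|y s IH] //=; case: ifP => [Py|nPy] /=; first by rewrite mem_head.
case: (ohead _) IH => [x [xs Px]|H]; first by rewrite in_cons xs orbT.
by move=> x; rewrite in_cons => /orP[/eqP -> |/H //]; rewrite nPy.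
Qed.

Lemma poly_sat_value X {eX : emb X} (F : X -> sat_instance) (a : X -> bits) :
  poly F -> poly a -> poly (fun x => sat_value (F x) (a x)).
Proof.
move=> pF pa; rewrite /sat_value; apply: poly_map; last exact: poly_sat_clauses.
by apply: poly_clause_sat; poly_auto.
Qed.

Lemma poly_sat_next X {eX : emb X} (F : X -> sat_instance) (a : X -> bits) :
  poly F -> poly a -> poly (fun x => sat_next (F x) (a x)).
Proof.
move=> pF pa; rewrite /sat_next; apply: poly_ohead; apply: poly_filter.
  by apply: poly_lt_bits; apply: poly_sat_value; poly_auto.
have pv := poly_sat_vars pF; have pfo := poly_sat_forbidden pF.
rewrite /sat_candidates; apply: poly_cat.
  by apply: poly_map; [apply: poly_flip|]; poly_auto.
apply: poly_flatten; apply: poly_map; last by poly_auto.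
apply: poly_map; first by apply: poly_flip; [|apply: poly_flip]; poly_auto.
apply: poly_filter; last by poly_auto.
pose fo x := sat_forbidden (F x); have pfo' : poly fo by [].
apply: (poly_ext (f := fun p : X * nat * nat => ~~ has (fun q : nat * nat =>
   (q.1 == p.2) && (q.2 == p.1.2)) (fo p.1.1))) => //.
by poly_auto.
Qed.

Lemma poly_sat_enc X {eX : emb X} (F : X -> sat_instance) :
  poly F -> poly (fun x => enc_sat (F x)).
Proof.
move=> pF; have pv := poly_sat_vars pF; have pc := poly_sat_clauses pF.
have pf := poly_sat_forbidden pF.
rewrite /enc_sat; apply: poly_cat; first exact: poly_enc_nat.
apply: poly_cat; apply: poly_enc_seq => //.
  apply: poly_enc_seq; last exact: poly_id.
  rewrite /enc_literal; apply: poly_cons; first by poly_auto.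
  by apply: poly_enc_nat; poly_auto.
by apply: poly_cat; apply: poly_enc_nat; poly_auto.
Qed.

Lemma poly_sat_wf X {eX : emb X} (F : X -> sat_instance) :
  poly F -> poly (fun x => sat_wf (F x)).
Proof.
move=> pF; have pv := poly_sat_vars pF; have pc := poly_sat_clauses pF.
have pf := poly_sat_forbidden pF; pose v x := sat_vars (F x).
have pv' : poly v by [].
apply: (poly_ext (f := fun x => all (fun C : seq literal =>
         (size C <= 4) && all (fun l : literal => l.1 < v x) C) (sat_clauses (F x))
  && all (fun xy : nat * nat => (xy.1 < xy.2) && (xy.2 < v x)) (sat_forbidden (F x)))) => //.
by poly_auto.
Qed.

Lemma enc_inj_sig A (P : A -> bool) (e : A -> bits) (d : bits -> A) :
  cancel e d -> injective (fun I : {x : A | P x} => e (sval I)).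
Proof.
move=> eK [x px] [y py] /= /(can_inj eK) E; case: _ / E py => py.
by rewrite (bool_irrelevance px py).
Qed.

Lemma SAT4_in_PLS : in_PLS SAT4_2FLIP.
Proof.
have [p /poly_decoder[d pd eK]] := sat_parser.
have pF : poly (fun z => d (unpair z).1).
  by apply: (poly_comp pd); apply: poly_fst; apply: poly_unpair; exact: poly_id.
have pa : poly (fun z => (unpair z).2).
  by apply: poly_snd; apply: poly_unpair; exact: poly_id.
split.
- exact: enc_inj_sig eK.
(* The decoder is total and also accepts words that are not codes; encoding the result again detects
   them. *)
- exists (fun w => sat_wf (d w) && (enc_sat (d w) == w)); split.
    apply: (polytime_poly (G := fun w => [:: sat_wf (d w) && (enc_sat (d w) == w)])) => //.
    have pw := poly_sat_wf pd; have pe := poly_sat_enc pd.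
    by apply: poly_cons; [apply: poly_andb => //; apply: poly_eqbits|]; poly_auto.
  move=> w; split=> [/andP[wf /eqP E]|[[F wf] /= <-]]; first by exists (exist _ (d w) wf).
  by rewrite eK wf eqxx.
- exists 1 => -[F wf] s /= /eqP ->; rewrite /enc_sat !size_cat size_rcons size_nseq.
  by rewrite expn1; lia.
- apply: (polytime_poly (G := fun z => [:: size (unpair z).2 ==
    sat_vars (d (unpair z).1)])).
    apply: poly_cons; last exact: poly_const.
    by apply: poly_eqn; [apply: poly_size|apply: poly_sat_vars].
  by move=> [[F wf] s] _; rewrite /enc_inst_sol unpairK /= eK.
- exists (fun I => nseq (sat_vars (sval I)) false); split.
    apply: (polytime_poly (G := fun w => nseq (sat_vars (d w)) false)).
      by apply: poly_nseq; [apply: poly_sat_vars|exact: poly_const].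
    by move=> [F wf] _ /=; rewrite eK.
  by move=> I; rewrite /= size_nseq.
- exists (fun I s => sat_value (sval I) s); split.
    apply: (polytime_poly (G := fun z => sat_value (d (unpair z).1) (unpair z).2)).
      exact: poly_sat_value.
    by move=> [[F wf] s] _; rewrite /enc_inst_sol unpairK /= eK.
  by move=> I s _; rewrite /= sat_payoffE.
exists (fun I s => sat_next (sval I) s); split.
  apply: (polytime_poly (G := fun z =>
      enc_option (sat_next (d (unpair z).1) (unpair z).2))).
    by apply: poly_enc_option; exact: poly_sat_next.
  by move=> [[F wf] s] _; rewrite /enc_inst_sol unpairK /= eK.
move=> [F wf] s /eqP /= sz; rewrite /sat_next.
have := ohead_filterP (fun b => lt_bits (sat_value F s) (sat_value F b))
  (sat_candidates F s).
case: (ohead _) => [b [/sat_candidatesP nb]|H].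
  rewrite lt_sat_value => lt; split; last by [].
  by split=> //=; rewrite ?sz // (sat_nbr_size nb sz).
split=> /=; first by rewrite sz.
move=> b [_ _ /= nb]; rewrite /better /= -lt_sat_value.
by apply: H; apply/sat_candidatesP.
Qed.

(** * The reductions *)

Lemma local_opt_no_nbr (I : ls_inst SAT4_2FLIP) a : local_opt I a ->
  size a = sat_vars (sval I) /\ forall a', sat_nbr (sval I) a a' ->
    ~~ (sat_payoff (sval I) a < sat_payoff (sval I) a').
Proof.
move=> [/eqP sa opt]; split=> // a' nb; apply: opt; split=> //.
  by rewrite /= sa.
by rewrite /= (sat_nbr_size nb sa).
Qed.

Lemma poly_circuit_eval X {eX : emb X} (c : X -> circuit) (x : X -> bits) :
  poly c -> poly x -> poly (fun y => circuit_eval (c y) (x y)).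
Proof.
move=> pc px; pose W y := foldl (fun v g => rcons v (gate_eval v g)) (x y) (c_gates (c y)).
have pW : poly W.
  apply: (poly_foldl (h := fun _ _ => (true, true))) => //; last exact: poly_c_gates.
  - apply: poly_rcons; first by poly_auto.
    by apply: poly_gate_eval; poly_auto.
  - exact: poly_const.
  move=> _ s g; rewrite esz_pair -cats1.
  have h : esz (s ++ [:: gate_eval s g]) = esz s + esz (gate_eval s g) + 1.
    elim: (s) (gate_eval s g) => [|b u IH] d /=; rewrite !esz_cons ?IH ?esz_nil; lia.
  by have := esz_bool (gate_eval s g); rewrite h (_ : esz true = 3) //; lia.
have po := poly_c_outputs pc.
apply: (poly_ext (f := fun y => [seq nth false (W y) o | o <- c_outputs (c y)])) => //.
by apply: poly_map => //; poly_auto.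
Qed.

Definition flip_next (c : circuit) (x : bits) : bits :=
  head x [seq b <- [seq flip i x | i <- iota 0 (c_inputs c)] |
          lt_bits (circuit_eval c x) (circuit_eval c b)].

Lemma poly_flip_next X {eX : emb X} (c : X -> circuit) (x : X -> bits) :
  poly c -> poly x -> poly (fun y => flip_next (c y) (x y)).
Proof.
move=> pc px; have pn := poly_c_inputs pc.
rewrite /flip_next; apply: poly_head => //; apply: poly_filter.
  by apply: poly_lt_bits; apply: poly_circuit_eval; poly_auto.
by apply: poly_map; [apply: poly_flip|]; poly_auto.
Qed.

Lemma flip_nextP c x : size x = c_inputs c ->
  [/\ size (flip_next c x) = c_inputs c,
    flip_next c x != x ->
      bin_val (circuit_eval c x) < bin_val (circuit_eval c (flip_next c x)) &
    flip_next c x = x -> forall i, i < c_inputs c ->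
      ~~ (bin_val (circuit_eval c x) < bin_val (circuit_eval c (flip i x)))].
Proof.
move=> sx; rewrite /flip_next; set P := fun b => lt_bits _ _.
have PE b : P b = (bin_val (circuit_eval c x) < bin_val (circuit_eval c b)).
  by rewrite /P lt_bitsE // !size_map.
have := ohead_filterP P [seq flip i x | i <- iota 0 (c_inputs c)].
case: (filter _ _) => [|b s] /=.
  move=> H; split=> //; first by rewrite eqxx.
  by move=> _ i li; rewrite -PE; apply: H; apply/mapP; exists i; rewrite ?mem_iota.
move=> [/mapP[i]]; rewrite mem_iota => /andP[_ li] -> Pb; rewrite PE in Pb.
split=> //; first by rewrite size_flip ?sx.
by move=> E; move: Pb; rewrite E ltnn.
Qed.

Lemma take_flip n i s : i < size s ->
  take n (flip i s) = if i < n then flip i (take n s) else take n s.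
Proof.
move=> li; have sz : i < n -> i < size (take n s).
  by rewrite size_take; case: ifP.
apply: (eq_from_nth (x0 := false)).
  rewrite size_take size_flip //; case: (boolP (i < n)) => lin.
    by rewrite size_flip ?sz // size_take.
  by rewrite size_take.
move=> j; rewrite size_take size_flip // => lj.
have ljn : j < n by move: lj; case: ifP; lia.
rewrite nth_take // nth_flip //; case: (boolP (i < n)) => lin.
  by rewrite nth_flip ?sz // !nth_take.
rewrite nth_take //; case: eqP => // E; lia.
Qed.

Lemma FLIP_reduction : exists (f : ls_inst FLIP -> ls_inst SAT4_2FLIP)
  (g : ls_inst FLIP -> bits -> bits), pls_reduction f g /\ tight f g.
Proof.
have [p /poly_decoder[d pd eK]] := circuit_parser.
pose nW e := c_inputs (d e); pose mW e := size (c_outputs (d e)).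
pose Kf z := circuit_eval (d (unpair z).1) (unpair z).2 ++
             flip_next (d (unpair z).1) (unpair z).2.
have pn : poly nW by apply: poly_c_inputs.
have pm : poly mW by apply: poly_size; apply: poly_c_outputs.
have pe : poly (fun z => (unpair z).1).
  by apply: poly_fst; apply: poly_unpair; exact: poly_id.
have pa : poly (fun z => (unpair z).2).
  by apply: poly_snd; apply: poly_unpair; exact: poly_id.
have pdz : poly (fun z => d (unpair z).1) by apply: poly_comp pe.
have pK : poly Kf.
  by apply: poly_cat; [apply: poly_circuit_eval|apply: poly_flip_next].
have [F [pF wfF leF fbF optF]] := local_search_sat pn pm pK.
pose enc (I : ls_inst FLIP) : bits := ls_enc I.
have dE I : d (enc I) = sval I by rewrite /enc /= eK.
pose f I : ls_inst SAT4_2FLIP := exist _ (F (enc I)) (wfF (enc I)).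
pose g (I : ls_inst FLIP) (s : bits) := take (c_inputs (sval I)) s.
have gsol I s : ls_sol (f I) s -> ls_sol I (g I s).
  move=> /eqP /= ss; rewrite /g size_takel // ss.
  by have := leF (enc I); rewrite /nW dE.
exists f, g; split; first split=> //.
- apply: (polytime_poly (G := fun w => enc_sat (F w))) => //.
  exact: poly_sat_enc.
- apply: (polytime_poly (G := fun z => take (nW (unpair z).1) (unpair z).2)).
    by apply: poly_take => //; apply: poly_comp pn pe.
  by move=> [I s] _; rewrite unpairK /= /nW eK.
- move=> I s opt; have [ss no] := local_opt_no_nbr opt.
  have sol : ls_sol (f I) s by case: opt.
  have := optF (enc I) s _ ss no.
  have KE w : Kf (enc_pair (enc I) w) = circuit_eval (sval I) w ++ flip_next (sval I) w.
    by rewrite /Kf unpairK /= dE.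
  have mE w : mW (enc I) = size (circuit_eval (sval I) w) by rewrite /mW dE size_map.
  have nE : nW (enc I) = c_inputs (sval I) by rewrite /nW dE.
  have dK w : drop (mW (enc I)) (Kf (enc_pair (enc I) w)) = flip_next (sval I) w.
    by rewrite KE (mE w) drop_size_cat.
  have tK w : take (mW (enc I)) (Kf (enc_pair (enc I) w)) = circuit_eval (sval I) w.
    by rewrite KE (mE w) take_size_cat.
  rewrite dK nE -/(g I s) => fix_.
  have /eqP szg := gsol I s sol; have [_ _ noimp] := flip_nextP szg.
  split; first exact: gsol.
  move=> s' [_ _ [i li ->]]; rewrite /better /=; apply: noimp => //.
  apply: fix_ => w sw /=; rewrite !dK !tK.
  have [h1 h2 _] := flip_nextP sw; split=> //.
  by rewrite KE size_cat -mE h1.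
(* Every assignment will count as reasonable and [g] reads only the first bits, so any padding gives
   a preimage. *)
exists (fun I s => s ++ nseq (sat_vars (F (enc I)) - c_inputs (sval I)) false); split.
  apply: (polytime_poly (G := fun z => (unpair z).2 ++
     nseq (sat_vars (F (unpair z).1) - nW (unpair z).1) false)).
    apply: poly_cat => //; apply: poly_nseq; last exact: poly_const.
    apply: poly_sub; last exact: poly_comp pn pe.
    by apply: poly_sat_vars; apply: poly_comp pF pe.
  by move=> [I s] _; rewrite /enc_inst_sol unpairK /= /nW eK.
move=> I; exists (fun q => ls_sol (f I) q); split=> //.
- by move=> q [].
- move=> s /eqP ss; split; last by rewrite /g take_size_cat.
  by rewrite /= size_cat size_nseq ss subnKC //; have := leF (enc I); rewrite /nW dE.
(* All assignments are in [R], so the path has no interior vertex and is a single edge. *)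
move=> q [|v p'] q' Rq Rq' np.
  move=> /= [[_ _ nb] _]; have /eqP /= sq := Rq.
  have flip1 x t : x < size t -> size t = size q ->
      g I (flip x t) = g I t \/ (x < c_inputs (sval I) /\
        g I (flip x t) = flip x (g I t)).
    move=> lx _; rewrite /g take_flip //; case: ifP => lt; [by right|by left].
  have tg x : x < c_inputs (sval I) -> TG I (g I q) (flip x (g I q)).
    move=> lx; have /eqP sg := gsol I q Rq; split=> //=; first by rewrite sg.
      by rewrite size_flip sg.
    by exists x.
  case: nb => [[x lx ->]|[x [y [lxy ly nf ->]]]].
    rewrite -sq in lx; case: (flip1 x q lx erefl) => [->|[lt ->]]; first by left.
    by right; exact: tg.
  (* Two variables of the visible copy may not be flipped together, so the larger one lies outside
     it and is invisible to [g]. *)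
  have lyn : c_inputs (sval I) <= y.
    rewrite leqNgt; apply/negP => lt; move/negP: nf; apply.
    by apply: fbF; rewrite lxy /nW dE lt.
  rewrite -sq in ly; have lx := ltn_trans lxy ly.
  have Ey : g I (flip y q) = g I q by rewrite /g take_flip // ltnNge lyn.
  rewrite -(size_flip ly) in lx.
  case: (flip1 x (flip y q)) => [||->|[lt ->]] //; rewrite ?size_flip ?Ey //.
    by left.
  by right; exact: tg.
by move=> /= [[_ sv _] _]; case: (np v (mem_head _ _)).
Qed.

(** * Hardness for arbitrary problems in PLS *)

Lemma bin_val_pad k b : bin_val (nseq k false ++ b) = bin_val b.
Proof. by elim: k => //= k IH; rewrite bin_val_cons mul0n. Qed.

(** Complementing strings of a common length reverses their order, which turns minimization into
    maximization. *)
Lemma bin_val_negb b : bin_val (map negb b) + bin_val b = (2 ^ size b).-1.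
Proof.
elim: b => [|d b IH] //=; rewrite !bin_val_cons size_map expnS.
have := expn_gt0 2 (size b); case: d => /=; rewrite ?mul1n ?mul0n; lia.
Qed.

(** The solutions of one instance may differ in length, whereas the register has a fixed one; the
    last [true] marks the end of the solution. *)
Definition pad (n : nat) (s : bits) : bits :=
  s ++ true :: nseq (n - (size s).+1) false.

Definition unpad (w : bits) : bits :=
  rev (drop (foldr (fun (b : bool) r => if b then 0 else r.+1) 0 (rev w)).+1 (rev w)).

Lemma unpadK n s : unpad (pad n s) = s.
Proof.
rewrite /unpad /pad rev_cat rev_cons rev_nseq cat_rcons.
set k := n - _.
have -> : foldr (fun (b : bool) r => if b then 0 else r.+1) 0
   (nseq k false ++ true :: rev s) = k by elim: k => //= k ->.
by rewrite drop_cat size_nseq ltnNge leqnSn /= subSnn /= drop0 revK.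
Qed.

Lemma size_pad n s : size s < n -> size (pad n s) = n.
Proof. by rewrite /pad size_cat /= size_nseq; lia. Qed.

Lemma poly_unpad X {eX : emb X} (w : X -> bits) : poly w -> poly (fun x => unpad (w x)).
Proof.
move=> pw; have pk : poly (fun u : bits =>
    foldr (fun (b : bool) r => if b then 0 else r.+1) 0 u).
  apply: (poly_foldr (h := fun _ _ => true)); poly_auto.
  by move=> _ s [] /=; rewrite !esz_nat (_ : esz true = 3) //; lia.
rewrite /unpad; apply: poly_rev; apply: poly_drop; first by poly_auto.
apply: poly_S; apply: (poly_comp pk); by poly_auto.
Qed.

Lemma SAT4_hard P : in_PLS P -> exists f g, @pls_reduction P SAT4_2FLIP f g.
Proof.
move=> [_ _ [ks sol_le] /poly_polytime[Gs pGs Gs_E] [start [/poly_polytime[Gi pGi Gi_E] solI]]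
  [val [/poly_polytime[Gv pGv Gv_E] valE]] [next [/poly_polytime[Gn pGn Gn_E] nextE]]].
pose enc (I : ls_inst P) : bits := ls_enc I.
have {}Gs_E I s : Gs (enc_pair (enc I) s) = [:: ls_sol I s] by apply: (Gs_E (I, s)).
have {}Gi_E I : Gi (enc I) = start I by apply: Gi_E.
have {}Gv_E I s : ls_sol I s -> Gv (enc_pair (enc I) s) = val I s.
  by move=> so; apply: (Gv_E (I, s)).
have {}Gn_E I s : ls_sol I s -> Gn (enc_pair (enc I) s) = enc_option (next I s).
  by move=> so; apply: (Gn_E (I, s)).
have [kv Hkv] := poly_esz pGv.
(* The additional bit makes room for the end marker of [pad]. *)
pose nW (e : bits) := (size e ^ ks + ks).+1.
(* The code of the pair of [e] and a solution [s] has [2 * size e + 1 + size s] bits. Its tree has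
   size at most four times that plus one, and the base of the bound [Hkv] adds two. *)
pose mW (e : bits) := (4 * (2 * size e + 1 + nW e) + 3) ^ kv.
pose dec e w := let s := unpad w in
  if head false (Gs (enc_pair e s)) then s else Gi e.
(* At a local optimum the string [w] itself is returned, not the padded form of the solution it
   denotes, so that strings which are not in padded form can be fixed points too. *)
pose Nx e w := if Gn (enc_pair e (dec e w)) is b :: s' then
  (if b then pad (nW e) s' else w) else w.
pose padv e w := let b := Gv (enc_pair e (dec e w)) in
  nseq (mW e - size b) false ++ b.
pose V e w := if ls_max P then padv e w else map negb (padv e w).
pose Kf z := V (unpair z).1 (unpair z).2 ++ Nx (unpair z).1 (unpair z).2.
have pn : poly nW by rewrite /nW; poly_auto.
have pm : poly mW by rewrite /mW; poly_auto.
have pe : poly (fun z => (unpair z).1).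
  by apply: poly_fst; apply: poly_unpair; exact: poly_id.
have pa : poly (fun z => (unpair z).2).
  by apply: poly_snd; apply: poly_unpair; exact: poly_id.
pose D z := dec (unpair z).1 (unpair z).2.
have pD : poly D.
  rewrite /D /dec; apply: poly_if.
  - apply: poly_head; first exact: poly_const.
    by apply: (poly_comp pGs); apply: poly_enc_pair => //; apply: poly_unpad.
  - exact: poly_unpad.
  exact: poly_comp pGi pe.
have pND (G : bits -> bits) : poly G -> poly (fun z => G (enc_pair (unpair z).1 (D z))).
  by move=> pG; apply: (poly_comp pG); apply: poly_enc_pair.
have pK : poly Kf.
  apply: poly_cat.
    have pv := pND _ pGv; pose bv z := Gv (enc_pair (unpair z).1 (D z)).
    have pbv : poly bv by [].
    have pp : poly (fun z => nseq (mW (unpair z).1 - size (bv z)) false ++ bv z).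
      apply: poly_cat => //; apply: poly_nseq; last exact: poly_const.
      by apply: poly_sub; [exact: poly_comp pm pe|exact: poly_size].
    rewrite /V; case: (ls_max P) => //.
    by apply: poly_map; [poly_auto|exact: pp].
  rewrite /Nx; apply: poly_caseseq; [exact: pND|by []|].
  apply: poly_if; [by poly_auto| |exact: poly_comp pa (poly_fst poly_id)].
  rewrite /pad; pose n' z := nW (unpair z).1.
  have pn' : poly n' by exact: poly_comp pn pe.
  apply: (poly_ext (f := fun p : bits * (bool * seq bool) => p.2.2 ++ true ::
     nseq (n' p.1 - (size p.2.2).+1) false)) => //.
  by poly_auto.
have [F [pF wfF leF fbF optF]] := local_search_sat pn pm pK.
pose f I : ls_inst SAT4_2FLIP := exist _ (F (enc I)) (wfF (enc I)).
pose g (I : ls_inst P) (s : bits) := dec (enc I) (take (nW (enc I)) s).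
have decsol I w : ls_sol I (dec (enc I) w).
  by rewrite /dec Gs_E Gi_E /=; case: ifP.
have sol_lt I s : ls_sol I s -> size s < nW (enc I).
  by move=> /sol_le; rewrite ltnS.
have decpad I s : ls_sol I s -> dec (enc I) (pad (nW (enc I)) s) = s.
  by move=> so; rewrite /dec unpadK Gs_E so.
have szp I w : size (padv (enc I) w) = mW (enc I).
  rewrite /padv size_cat size_nseq subnK // Gv_E //.
  have so := decsol I w; rewrite -(Gv_E _ _ so).
  have hs : size (Gv (enc_pair (enc I) (dec (enc I) w))) <
     esz (Gv (enc_pair (enc I) (dec (enc I) w))) by apply: size_esz.
  apply: leq_trans (ltnW hs) _; apply: leq_trans (Hkv _) _.
  rewrite /mW; move: (sol_lt _ _ so) => lts.
  have le : (esz (enc_pair (enc I) (dec (enc I) w))).+2 <=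
      4 * (2 * size (enc I) + 1 + nW (enc I)) + 3.
    have := esz_bits (enc_pair (enc I) (dec (enc I) w)).
    have -> : size (enc_pair (enc I) (dec (enc I) w)) =
        2 * size (enc I) + 1 + size (dec (enc I) w).
      rewrite /enc_pair size_cat /= addnS -addSn; congr (_ + _).
      by rewrite addn1; congr S; elim: (enc I) => //= b u ->; lia.
    by lia.
  by case: (kv) => // k; rewrite leq_exp2r.
have szV I w : size (V (enc I) w) = mW (enc I).
  by rewrite /V; case: (ls_max P); rewrite ?size_map szp.
have Vlt I w w' : (if ls_max P then
    ls_payoff I (dec (enc I) w) < ls_payoff I (dec (enc I) w')
    else ls_payoff I (dec (enc I) w') < ls_payoff I (dec (enc I) w)) ->
    bin_val (V (enc I) w) < bin_val (V (enc I) w').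
  have E u : bin_val (padv (enc I) u) = ls_payoff I (dec (enc I) u).
    by rewrite /padv bin_val_pad Gv_E // valE.
  rewrite -!E /V; case: (ls_max P) => // lt.
  have := bin_val_negb (padv (enc I) w); have := bin_val_negb (padv (enc I) w').
  have := bin_val_lt (padv (enc I) w); have := bin_val_lt (padv (enc I) w').
  by rewrite !szp; lia.
have NxE I w : Nx (enc I) w =
    if next I (dec (enc I) w) is Some s' then pad (nW (enc I)) s' else w.
  by rewrite /Nx Gn_E //; case: (next _ _).
have KE I w : Kf (enc_pair (enc I) w) = V (enc I) w ++ Nx (enc I) w.
  by rewrite /Kf unpairK.
have dK I w : drop (mW (enc I)) (Kf (enc_pair (enc I) w)) = Nx (enc I) w.
  by rewrite KE -(szV I w) drop_size_cat.
have tK I w : take (mW (enc I)) (Kf (enc_pair (enc I) w)) = V (enc I) w.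
  by rewrite KE -(szV I w) take_size_cat.
exists f, g; split.
- apply: (polytime_poly (G := fun w => enc_sat (F w))) => //.
  exact: poly_sat_enc.
- apply: (polytime_poly (G := fun z => D (enc_pair (unpair z).1
     (take (nW (unpair z).1) (unpair z).2)))).
    apply: (poly_comp pD); apply: poly_enc_pair => //; apply: poly_take => //.
    exact: poly_comp pn pe.
  by move=> [I s] _; rewrite unpairK /D unpairK.
- by move=> I s _; exact: decsol.
move=> I s opt; have [ss no] := local_opt_no_nbr opt.
have := optF (enc I) s _ ss no; rewrite dK NxE -/(g I s) => fix_.
have := nextE I (g I s) (decsol _ _); case E: (next I (g I s)) => [s'|] //.
move=> [tg bt]; rewrite E in fix_.
have so' : ls_sol I s' by case: tg.
(* The string read by [g] is its own successor, hence the padded form of [s']. So [s'] would be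
   better than itself. *)
have : g I s = s'.
  rewrite /g -fix_; first exact: decpad.
  move=> w sw; rewrite /= !dK !tK NxE; split.
    rewrite KE size_cat szV NxE; congr (_ + _).
    have := nextE I (dec (enc I) w) (decsol _ _).
    by case: (next _ _) => [t [[_ st _] _]|_] //; rewrite size_pad // sol_lt.
  have := nextE I (dec (enc I) w) (decsol _ _).
  case: (next _ _) => [t [[_ st _] bt']|_]; last by rewrite eqxx.
  by move=> _; apply: Vlt; rewrite decpad.
by move=> Eg; move: bt; rewrite Eg /better; case: (ls_max P); rewrite ltnn.
Qed.

Theorem theorem7 :
  PLS_complete SAT4_2FLIP /\
  exists (f : ls_inst FLIP -> ls_inst SAT4_2FLIP)
         (g : ls_inst FLIP -> bits -> bits),
    pls_reduction f g /\ tight f g.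
Proof.
split; last exact: FLIP_reduction.
by split; [exact: SAT4_in_PLS|exact: SAT4_hard].
Qed.
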